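(* Let $(x_0,u_0)$ be a Pareto optimal solution of the multiobjective Bolza problem $(\mathcal B)$. Assume: (a) for each $i\in\{1,\dots,l\}$, $f_i^0$ is continuous on $[0,T]\times\Omega\times U$; $D_{G,2}f_i^0(t,\xi,\zeta)$ exists for all $(t,\xi,\zeta)\in[0,T]\times\Omega\times U$; $D_{F,2}f_i^0(t,x_0(t),\zeta)$ exists for all $(t,\zeta)\in[0,T]\times U$; $(t,\zeta)\mapsto D_{F,2}f_i^0(t,x_0(t),\zeta)$ is continuous from $[0,T]\times U$ to $E^*$; and for all non-empty compact $K\subset\Omega$, $M\subset U$, $\sup_{[0,T]\times K\times M}\|D_{G,2}f_i^0(t,\xi,\zeta)\|_{\mathcal L}<+\infty$; (b) $f$ is continuous on $[0,T]\times\Omega\times U$; $D_{G,2}f(t,\xi,\zeta)$ exists for all $(t,\xi,\zeta)\in[0,T]\times\Omega\times U$; $D_{F,2}f(t,x_0(t),\zeta)$ exists for all $(t,\zeta)\in[0,T]\times U$; $(t,\zeta)\mapsto D_{F,2}f(t,x_0(t),\zeta)$ is continuous from $[0,T]\times U$ to $\mathcal L(E,E)$; and for all non-empty compact $K\subset\Omega$, $M\subset U$, $\sup_{[0,T]\times K\times M}\|D_{G,2}f(t,\xi,\zeta)\|_{\mathcal L}<+\infty$; (c) all $g_i^0$ and all $g^\alpha$ are Hadamard differentiable at $x_0(T)$; (d) each $h^\beta$ is continuous on a neighborhood of $x_0(T)$ and Hadamard differentiable at $x_0(T)$; (e) whenever $(c_\alpha)_{1\le\alpha\le m}\in\mathbb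 R_+^m$ and $(d_\beta)_{1\le\beta\le q}\in\mathbb R^q$ satisfy $c_\alpha g^\alpha(x_0(T))=0$ for all $\alpha$ and $\sum_{\alpha=1}^mc_\alpha D_Hg^\alpha(x_0(T))+\sum_{\beta=1}^qd_\beta D_Hh^\beta(x_0(T))=0$, then $c_\alpha=0$ for all $\alpha$ and $d_\beta=0$ for all $\beta$; (f) $U$ is a subset of a real normed vector space $Y$, and there exists $\hat t\in[0,T]$ such that $U$ is a neighborhood of $u_0(\hat t)$ in $Y$, $D_{G,3}f(\hat t,x_0(\hat t),u_0(\hat t))$ exists and is surjective. Then there exist $((\theta_i)_{1\le i\le l},(\lambda_\alpha)_{1\le\alpha\le m},(\mu_\beta)_{1\le\beta\le q},p)\in\mathbb R^l\times\mathbb R^m\times\mathbb R^q\times PC^1([0,T],E^* )$ satisfying the Pontryagin conditions (NN), (Si), (S$\ell$), (TC), (AE.B), (MP.B), (CH.B) listed in the context, and for every such tuple, $(\theta_i)_{1\le i\le l}\ne0$.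
   Context: Function spaces. Fix $T\in(0,+\infty)$. Let $Y$ be a Hausdorff space. A function $u:[0,T]\to Y$ is piecewise continuous if there is a subdivision $0=\tau_0<\tau_1<\dots<\tau_{k+1}=T$ such that $u$ is continuous on each $(\tau_i,\tau_{i+1})$, the right limits $u(\tau_i+)$ exist in $Y$ for $0\le i\le k$ and the left limits $u(\tau_i-)$ exist in $Y$ for $1\le i\le k+1$. $NPC^0([0,T],Y)$ is the set of piecewise continuous $u$ that are right continuous on $[0,T)$ and satisfy $u(T-)=u(T)$. If $Y$ is a real Banach space, $PC^1([0,T],Y)$ is the set of continuous $x:[0,T]\to Y$ for which there is a subdivision as before such that $x$ is continuously differentiable on each $(\tau_i,\tau_{i+1})$ and the one-sided limits $x'(\tau_i+)$ ($0\le i\le k$), $x'(\tau_i-)$ ($1\le i\le k+1$) exist in $Y$; for open $G\subset Y$, $PC^1([0,T],G)=\{x\in PC^1([0,T],Y): x([0,T])\subset G\}$. The extended derivative $\underline{d}x:[0,T]\to Y$ of such $x$ is $\underline{d}x(t)=x'(t)$ if $t\notin\{\tau_0,\dots,\tau_{k+1}\}$, $\underline{d}x(\tau_i)=x'(\tau_i+)$ for $0\le i\le k$, $\underline{d}x(T)=x'(T-)$. Differentials. For real normed spaces $X,Y$, $\mathcal L(X,Y)$ is the space of bounded linear maps with operator norm $\|\cdot\|_{\mathcal L}$ and $X^*=\mathcal L(X,\mathbb R)$. Let $G\subset X$ be non-empty open (or a neighborhood of the point considered), $\mathfrak f:G\to Y$, $x\in G$. $\mathfrak f$ is Gâteaux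 differentiable at $x$ if there is $D_G\mathfrak f(x)\in\mathcal L(X,Y)$ with $\lim_{t\to0+}\frac{\mathfrak f(x+th)-\mathfrak f(x)}{t}=D_G\mathfrak f(x)\cdot h$ for all $h\in X$; it is Hadamard differentiable at $x$ if there is $D_H\mathfrak f(x)\in\mathcal L(X,Y)$ such that for each compact $K\subset X$, $\lim_{t\to0+}\sup_{h\in K}\|\frac{\mathfrak f(x+th)-\mathfrak f(x)}{t}-D_H\mathfrak f(x)\cdot h\|=0$. $D_F\mathfrak f(x)$ is the Fréchet differential. $D_{G,k}$, $D_{F,k}$ denote partial Gâteaux/Fréchet differentials with respect to the $k$-th variable ($D_{G,3}f(t,\xi,\zeta)$ is the Gâteaux differential at $\zeta$ of $f(t,\xi,\cdot)$). Problem. $E$ is a real Banach space, $\Omega\subset E$ a non-empty open subset, $U$ a Hausdorff topological space, $\xi_0\in\Omega$, $l,m,q$ positive integers, $f:[0,T]\times\Omega\times U\to E$, $f_i^0:[0,T]\times\Omega\times U\to\mathbb R$, and $g_i^0,g^\alpha,h^\beta:\Omega\to\mathbb R$ ($1\le i\le l$, $1\le\alpha\le m$, $1\le\beta\le q$). The multiobjective Bolza problem $(\mathcal B)$ is: maximize $(J_1(x,u),\dots,J_l(x,u))$, $J_i(x,u)=g_i^0(x(T))+\int_0^Tf_i^0(t,x(t),u(t))\,dt$, over $x\in PC^1([0,T],\Omega)$, $u\in NPC^0([0,T],U)$ subject to $\underline{d}x(t)=f(t,x(t),u(t))$ for all $t\in[0,T]$, $x(0)=\xi_0$, $g^\alpha(x(T))\ge0$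 for all $\alpha$, $h^\beta(x(T))=0$ for all $\beta$. Pairs $(x,u)$ satisfying these constraints are admissible. An admissible $(\overline x,\overline u)$ is a Pareto optimal solution if there is no admissible $(x,u)$ with $J_i(x,u)\ge J_i(\overline x,\overline u)$ for all $i$ and $J_{i_0}(x,u)>J_{i_0}(\overline x,\overline u)$ for some $i_0$. Hamiltonian: $H_B:[0,T]\times\Omega\times U\times E^*\times\mathbb R^l\to\mathbb R$, $H_B(t,x,u,p,\theta)=\sum_{i=1}^l\theta_if_i^0(t,x,u)+p\cdot f(t,x,u)$. Pontryagin conditions for $(\theta=(\theta_i),(\lambda_\alpha),(\mu_\beta),p)$ at $(x_0,u_0)$: (NN) $((\theta_i)_i,(\lambda_\alpha)_\alpha,(\mu_\beta)_\beta)\ne 0$; (Si) $\theta_i\ge0$ for all $i$ and $\lambda_\alpha\ge 0$ for all $\alpha$; (S$\ell$) $\lambda_\alpha g^\alpha(x_0(T))=0$ for all $\alpha$; (TC) $\sum_{i=1}^l\theta_iD_Hg_i^0(x_0(T))+\sum_{\alpha=1}^m\lambda_\alpha D_Hg^\alpha(x_0(T))+\sum_{\beta=1}^q\mu_\beta D_Hh^\beta(x_0(T))=p(T)$; (AE.B) $\underline{d}p(t)=-D_{F,2}H_B(t,x_0(t),u_0(t),p(t),\theta)$ for all $t\in[0,T]$; (MP.B) $H_B(t,x_0(t),u_0(t),p(t),\theta)\ge H_B(t,x_0(t),\zeta,p(t),\theta)$ for all $t\in[0,T]$, $\zeta\in U$; (CH.B) $t\mapsto H_B(t,x_0(t),u_0(t),p(t),\theta)$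 is continuous on $[0,T]$. *)

(* Defs.v *)
From HB Require Import structures.
From mathcomp Require Import all_boot all_order all_algebra.
From mathcomp Require Import all_classical all_reals all_analysis.
Set Implicit Arguments.
Unset Strict Implicit.
Unset Printing Implicit Defensive.
Import Order.TTheory GRing.Theory Num.Theory.
Import numFieldNormedType.Exports.
Local Open Scope classical_set_scope.
Local Open Scope ring_scope.


Section BoundedLinear.
Context {R : realType} {V W : normedModType R}.

Definition bounded_linear : {pred V -> W} :=
  fun f => `[< linear f /\ continuous f >].

Lemma bounded_linear_submod : submod_closed bounded_linear.
Proof.
split=> [|a f g /asboolP[lf cf] /asboolP[lg cg]]; apply/asboolP; split.
- move=> a u v; have z x : (0 : V -> W) x = 0 by [].
  by rewrite !z scaler0 addr0.
- by move=> x; exact: cvg_cst.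
- move=> b u v; have z x : (a *: f + g) x = a *: f x + g x by [].
  rewrite !z lf lg !scalerDr -!addrA; congr (_ + _).
    by rewrite !scalerA mulrC.
  by rewrite addrCA.
- by move=> x; apply: cvgD; [apply: cvgZr; exact: cf|exact: cg].
Qed.

HB.instance Definition _ :=
  GRing.isSubmodClosed.Build R (V -> W) bounded_linear bounded_linear_submod.

End BoundedLinear.
Arguments bounded_linear {R} V W.

Record blin (R : realType) (V W : normedModType R) :=
  BLin { blin_fun :> V -> W ; _ : blin_fun \in bounded_linear V W }.

Section BlinLmodule.
Context {R : realType} (V W : normedModType R).

HB.instance Definition _ := [isSub for @blin_fun R V W].
HB.instance Definition _ := [Choice of blin V W by <:].
HB.instance Definition _ := [SubChoice_isSubLmodule of blin V W by <:].

Lemma blin_linear (f : blin V W) : linear f.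
Proof. by case: f => f /= /asboolP[]. Qed.

HB.instance Definition _ (f : blin V W) :=
  GRing.isLinear.Build R V W _ (blin_fun f) (@blin_linear f).

Lemma blin_continuous (f : blin V W) : continuous f.
Proof. by case: f => f /= /asboolP[]. Qed.

Definition opnorm (f : blin V W) : R :=
  sup [set `|f x| | x in [set x | `|x| <= 1]].

Lemma opnorm_has_sup (f : blin V W) :
  has_sup [set `|f x| | x in [set x | `|x| <= 1]].
Proof.
split; first by exists `|f 0|, 0 => //=; rewrite normr0.
have /(linear_bounded_continuous f)/bounded_funP/(_ 1)[M fM] :=
  @blin_continuous f.
by exists M => _ [x /= x1 <-]; exact: fM.
Qed.

Lemma opnorm_ub (f : blin V W) x : `|x| <= 1 -> `|f x| <= opnorm f.
Proof.
by move=> x1; apply: ub_le_sup; [exact: (opnorm_has_sup f).2|exists x].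
Qed.

Lemma opnorm_le (f : blin V W) M :
  (forall x, `|x| <= 1 -> `|f x| <= M) -> opnorm f <= M.
Proof.
move=> fM; apply: ge_sup; first exact: (opnorm_has_sup f).1.
by move=> _ [x x1 <-]; exact: fM.
Qed.

Lemma blinD (f g : blin V W) x : (f + g) x = f x + g x.
Proof. by []. Qed.

Lemma blinZ (a : R) (f : blin V W) x : (a *: f) x = a *: f x.
Proof. by []. Qed.

Lemma opnormD (f g : blin V W) : opnorm (f + g) <= opnorm f + opnorm g.
Proof.
apply: opnorm_le => x x1; rewrite blinD.
by rewrite (le_trans (ler_normD _ _))// lerD// opnorm_ub.
Qed.

Lemma opnormZ_le (a : R) (f : blin V W) : opnorm (a *: f) <= `|a| * opnorm f.
Proof.
apply: opnorm_le => x x1.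
by rewrite blinZ normrZ ler_wpM2l// opnorm_ub.
Qed.

Lemma opnormZ (a : R) (f : blin V W) : opnorm (a *: f) = `|a| * opnorm f.
Proof.
apply/eqP; rewrite eq_le opnormZ_le /=; have [->|a0] := eqVneq a 0.
  rewrite normr0 mul0r (le_trans (normr_ge0 ((0 *: f) 0)))//.
  by apply: opnorm_ub; rewrite normr0.
rewrite -ler_pdivlMl ?normr_gt0// -normfV.
by rewrite (le_trans _ (opnormZ_le _ _))// scalerA mulVf// scale1r.
Qed.

Lemma opnorm0_eq0 (f : blin V W) : opnorm f = 0 -> f = 0.
Proof.
move=> f0; apply/val_inj/funext => x /=.
have [->|x0] := eqVneq x 0; first by rewrite linear0.
have nx : `|x| != 0 by rewrite normr_eq0.
have : `|f (`|x|^-1 *: x)| <= 0.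
  by rewrite -f0 opnorm_ub// normrZ normfV normr_id mulVf.
rewrite normr_le0 linearZ/= scaler_eq0 invr_eq0 (negbTE nx)/=.
by move/eqP.
Qed.

HB.instance Definition _ := Lmodule_isNormed.Build R (blin V W)
  opnormD opnormZ opnorm0_eq0.

End BlinLmodule.

Section FunctionSpaces.
Context {R : realType}.
Implicit Types (T : R) (s : seq R).

(* A subdivision 0 = tau_0 < tau_1 < ... < tau_(k+1) = T is encoded by
   s = [:: tau_1; ...; tau_(k+1)], with [itv_partition 0 T s]. *)
Definition tau s (i : nat) : R := nth 0 (0 :: s) i.

(* For functions with values in a subset [U] of [Y] with the induced topology:
   the one-sided limits have to exist in [U]. *)
Definition NPC0 (Y : topologicalType) T (U : set Y) (u : R -> Y) : Prop :=
  [/\ forall t, t \in `[0, T] -> U (u t),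
      exists2 s, itv_partition 0 T s &
        forall i, (i < size s)%N ->
          [/\ {in `]tau s i, tau s i.+1[, continuous u},
              exists2 y, U y & u t @[t --> (tau s i)^'+] --> y
            & exists2 y, U y & u t @[t --> (tau s i.+1)^'-] --> y],
      forall t, t \in `[0, T[ -> u r @[r --> t^'+] --> u t
    & u r @[r --> T^'-] --> u T].

Section PC1.
Context {V : normedModType R}.

Definition PC1_along T s (x : R -> V) : Prop :=
  [/\ itv_partition 0 T s, {within `[0, T], continuous x} &
      forall i, (i < size s)%N ->
        [/\ {in `]tau s i, tau s i.+1[, forall t, derivable x t 1},
            {in `]tau s i, tau s i.+1[, continuous (derive1 x)},
            cvg (derive1 x t @[t --> (tau s i)^'+])
          & cvg (derive1 x t @[t --> (tau s i.+1)^'-])]].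

Definition PC1 T (G : set V) (x : R -> V) : Prop :=
  (exists s, PC1_along T s x) /\ (forall t, t \in `[0, T] -> G (x t)).

Definition ext_derive_along T s (x : R -> V) (t : R) : V :=
  if t \notin 0 :: s then derive1 x t
  else if t < T then lim (derive1 x r @[r --> t^'+])
  else lim (derive1 x r @[r --> T^'-]).

(* The choice of the subdivision does not matter: see [ext_deriveE]. *)
Definition ext_derive T (x : R -> V) : R -> V :=
  ext_derive_along T (xget [::] [set s | PC1_along T s x]) x.

Lemma itv_partition_mem (a b t : R) s : itv_partition a b s ->
  a <= t <= b -> t \notin a :: s ->
  exists2 i, (i < size s)%N & nth 0 (a :: s) i < t < nth 0 (a :: s) i.+1.
Proof.
elim: s a => [|c s IH] a abs /andP[a_t t_b].
  by rewrite inE -(itv_partition_nil abs) in t_b *; rewrite eq_le a_t t_b.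
rewrite inE negb_or => /andP[ta tcs].
have {}a_t : a < t by rewrite lt_neqAle eq_sym ta.
have [t_c|c_t] := ltP t c; first by exists 0%N => //=; rewrite a_t.
have [i si ti] := IH c (itv_partition_cons abs) (introT andP (conj c_t t_b)) tcs.
by exists i.+1.
Qed.

Lemma ext_derive_alongE T s (x : R -> V) (t : R) :
  PC1_along T s x -> t \in `[0, T] ->
  ext_derive_along T s x t = if t < T then lim (derive1 x r @[r --> t^'+])
                             else lim (derive1 x r @[r --> T^'-]).
Proof.
move=> [sT _ xs]; rewrite in_itv/= => t0T; rewrite /ext_derive_along.
case: ifPn => // ts; have [i si /andP[it ti]] := itv_partition_mem sT t0T ts.
have tT : t < T.
  rewrite lt_neqAle (andP t0T).2 andbT; apply: contra ts => /eqP ->.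
  by case: sT => _ /eqP <-; exact: mem_last.
have [_ x'c _ _] := xs _ si; rewrite tT; apply/esym/cvg_lim => //.
by apply: cvg_at_right_filter; apply: x'c; rewrite in_itv/= it.
Qed.

Lemma ext_deriveE T s (x : R -> V) (t : R) : PC1_along T s x ->
  t \in `[0, T] -> ext_derive T x t = ext_derive_along T s x t.
Proof.
move=> xs t0T; rewrite /ext_derive; case: xgetP => [s' _ xs'|/(_ s)//].
by rewrite !ext_derive_alongE.
Qed.

End PC1.
End FunctionSpaces.

Section Differentials.
Context {R : realType} {V W : normedModType R}.
Implicit Types (f : V -> W) (x : V) (L : blin V W).

Definition is_Gdiff f x L : Prop :=
  forall h : V, t^-1 *: (f (x + t *: h) - f x) @[t --> 0^'+] --> L h.

(* The supremum is over a nonempty set, since [ereal_sup set0 = -oo]. *)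
Definition is_Hdiff f x L : Prop :=
  forall K : set V, K !=set0 -> compact K ->
    ereal_sup [set (`|t^-1 *: (f (x + t *: h) - f x) - L h|)%:E | h in K]
      @[t --> (0 : R)^'+] --> 0%E.

Definition is_Fdiff f x L : Prop := is_diff x f L.

Definition Gdifferentiable f x : Prop := exists L, is_Gdiff f x L.
Definition Hdifferentiable f x : Prop := exists L, is_Hdiff f x L.
Definition Fdifferentiable f x : Prop := exists L, is_Fdiff f x L.

Definition DG f x : blin V W := get [set L | is_Gdiff f x L].
Definition DH f x : blin V W := get [set L | is_Hdiff f x L].
Definition DF f x : blin V W := get [set L | is_Fdiff f x L].

End Differentials.


Section Bolza.
Context {R : realType} {E Y : normedModType R} {l m q : nat}.
Variables (T : R) (Omega : set E) (U : set Y) (xi0 : E).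
Variables (f : R -> E -> Y -> E) (f0 : 'I_l -> R -> E -> Y -> R).
Variables (g0 : 'I_l -> E -> R) (g : 'I_m -> E -> R) (h : 'I_q -> E -> R).

Definition Jobj (i : 'I_l) (x : R -> E) (u : R -> Y) : R :=
  g0 i (x T) + \int[lebesgue_measure]_(t in `[0, T]) f0 i t (x t) (u t).

Definition admissible (x : R -> E) (u : R -> Y) : Prop :=
  [/\ PC1 T Omega x, NPC0 T U u,
      forall t, t \in `[0, T] -> ext_derive T x t = f t (x t) (u t),
      x 0 = xi0
    & (forall a, 0 <= g a (x T)) /\ (forall b, h b (x T) = 0)].

Definition Pareto_optimal (x0 : R -> E) (u0 : R -> Y) : Prop :=
  admissible x0 u0 /\
  ~ exists x u, [/\ admissible x u,
      forall i, Jobj i x0 u0 <= Jobj i x u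
    & exists i0, Jobj i0 x0 u0 < Jobj i0 x u].

Definition Hamiltonian (t : R) (x : E) (u : Y) (p : blin E R)
    (theta : 'rV[R]_l) : R :=
  \sum_i theta 0 i * f0 i t x u + p (f t x u).

Definition Pontryagin (x0 : R -> E) (u0 : R -> Y) (theta : 'rV[R]_l)
    (lambda : 'rV[R]_m) (mu : 'rV[R]_q) (p : R -> blin E R) : Prop :=
  [/\ (theta, lambda, mu) != 0,
      (forall i, 0 <= theta 0 i) /\ (forall a, 0 <= lambda 0 a),
      forall a, lambda 0 a * g a (x0 T) = 0,
      \sum_i theta 0 i *: DH (g0 i) (x0 T)
        + \sum_a lambda 0 a *: DH (g a) (x0 T)
        + \sum_b mu 0 b *: DH (h b) (x0 T) = p T
    & [/\ forall t, t \in `[0, T] -> ext_derive T p t =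
            - DF (fun xi => Hamiltonian t xi (u0 t) (p t) theta) (x0 t),
          forall t zeta, t \in `[0, T] -> U zeta ->
            Hamiltonian t (x0 t) zeta (p t) theta
              <= Hamiltonian t (x0 t) (u0 t) (p t) theta
        & {within `[0, T], continuous
            (fun t => Hamiltonian t (x0 t) (u0 t) (p t) theta)}]].

Definition regular_along {F : normedModType R} (x0 : R -> E)
    (phi : R -> E -> Y -> F) : Prop :=
  [/\ {within `[0, T] `*` Omega `*` U, continuous
        (fun z : R * E * Y => phi z.1.1 z.1.2 z.2)},
      forall t xi zeta, t \in `[0, T] -> Omega xi -> U zeta ->
        Gdifferentiable (phi t ^~ zeta) xi,
      forall t zeta, t \in `[0, T] -> U zeta ->
        Fdifferentiable (phi t ^~ zeta) (x0 t),
      {within `[0, T] `*` U, continuous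
        (fun z : R * Y => DF (phi z.1 ^~ z.2) (x0 z.1))}
    & forall (K : set E) (M : set Y), K !=set0 -> M !=set0 ->
        compact K -> compact M -> K `<=` Omega -> M `<=` U ->
        has_ubound [set `|DG (phi z.1.1 ^~ z.2) z.1.2|
                   | z in `[0, T] `*` K `*` M]].

End Bolza.

(* Main.v *)
(* Multiple needle variations: on short intervals stacked after instants t_k, of
   lengths a_k, the control u0 is replaced by constants v_k. If 0 <= a_k <= C s, every
   endpoint functional (cost, inequality or equality constraint) changes by
   sum_k a_k w(t_k, v_k) + o(s), uniformly in the lengths. Since the differential in
   the state is continuous only along x0, the remainder of the state equation is small
   only pointwise in t, and its integral is controlled by dominated convergence.
   An adjoint arc p_j for each functional j, ending at its Hadamard differential, gives
     w_j(t, v) = p_j(t) (f(t, x0, v) - f(t, x0, u0)) + (f0_j(t, x0, v) - f0_j(t, x0, u0)).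

   Let K be the convex cone of the combinations of effects w(t, v) minus the slacks. If
   K is not dense, a nonzero vector c with c <= 0 on K yields the multipliers and
   p = sum_j c_j p_j. If K is dense, finitely many needles increase all costs and active
   constraints and move the equality constraints in each direction +-e_b; as endpoints
   depend continuously on the lengths, the Poincare-Miranda theorem provides lengths
   for which the equality constraints hold exactly, against Pareto optimality.

   If theta = 0, then u0(t) is an interior maximum of p(t) o f(t, x0(t), .) at the
   instant t of hypothesis (f), so p(t) = 0 by surjectivity, p = 0 after t by Gronwall,
   and p(T) = 0 contradicts (e). *)

(* The hypotheses bound the differential in the state on compact sets only, and [E] need not be
   locally compact. A tube around the trajectory on which the data are Lipschitz is therefore found
   by contradiction: a sequence of bad points approaching the trajectory forms, together with it, a
   compact set. Hadamard differentiability is used in the same way, along directions that approach a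
   compact set of finite combinations. Endpoints depend continuously on the needle lengths, with a
   first-order expansion at zero length only. No inverse function theorem applies to such a map,
   whereas the Poincare-Miranda theorem asks for continuity and for signs on opposite faces of a
   cube. Outside the tube the equation is modified by a radial retraction, so that every needle
   control has a global trajectory; short needles never meet the modification. Integrals of vector
   valued functions are replaced by primitives, and integral inequalities by comparisons of
   derivatives off a finite set. *)
Require Import Defs.
From HB Require Import structures.
From mathcomp Require Import all_boot all_order all_algebra all_fingroup.
From mathcomp Require Import all_classical all_reals all_analysis.
From mathcomp Require Import measurable_realfun.
From mathcomp Require Import zify ring lra.
Set Implicit Arguments.
Unset Strict Implicit.
Unset Printing Implicit Defensive.
Import Order.TTheory GRing.Theory Num.Theory.
Import numFieldNormedType.Exports.
Local Open Scope classical_set_scope.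
Local Open Scope ring_scope.

(** * The Poincare-Miranda theorem *)

Section Cup.
Variables (X : Type).
Implicit Types (a : nat -> X -> int) (c : X -> int) (v : nat -> X).

Definition skip v m := fun j => v (if (j < m)%N then j else j.+1).

(* The cochain d(a_0) u ... u d(a_(i-1)) u c u d(a_(i+1)) u ... u d(a_(n-1)). *)
Definition cup a c n i v :=
  (\prod_(0 <= j < i) (a j (v j.+1) - a j (v j))) * c (v i)
    * \prod_(i.+1 <= j < n) (a j (v j) - a j (v j.-1)).

(** In the next two lemmas each inner face of a simplex contributes two neighbouring terms [r j] and
    [r j.+1], so that only the extreme terms survive the alternating sum. *)
Lemma alternating_telescope (r : nat -> int) m n : (m <= n)%N ->
  \sum_(m <= j < n) (-1) ^+ j * (r j + r j.+1) =
    (-1) ^+ m * r m - (-1) ^+ n * r n.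
Proof.
elim: n => [|n IH] mn.
  by move: mn; rewrite leqn0 => /eqP ->; rewrite big_geq// subrr.
move: mn; rewrite leq_eqVlt => /predU1P[->|mn]; first by rewrite big_geq// subrr.
by rewrite big_nat_recr//= IH// exprS; ring.
Qed.

(** Omitting vertex [m.+1] with [m < i] merges two edges in factor [m], whose increment becomes the
    sum of those over the edges [m] and [m.+1]. The face splits as [r m + r m.+1], and the sum
    telescopes to the term in which no factor is shifted. *)
Lemma cupd_low a c n i v : (i < n)%N ->
  \sum_(0 <= m < i.+1) (-1) ^+ m * cup a c n i (skip v m) =
  (-1) ^+ i * ((\prod_(0 <= j < i) (a j (v j.+1) - a j (v j))) * c (v i.+1)
    * \prod_(i.+1 <= j < n) (a j (v j.+1) - a j (v j))).
Proof.
move=> i_n; pose d j p := a j (v p.+1) - a j (v p).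
(* Factors before [m] keep their own edge, those from [m] to [i] take the next one. *)
pose r m := (\prod_(0 <= j < m) d j j) * (\prod_(m <= j < i) d j j.+1)
  * (c (v i.+1) * \prod_(i.+1 <= j < n) d j j).
have up m : (m <= i)%N ->
  \prod_(i.+1 <= j < n) (a j (skip v m j) - a j (skip v m j.-1)) =
     \prod_(i.+1 <= j < n) d j j.
  move=> mi; apply: eq_big_nat => j /andP[ij _].
  rewrite /skip !ifF; [|lia|lia].
  by rewrite prednK; last lia.
have cup0 : cup a c n i (skip v 0) = r 0%N.
  by rewrite /cup /r up// (big_geq (leqnn 0)) mul1r mulrA.
have cupS m : (m < i)%N -> cup a c n i (skip v m.+1) = r m + r m.+1.
  move=> mi; rewrite /cup up// /r [skip v m.+1 i]/skip ltnS leqNgt mi/= -mulrA -mulrDl.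
  congr (_ * _).
  rewrite [LHS](big_cat_nat (n := m))//=; last exact: ltnW.
  rewrite (big_ltn mi) [X in _ = _ + X * _]big_nat_recr//= -[RHS]addrC -mulrA -mulrDr.
  congr (_ * _).
    by apply: eq_big_nat => j /andP[_ jm]; rewrite /skip !ifT//; lia.
  rewrite (big_ltn mi) -mulrDl; congr (_ * _).
    by rewrite /skip ltnn ltnSn /d; ring.
  by apply: eq_big_nat => j /andP[jm _]; rewrite /skip !ifF//; lia.
rewrite big_nat_recl// expr0 mul1r cup0.
under eq_big_nat => m /andP[_ mi] do rewrite exprS mulN1r cupS// mulNr.
rewrite sumrN alternating_telescope// expr0 mul1r opprB addrC subrK.
by rewrite /r (big_geq (leqnn i)) mulr1 mulrA.
Qed.

(** Mirror image of [cupd_low]: the omitted vertex lies after [c], the factors between [i] and [m]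
    take the previous edge, and the surviving term carries [c (v i)]. *)
Lemma cupd_high a c n i v : (i < n)%N ->
  \sum_(i.+1 <= m < n.+1) (-1) ^+ m * cup a c n i (skip v m) =
  - (-1) ^+ i * ((\prod_(0 <= j < i) (a j (v j.+1) - a j (v j))) * c (v i)
    * \prod_(i.+1 <= j < n) (a j (v j.+1) - a j (v j))).
Proof.
move=> i_n; pose d j p := a j (v p.+1) - a j (v p).
pose r m := (\prod_(0 <= j < i) d j j) * c (v i)
  * ((\prod_(i.+1 <= j < m) d j j.-1) * (\prod_(m <= j < n) d j j)).
have lo m : (i < m)%N ->
  \prod_(0 <= j < i) (a j (skip v m j.+1) - a j (skip v m j)) =
     \prod_(0 <= j < i) d j j.
  by move=> mi; apply: eq_big_nat => j /andP[_ ji]; rewrite /skip !ifT//; lia.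
have cupn : cup a c n i (skip v n) = r n.
  rewrite /cup /r lo// (big_geq (leqnn n)) mulr1 {1}/skip i_n; congr (_ * _).
  apply: eq_big_nat => j /andP[ij jn]; rewrite /skip !ifT; [|lia|lia].
  by rewrite /d prednK; last lia.
have cupS m : (i < m < n)%N -> cup a c n i (skip v m) = r m + r m.+1.
  move=> /andP[im mn]; rewrite /cup lo// /r [skip v m i]/skip im -mulrDr.
  congr (_ * _).
  rewrite (big_cat_nat (n := m))//=; last exact: ltnW.
  rewrite (big_ltn mn) big_nat_recr//= (big_ltn mn) -!mulrA -mulrDr.
  congr (_ * _).
    apply: eq_big_nat => j /andP[ij jm]; rewrite /skip !ifT; [|lia|lia].
    by rewrite /d prednK; last lia.
  rewrite -mulrDl; congr (_ * _).
    rewrite /skip ltnn ifT; last lia.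
    by rewrite /d prednK; [ring|lia].
  apply: eq_big_nat => j /andP[jm _]; rewrite /skip !ifF; [|lia|lia].
  by rewrite prednK//; lia.
rewrite big_nat_recr//= cupn.
under eq_big_nat => m imn do rewrite cupS//.
rewrite alternating_telescope// subrK exprS mulN1r.
by rewrite /r (big_geq (leqnn i.+1)) mul1r.
Qed.

(** Leibniz rule for the cup product: the increments of the labels are themselves coboundaries, so
    only the differential of [c] remains. *)
Lemma cupd a c n i v : (i < n)%N ->
  \sum_(0 <= m < n.+1) (-1) ^+ m * cup a c n i (skip v m) =
  (-1) ^+ i * ((\prod_(0 <= j < i) (a j (v j.+1) - a j (v j)))
    * (c (v i.+1) - c (v i)) * \prod_(i.+1 <= j < n) (a j (v j.+1) - a j (v j))).
Proof.
move=> i_n; rewrite (big_cat_nat (n := i.+1))//=; last exact: ltnW.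
by rewrite cupd_low// cupd_high//; ring.
Qed.

End Cup.

(** * Signed count of the simplices of Kuhn's triangulation *)

Section Kuhn.
Variables (n k : nat).
Notation vertex := {ffun 'I_n.+1 -> nat}.
Notation cell := {ffun 'I_n.+1 -> 'I_k.+1}.
Implicit Types (z : cell) (s : 'S_n.+1) (om : (nat -> vertex) -> int).

(* The vertices of the simplex of Kuhn's triangulation in which the coordinate
   [p] is increased at time [s p]. *)
Definition path_from (x : vertex) s (j : nat) : vertex :=
  [ffun p => (x p + (s p < j))%N].

Definition corner z : vertex := [ffun p => z p : nat].

(** Exchanging the coordinates increased at the times [m.-1] and [m] alters the path at vertex [m]
    only, which the face omits, and reverses the sign. Faces with an inner vertex omitted thus
    cancel in pairs inside a cell. *)
Lemma Kuhn_swap om z m : (0 < m <= n)%N ->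
  (forall v w, (forall j, (j <= n)%N -> v j = w j) -> om v = om w) ->
  \sum_(s : 'S_n.+1) (-1) ^+ s * om (skip (path_from (corner z) s) m) = 0.
Proof.
move=> /andP[m0 mn] omE; set S := (X in X = _); suff : S = - S by lia.
have im : (m < n.+1)%N by []. have im' : (m.-1 < n.+1)%N by lia.
pose t := tperm (Ordinal im') (Ordinal im).
rewrite {1}/S (reindex_inj (mulIg t))/= -sumrN; apply: eq_bigr => s _.
rewrite odd_permM odd_tperm -val_eqE/=.
have -> : m.-1 != m by lia.
rewrite signr_addb mulrN1 mulNr; congr (- (_ * _)); apply: omE => j jn.
rewrite /skip; apply/ffunP => p; rewrite !ffunE permM; congr (_ + nat_of_bool _)%N.
set j' := (if _ then _ else _).
have j'm : j' != m by rewrite /j'; case: ifP; lia.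
move: j'm; rewrite /t; case: tpermP => [->|->|]//=; lia.

Qed.

(** The cycle sending 0 to [n] and every other [i] to [i.-1]. As a lifted permutation it has a known
    parity, that of [n]. *)
Definition cyc : 'S_n.+1 := lift_perm ord0 ord_max 1.

Lemma cycE (i : 'I_n.+1) : cyc i = (if i == 0%N :> nat then n else i.-1) :> nat.
Proof.
rewrite /cyc; case: (unliftP ord0 i) => [j ->|->]; last by rewrite lift_perm_id.
by rewrite lift_perm_lift perm1 lift_max lift0.
Qed.

(** The face opposite to the first vertex in one cell is the face opposite to the last vertex in a
    neighbouring cell: the coordinate [p] increased first in the former is increased last in the
    latter. The two orders differ by [cyc], whence the sign. *)
Lemma Kuhn_shift om :
  (forall v w, (forall j, (j <= n)%N -> v j = w j) -> om v = om w) ->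
  (forall (v : nat -> vertex) p, (forall j, (j <= n)%N -> v j p = 0%N) -> om v = 0) ->
  (forall (v : nat -> vertex) p, (forall j, (j <= n)%N -> (k <= v j p)%N) -> om v = 0) ->
  \sum_(z : cell) \sum_(s : 'S_n.+1) (-1) ^+ s * om (skip (path_from (corner z) s) 0) =
  (-1) ^+ n * \sum_(z : cell) \sum_(s : 'S_n.+1) (-1) ^+ s * om (path_from (corner z) s).
Proof.
move=> omE om0 omk.
rewrite exchange_big [in RHS]exchange_big mulr_sumr/=.
rewrite (reindex_inj (mulIg cyc^-1%g))/=; apply: eq_bigr => s _.
rewrite odd_permM odd_permV /cyc odd_lift_perm odd_perm1 -/cyc/= addbF.
rewrite -!mulr_sumr signr_addb signr_odd -mulrA mulrCA; congr (_ * (_ * _)).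
pose p := (s^-1)%g ord_max.
have sp : s p = ord_max by rewrite permKV.
(* The neighbour in direction [p] is taken cyclically to have a bijection of the cells. Where it
   wraps around, both faces lie on the boundary and [om] vanishes. *)
pose f z : cell := [ffun q => if q == p then ordS (z q) else z q].
have f_inj : injective f.
  move=> z z' /ffunP fz; apply/ffunP => q; have := fz q; rewrite !ffunE.
  by case: eqP => // _ /ordS_inj.
rewrite [RHS](reindex_inj f_inj)/=; apply: eq_bigr => z _.
have vE j q : (j <= n)%N -> skip (path_from (corner z) (s * cyc^-1)) 0 j q =
    ((if q == p then (z q).+1 else z q) + (s q < j))%N.
  move=> jn; rewrite /skip !ffunE permM.
  have sq : cyc ((cyc^-1)%g (s q)) = s q by rewrite permKV.
  have := cycE ((cyc^-1)%g (s q)); rewrite sq; move: (cyc^-1 _)%g => i si.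
  have [qp|qp] := eqVneq q p.
    have i0 : i = 0%N :> nat.
      by move: si; rewrite qp sp/=; case: eqP => //; have := ltn_ord i; lia.
    rewrite i0 qp sp/= addn1 ltnNge jn addn0.
    by [].
  have i0 : i != 0%N :> nat.
    apply: contraNneq qp => i0; rewrite i0 eqxx in si.
    by apply/eqP/(can_inj (permK s)); rewrite sp; exact: val_inj.
  move: si i0; case: (nat_of_ord i) => [|i']/= -> // _.

have [zk|zk] := eqVneq (z p : nat) k.
  rewrite (omk _ p) ?(om0 _ p)// => j jn.
    by rewrite !ffunE eqxx/= zk modnn sp/= ltnNge jn.
  by rewrite vE// eqxx zk; lia.
apply: omE => j jn; apply/ffunP => q; rewrite vE// !ffunE.
case: eqP => // -> /=; rewrite modn_small//; have := ltn_ord (z p); lia.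
Qed.

(** Inner faces cancel within a cell by [Kuhn_swap], first and last faces of neighbouring cells by
    [Kuhn_shift]. *)
Lemma Kuhn_Stokes om :
  (forall v w, (forall j, (j <= n)%N -> v j = w j) -> om v = om w) ->
  (forall (v : nat -> vertex) p, (forall j, (j <= n)%N -> v j p = 0%N) -> om v = 0) ->
  (forall (v : nat -> vertex) p, (forall j, (j <= n)%N -> (k <= v j p)%N) -> om v = 0) ->
  \sum_(z : cell) \sum_(s : 'S_n.+1) (-1) ^+ s *
    \sum_(0 <= m < n.+2) (-1) ^+ m * om (skip (path_from (corner z) s) m) = 0.
Proof.
move=> omE om0 omk.
transitivity (\sum_(0 <= m < n.+2) (-1) ^+ m * \sum_(z : cell) \sum_(s : 'S_n.+1)
    (-1) ^+ s * om (skip (path_from (corner z) s) m)).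
  under [RHS]eq_bigr => m _ do rewrite mulr_sumr.
  rewrite [RHS]exchange_big/=; apply: eq_bigr => z _.
  under [RHS]eq_bigr => m _ do rewrite mulr_sumr.
  rewrite [RHS]exchange_big/=; apply: eq_bigr => s _.
  by rewrite mulr_sumr; apply: eq_bigr => m _; rewrite mulrCA.
rewrite big_nat_recl// big_nat_recr//= [X in _ + (X + _)]big_nat.
rewrite [X in _ + (X + _)]big1 ?add0r => [|m mn].
  rewrite mul1r Kuhn_shift// exprS mulN1r mulNr.
  have -> : \sum_(z : cell) \sum_(s : 'S_n.+1) (-1) ^+ s * om (skip (path_from (corner z) s) n.+1) =
      \sum_(z : cell) \sum_(s : 'S_n.+1) (-1) ^+ s * om (path_from (corner z) s).
    apply: eq_bigr => z _; apply: eq_bigr => s _; congr (_ * _).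
    by apply: omE => j jn; rewrite /skip ltnS jn.
  by rewrite subrr.
by rewrite big1 ?mulr0// => z _; apply: Kuhn_swap.
Qed.

(* The signed sum over all simplices of the products of the increments of the labels
   depends only on the boundary behaviour of the labels: replacing one label changes
   the summand by a coboundary, which vanishes by Stokes' formula. For the labels
   [x p != 0] the sum is 1, so it has a nonzero term for any other labels. *)
Definition Kuhn_sum (a : nat -> vertex -> int) :=
  \sum_(z : cell) \sum_(s : 'S_n.+1) (-1) ^+ s *
    let v := path_from (corner z) s in
    \prod_(0 <= j < n.+1) (a j (v j.+1) - a j (v j)).

(** The upper condition reads [k <= x p] because cells with a corner coordinate [k] protrude from
    the grid by one unit. *)
Definition PM_labels (a : nat -> vertex -> int) :=
  forall (p : 'I_n.+1) (x : vertex), (x p = 0%N -> a p x = 0) /\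
                                     ((k <= x p)%N -> a p x = 1).

(** Up to sign the summand is the coboundary of [cup a c n.+1 i]. On a boundary face of direction
    [p] the label [a p] is constant and its increment kills the cochain; for [p = i] the factor [c]
    does. *)
Lemma Kuhn_sum_update a c i : (i <= n)%N -> PM_labels a ->
  (forall (p : 'I_n.+1) (x : vertex), p = i :> nat ->
     x p = 0%N \/ (k <= x p)%N -> c x = 0) ->
  \sum_(z : cell) \sum_(s : 'S_n.+1) (-1) ^+ s *
    (let v := path_from (corner z) s in
     (\prod_(0 <= j < i) (a j (v j.+1) - a j (v j))) * (c (v i.+1) - c (v i)) *
     \prod_(i.+1 <= j < n.+1) (a j (v j.+1) - a j (v j))) = 0.
Proof.
move=> i_n aP cP; pose om := cup a c n.+1 i.
apply: (mulfI (x := (-1) ^+ i)); first by rewrite signr_eq0.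
rewrite mulr0 -[RHS](@Kuhn_Stokes om).
- rewrite mulr_sumr; apply: eq_bigr => z _; rewrite mulr_sumr.
  by apply: eq_bigr => s _; rewrite /om cupd// mulrCA.
- move=> v w vw; rewrite /om /cup vw//; congr (_ * _ * _).
    by apply: eq_big_nat => j /andP[_ ji]; rewrite !vw//; lia.
  by apply: eq_big_nat => j /andP[ij jn]; rewrite !vw//; lia.
- move=> v p v0; have pn : (p <= n.+1)%N by exact: ltnW.
  have [ip|pi|pi] := ltngtP i p.
  + rewrite /om /cup (@big_cat_nat _ _ _ p i.+1 n.+1)//=.
    rewrite (big_ltn (ltn_ord p)) !(proj1 (aP p _)); first by rewrite subrr !(mul0r, mulr0).
      by apply: v0; lia.
    by apply: v0; have := ltn_ord p; lia.
  + rewrite /om /cup (@big_cat_nat _ _ _ p 0 i xpredT _ (leq0n _) (ltnW pi))/=.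
    rewrite (big_ltn pi) !(proj1 (aP p _)); first by rewrite subrr !(mul0r, mulr0).
      by apply: v0; lia.
    by apply: v0; have := ltn_ord p; lia.
  + by rewrite /om /cup (cP p) ?mulr0 ?mul0r//; left; rewrite v0.
- move=> v p v0; have pn : (p <= n.+1)%N by exact: ltnW.
  have [ip|pi|pi] := ltngtP i p.
  + rewrite /om /cup (@big_cat_nat _ _ _ p i.+1 n.+1)//=.
    rewrite (big_ltn (ltn_ord p)) !(proj2 (aP p _)); first by rewrite subrr !(mul0r, mulr0).
      by apply: v0; lia.
    by apply: v0; have := ltn_ord p; lia.
  + rewrite /om /cup (@big_cat_nat _ _ _ p 0 i xpredT _ (leq0n _) (ltnW pi))/=.
    rewrite (big_ltn pi) !(proj2 (aP p _)); first by rewrite subrr !(mul0r, mulr0).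
      by apply: v0; lia.
    by apply: v0; have := ltn_ord p; lia.
  + by rewrite /om /cup (cP p) ?mulr0 ?mul0r//; right; rewrite v0.
Qed.

Lemma Kuhn_sum_labels a b : PM_labels a -> PM_labels b -> Kuhn_sum a = Kuhn_sum b.
Proof.
(* Labels are exchanged one at a time: [h r] uses [b] below [r]. Consecutive sums differ by an
   instance of [Kuhn_sum_update], with [c] the difference of the two labels. *)
move=> aP bP; pose h r j := if (j < r)%N then b j else a j.
have hP r : PM_labels (h r) by move=> p x; rewrite /h; case: ifP.
suff step r : (r <= n)%N -> Kuhn_sum (h r) = Kuhn_sum (h r.+1).
  have h0 : Kuhn_sum a = Kuhn_sum (h 0%N).
    by apply: eq_bigr => z _; apply: eq_bigr => s _; congr (_ * _).
  have hr r : (r <= n.+1)%N -> Kuhn_sum a = Kuhn_sum (h r).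
    elim: r => [_|r IH rn]; first exact: h0.
    by rewrite IH; [exact: step|exact: ltnW].
  rewrite (hr n.+1 (leqnn _)); apply: eq_bigr => z _; apply: eq_bigr => s _; congr (_ * _) => /=.
  by apply: eq_big_nat => j /andP[_ jn]; rewrite /h jn.
move=> rn; apply/eqP; rewrite -subr_eq0 /Kuhn_sum -sumrB.
under eq_bigr => z _ do rewrite -sumrB.
rewrite -[X in _ == X](@Kuhn_sum_update (h r) (fun x => a r x - b r x) r)//; last first.
  move=> p x pr [x0|xk].
    by rewrite -pr (proj1 (aP p x)) ?(proj1 (bP p x))// subrr.
  by rewrite -pr (proj2 (aP p x)) ?(proj2 (bP p x))// subrr.
apply/eqP/eq_bigr => z _; apply: eq_bigr => s _; rewrite -mulrBr; congr (_ * _).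
set v := path_from _ _; rewrite /= [X in X - _](@big_cat_nat _ _ _ r)//=; last exact: leqW.
rewrite [X in _ - X](@big_cat_nat _ _ _ r)//=; last exact: leqW.
have rn1 : (r < n.+1)%N by [].
rewrite !(big_ltn rn1).
have -> : \prod_(0 <= j < r) (h r.+1 j (v j.+1) - h r.+1 j (v j)) =
          \prod_(0 <= j < r) (h r j (v j.+1) - h r j (v j)).
  by apply: eq_big_nat => j /andP[_ jr]; rewrite /h ltnS jr ltnW.
have -> : \prod_(r.+1 <= j < n.+1) (h r.+1 j (v j.+1) - h r.+1 j (v j)) =
          \prod_(r.+1 <= j < n.+1) (h r j (v j.+1) - h r j (v j)).
  by apply: eq_big_nat => j /andP[rj _]; rewrite /h ltnNge rj ltnNge ltnW.
have hr1 : h r.+1 r = b r by rewrite /h ltnSn.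
have hr0 : h r r = a r by rewrite /h ltnn.
by rewrite hr1 hr0; ring.
Qed.

Lemma Kuhn_sum1 a : (0 < k)%N -> PM_labels a -> Kuhn_sum a = 1.
Proof.
move=> k0 aP; pose b j (x : vertex) : int := (x (inord j) != 0%N)%:R.
have bP : PM_labels b.
  move=> p x; rewrite /b inord_val; split=> [->//|].
  by case: (x p) => //; lia.
rewrite (Kuhn_sum_labels aP bP) /Kuhn_sum.
rewrite (bigD1 [ffun=> ord0])//= (bigD1 1%g)//= odd_perm1 expr0 mul1r.
(* A nonzero product requires each coordinate [p] to become nonzero exactly on edge [p], hence to
   start at 0 and to be increased at time [p]. *)
have key (z : cell) (s : 'S_n.+1) :
  (\prod_(0 <= j < n.+1) (b j (path_from (corner z) s j.+1)
     - b j (path_from (corner z) s j)) != 0) -> z = [ffun=> ord0] /\ s = 1%g.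
  move=> nz; suff zs (p : 'I_n.+1) : z p = ord0 /\ s p = p.
    by split; [apply/ffunP => p; rewrite ffunE (zs p).1
              |apply/permP => p; rewrite perm1 (zs p).2].
  have : b p (path_from (corner z) s p.+1) - b p (path_from (corner z) s p) != 0.
    have pn : (p <= n.+1)%N by exact: ltnW.
    apply: contraNneq nz => bp; rewrite (@big_cat_nat _ _ _ p)//=.
    by rewrite (big_ltn (ltn_ord p)) bp mul0r mulr0.
  rewrite /b !inord_val !ffunE ltnS.
  case: (ltngtP (s p) p) => [sp|sp|/val_inj sp]; rewrite ?subrr//= addn0 addn1 => zp.
  split=> //; apply/val_inj; move: zp => /=; case: (nat_of_ord (z p)) => //.
rewrite [X in _ + X]big1 => [|z zn0]; last first.
  rewrite big1// => s _; apply/eqP; rewrite mulf_eq0 signr_eq0/=.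
  by apply: contraNT zn0 => /key[-> _].
rewrite [X in _ + X + _]big1 => [|s sn1]; last first.
  by apply/eqP; rewrite mulf_eq0 signr_eq0/=; apply: contraNT sn1 => /key[_ ->].
rewrite !addr0 big_nat big1// => j /andP[_ jn].
by rewrite /b !ffunE perm1 inordK// ltnn ltnSn.
Qed.

(** A nonzero signed sum has a nonzero term. Along its path label [p] changes on the edge from
    vertex [p] to vertex [p.+1], and all these vertices lie in one cell. *)
Lemma PM_cell a : (0 < k)%N -> PM_labels a ->
  exists (z : cell) (v w : 'I_n.+1 -> vertex), forall p : 'I_n.+1,
    [/\ a p (v p) != a p (w p),
       forall q, (z q <= v p q <= (z q).+1)%N &
       forall q, (z q <= w p q <= (z q).+1)%N].
Proof.
move=> k0 aP; have : Kuhn_sum a != 0 by rewrite Kuhn_sum1.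
rewrite /Kuhn_sum; case: (pickP (fun zs : cell * 'S_n.+1 =>
  \prod_(0 <= j < n.+1) (a j (path_from (corner zs.1) zs.2 j.+1)
   - a j (path_from (corner zs.1) zs.2 j)) != 0)) => [[z s]/= nz _|no]; last first.
  rewrite big1 ?eqxx// => z _; rewrite big1// => s _.
  by have /negbT/negPn/eqP/= -> := no (z, s); rewrite mulr0.
pose v := path_from (corner z) s.
exists z, (fun p => v p), (fun p => v p.+1) => p; split.
- have pn : (p <= n.+1)%N by exact: ltnW.
  apply: contraNneq nz => ap; rewrite (@big_cat_nat _ _ _ p)//=.
  by rewrite (big_ltn (ltn_ord p)) -/v ap subrr mul0r mulr0.
- by move=> q; rewrite !ffunE; case: ltnP; lia.
- by move=> q; rewrite !ffunE; case: ltnP; lia.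
Qed.
End Kuhn.

(** * Zeros of continuous maps on a cube *)

Section PoincareMiranda.
Context {R : realType}.

Definition cube n : set 'rV[R]_n := [set x | forall i, -1 <= x 0 i <= 1].

Lemma cube_compact n : compact (@cube n).
Proof.
have := @rV_compact R n (fun=> `[-1, 1]%classic) (fun=> @segment_compact _ _ _).
by congr compact; apply/seteqP; split=> x /= xc i; have := xc i; rewrite in_itv/=.
Qed.

(** The labels are the signs of the coordinates of [F] at the grid points, prescribed on the faces.
    In the cell of [PM_cell] every label changes, so no coordinate has a constant strict sign within
    [2 / k] of the corner. *)
Lemma PM_nonzero n k (F : 'rV[R]_n.+1 -> 'rV[R]_n.+1) : (0 < k)%N ->
  (forall x i, cube x -> x 0 i = -1 -> F x 0 i <= 0) ->
  (forall x i, cube x -> x 0 i = 1 -> 0 <= F x 0 i) ->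
  ~ (forall x, cube x -> exists i,
      (forall y, cube y -> (forall j, `|x 0 j - y 0 j| <= 2 / k%:R) -> 0 < F y 0 i) \/
      (forall y, cube y -> (forall j, `|x 0 j - y 0 j| <= 2 / k%:R) -> F y 0 i < 0)).
Proof.
move=> k0 F0 F1 far.
have kR : 0 < k%:R :> R by rewrite ltr0n.
(* [minn] brings the vertices beyond the grid back to the face at 1. *)
pose pt (v : {ffun 'I_n.+1 -> nat}) : 'rV[R]_n.+1 :=
  \row_j (2 * (minn (v j) k)%:R / k%:R - 1).
have ptc v : cube (pt v).
  move=> j; rewrite mxE; have jk : (minn (v j) k)%:R <= k%:R :> R.
    by rewrite ler_nat geq_minr.
  have : 0 <= ((minn (v j) k)%:R / k%:R : R) <= 1.
    by rewrite divr_ge0//= ler_pdivrMr// mul1r.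
  by rewrite -mulrA; lra.
pose a j (v : {ffun 'I_n.+1 -> nat}) : int := let p := inord j : 'I_n.+1 in
  if v p == 0%N then 0 else if (k <= v p)%N then 1 else (0 < F (pt v) 0 p)%R%:R.
have aP : PM_labels k a.
  move=> p v; rewrite /a inord_val; split=> [->//|kv].
  by rewrite kv; case: eqP => // v0; move: kv; rewrite v0 leqNgt k0.
have [z [v [w vw]]] := PM_cell k0 aP.
have near_z (v' : {ffun 'I_n.+1 -> nat}) :
    (forall q, (z q <= v' q <= (z q).+1)%N) ->
    forall j, `|pt (corner z) 0 j - pt v' 0 j| <= 2 / k%:R.
  move=> zv j; rewrite !mxE ffunE; have /andP[z1 z2] := zv j.
  have -> : minn (z j) k = z j by apply/minn_idPl; rewrite -ltnS.
  have /andP[m1 m2] : (z j <= minn (v' j) k <= (z j).+1)%N.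
    by have := ltn_ord (z j); lia.
  have -> : 2 * (z j)%:R / k%:R - 1 - (2 * (minn (v' j) k)%:R / k%:R - 1) =
    - (2 * ((minn (v' j) k)%:R - (z j)%:R) / k%:R) :> R by ring.
  rewrite normrN ger0_norm ?ler_pM2r ?invr_gt0//.
    rewrite -[leRHS]mulr1 ler_pM2l// lerBlDr nat1r ler_nat//.
  by rewrite divr_ge0// mulr_ge0// subr_ge0 ler_nat.
have [i Fi] := far _ (ptc (corner z)).
have [avw zv zw] := vw i.
(* A strict sign agrees with the label even on the faces, where the boundary hypotheses exclude the
   opposite label. *)
have a1 (v' : {ffun 'I_n.+1 -> nat}) : (forall q, (z q <= v' q <= (z q).+1)%N) ->
    0 < F (pt v') 0 i -> a i v' = 1.
  move=> zv' Fv'; rewrite /a inord_val Fv'; case: eqP => [v'0|]; last by case: ifP.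
  have pt0 : pt v' 0 i = -1 by rewrite mxE v'0 min0n; ring.
  by have := F0 (pt v') i (ptc v') pt0; rewrite leNgt Fv'.
have a0 (v' : {ffun 'I_n.+1 -> nat}) : (forall q, (z q <= v' q <= (z q).+1)%N) ->
    F (pt v') 0 i < 0 -> a i v' = 0.
  move=> zv' Fv'; rewrite /a inord_val (lt_gtF Fv'); case: eqP => // _.
  case: ifP => // kv; have pt1 : pt v' 0 i = 1.
    by rewrite mxE (minn_idPr kv) mulfK ?gt_eqF//; ring.
  by have := F1 (pt v') i (ptc v') pt1; rewrite leNgt Fv'.
case: Fi => Fi; move: avw.
- by rewrite !a1 ?eqxx//; apply: Fi => //; exact: near_z.
- by rewrite !a0 ?eqxx//; apply: Fi => //; exact: near_z.
Qed.

(** If [F] has no zero, some coordinate keeps a strict sign near each point. Compactness of the cube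
    makes this uniform at the scale [2 / k] for large [k], against [PM_nonzero]. *)
Lemma Poincare_Miranda n (F : 'rV[R]_n -> 'rV[R]_n) :
  (forall x, cube x -> forall e, 0 < e -> exists2 d, 0 < d & forall y, cube y ->
    (forall j, `|x 0 j - y 0 j| < d) -> forall i, `|F x 0 i - F y 0 i| < e) ->
  (forall x i, cube x -> x 0 i = -1 -> F x 0 i <= 0) ->
  (forall x i, cube x -> x 0 i = 1 -> 0 <= F x 0 i) ->
  exists2 x, cube x & F x = 0.
Proof.
case: n F => [|n] F cF F0 F1.
  by exists 0; [move=> [] | apply/rowP => -[]].
apply: contrapT => noz.
pose P (k : nat) (x : 'rV[R]_n.+1) := exists i,
  (forall y, cube y -> (forall j, `|x 0 j - y 0 j| <= 2 / k%:R) -> 0 < F y 0 i) \/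
  (forall y, cube y -> (forall j, `|x 0 j - y 0 j| <= 2 / k%:R) -> F y 0 i < 0).
have : \forall k \near \oo, @cube n.+1 `<=` P k.
  apply: (proj1 (compact_near_coveringP _) (cube_compact (n := n.+1))) => x xc.
  have [i Fxi] : exists i, F x 0 i != 0.
    apply: contrapT => Fx; apply: noz; exists x => //; apply/rowP => i.
    by rewrite mxE; apply/eqP; apply: contrapT => Fxi; apply: Fx; exists i; apply/negP.
  have e0 : 0 < `|F x 0 i| by rewrite normr_gt0.
  have [d d0 dF] := cF x xc _ e0.
  have sgn y : `|F x 0 i - F y 0 i| < `|F x 0 i| -> 0 < F x 0 i -> 0 < F y 0 i.
    by move=> + F_gt0; rewrite ltr_norml (gtr0_norm F_gt0); lra.
  have sgn' y : `|F x 0 i - F y 0 i| < `|F x 0 i| -> F x 0 i < 0 -> F y 0 i < 0.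
    by move=> + F_lt0; rewrite ltr_norml (ltr0_norm F_lt0); lra.
  (* Half of [d] is for the moved centre, half for the mesh. *)
  exists (ball x (d / 2), [set k | 2 / k%:R < d / 2 :> R]).
    split; first by apply: nbhsx_ballx; rewrite divr_gt0.
    near=> k; rewrite /= ltr_pdivrMr; last by rewrite ltr0n; near: k; exists 1%N.
    rewrite mulrC -ltr_pdivrMr ?divr_gt0//; near: k.
    exists (Num.truncn (2 / (d / 2))).+1 => // k /= hk.
    by rewrite (lt_le_trans (truncnS_gt _))// ler_nat.
  move=> [x' k] [/= [_ xx'] kd] ; exists i.
  have close y : cube y -> (forall j, `|x' 0 j - y 0 j| <= 2 / k%:R) ->
      `|F x 0 i - F y 0 i| < `|F x 0 i|.
    move=> yc x'y; apply: dF => // j.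
    have := xx' 0 j; rewrite /ball/= => xx'j.
    rewrite (le_lt_trans (ler_distD (x' 0 j) _ _))// [ltRHS]splitr ltr_leD//.
    by rewrite (le_trans (x'y j))// ltW.
  have [F_lt0|F_gt0|/eqP] := ltgtP (F x 0 i) 0; last by rewrite (negbTE Fxi).
  - by right=> y yc x'y; exact: sgn' (close _ yc x'y) _.
  - by left=> y yc x'y; exact: sgn (close _ yc x'y) _.
move=> [k0 _ kP]; apply: (@PM_nonzero n k0.+1 F) => //; exact: (kP k0.+1 (leqnSn _)).
Unshelve. all: by end_near. Qed.

End PoincareMiranda.

(** * Separation from a convex cone *)

Section ConeSeparation.
Context {R : realType} {n : nat}.
Implicit Types (x y c : 'rV[R]_n).

Definition dotr x y := \sum_i x 0 i * y 0 i.

Lemma dotrDl x x' y : dotr (x + x') y = dotr x y + dotr x' y.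
Proof. by rewrite /dotr -big_split; apply: eq_bigr => i _; rewrite mxE mulrDl. Qed.

Lemma dotrC x y : dotr x y = dotr y x.
Proof. by apply: eq_bigr => i _; rewrite mulrC. Qed.

Lemma dotrZl a x y : dotr (a *: x) y = a * dotr x y.
Proof. by rewrite /dotr mulr_sumr; apply: eq_bigr => i _; rewrite mxE mulrA. Qed.

Lemma dotr_ge0 x : 0 <= dotr x x.
Proof. by apply: sumr_ge0 => i _; rewrite -expr2 sqr_ge0. Qed.

Lemma dotr_continuous y : continuous (fun x => dotr (x - y) (x - y)).
Proof.
have -> : (fun x => dotr (x - y) (x - y)) =
    \sum_i (fun x => (x 0 i - y 0 i) * (x 0 i - y 0 i)).
  apply/funext => x; rewrite fct_sumE.
  by apply: eq_bigr => i _; rewrite !mxE.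
apply: (big_ind (fun f : 'rV[R]_n -> R => continuous f)).
- by change (continuous (fun _ : 'rV[R]_n => (0 : R))); exact: cst_continuous.
- by move=> f g cf cg x; exact: (@continuousD _ _ _ f g x (cf x) (cg x)).
- move=> i _ x; have xC : {for x, continuous (fun x : 'rV[R]_n => x 0 i - y 0 i)}.
    apply: (@continuousB R R^o _ (fun x : 'rV[R]_n => x 0 i) (fun=> y 0 i) x).
      exact: coord_continuous.
    exact: cst_continuous.
  exact: (@continuousM _ _ _ _ _ xC xC).
Qed.

(** The separating vector is [y - z], with [z] the point nearest to [y] in the closure of [K]; the
    distance [e] keeps it from being zero. *)
Lemma cone_separation (K : set 'rV[R]_n) (y : 'rV[R]_n) (e : R) :
  0 < e -> K 0 -> (forall x x', K x -> K x' -> K (x + x')) ->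
  (forall a x, 0 <= a -> K x -> K (a *: x)) ->
  (forall x, K x -> exists i, e <= `|x 0 i - y 0 i|) ->
  exists2 c, c != 0 & forall x, K x -> dotr c x <= 0.
Proof.
move=> e0 K0 KD KZ Ky.
pose S x := dotr (x - y) (x - y); have cS : continuous S := @dotr_continuous y.
pose m := S 0 + 1; have m1 : 1 <= m by rewrite lerDr dotr_ge0.
have S_coord x : S x <= S 0 -> forall i, y 0 i - m <= x 0 i <= y 0 i + m.
  move=> Sx i; have xi : (x 0 i - y 0 i) * (x 0 i - y 0 i) <= S 0.
    apply: le_trans Sx; rewrite /S /dotr (bigD1 i)//= !mxE lerDl.
    by apply: sumr_ge0 => j _; rewrite -expr2 sqr_ge0.
  by move: xi m1; rewrite /m; nra.
(* Points no farther from [y] than the origin lie in this box, so the minimum over a compact set is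
   the minimum over the whole closure. *)
pose B := [set x : 'rV[R]_n | forall i, `[y 0 i - m, y 0 i + m]%classic (x 0 i)] `&` closure K.
have cB : compact B.
  apply: compact_closedI; last exact: closed_closure.
  exact: (@rV_compact R n (fun i => `[y 0 i - m, y 0 i + m]%classic)
    (fun=> @segment_compact _ _ _)).
have B0 : B 0.
  split; last exact: subset_closure.
  by move=> i /=; rewrite in_itv/=; exact: S_coord.
have [||z zB zmin] := @compact_EVT_min _ _ S B _ cB.
- by exists 0.
- exact: continuous_subspaceT.
move: zB; rewrite inE => -[_ zK].
have zmin' x : closure K x -> S z <= S x.
  move=> Kx; have [Sx|Sx] := leP (S x) (S 0).
    apply: zmin; rewrite inE; split=> // i /=; rewrite in_itv/=; exact: S_coord.
  by rewrite (le_trans (zmin _ _) (ltW Sx))// inE.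
exists (y - z).
  rewrite subr_eq0; apply/eqP => yz.
  have [x [Kx xz]] : (K `&` ball y e) !=set0 by apply: zK; rewrite -yz; exact: nbhsx_ballx.
  have [i] := Ky x Kx; have := xz.2 0 i; rewrite /ball/= distrC.
  by move=> /lt_le_trans h /h; rewrite ltxx.
move=> x Kx.
(* Minimality of [z] along this ray, expanded to second order in [t], is the inequality [key]
   below. *)
have Kzx t : 0 <= t -> closure K (z + t *: x).
  move=> t0 A /= A_nbhs.
  have cw : {for z, continuous (fun w : 'rV[R]_n => w + t *: x)}.
    apply: (@continuousD R 'rV[R]_n _ id (fun=> t *: x) z); first exact: cvg_id.
    exact: cst_continuous.
  have [w [Kw Aw]] := zK _ (cw _ A_nbhs).
  by exists (w + t *: x); split=> //; apply: KD => //; exact: KZ.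
have key t : 0 < t -> dotr (y - z) x <= t * dotr x x.
  move=> t0; have := zmin' _ (Kzx t (ltW t0)).
  rewrite /S; have -> : z + t *: x - y = (z - y) + t *: x by rewrite addrAC.
  set u := z - y; have -> : dotr (u + t *: x) (u + t *: x) =
      dotr u u + 2 * t * dotr u x + t * t * dotr x x.
    have uD v : dotr v (u + t *: x) = dotr u v + t * dotr x v.
      by rewrite dotrC dotrDl dotrZl.
    by rewrite uD (dotrC u (u + _)) (dotrC x (u + _)) dotrDl [dotr (u + _) x]dotrDl
      !dotrZl; rewrite (dotrC x u); ring.
  have -> : dotr (y - z) x = - dotr u x by rewrite -opprB -scaleN1r dotrZl mulN1r.
  have := dotr_ge0 x; nra.
rewrite leNgt; apply/negP => cx.
have x2 : 0 < dotr x x by have := key 1 ltr01; rewrite mul1r; exact: lt_le_trans.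
(* For this [t] the inequality says that a positive number is at most its half. *)
have := key (dotr (y - z) x / dotr x x / 2).
rewrite !divr_gt0// => /(_ isT); rewrite mulrAC divfK ?gt_eqF//.
lra.
Qed.

End ConeSeparation.

(** * Gronwall's inequality, primitives and ordinary differential equations *)

Section EpsilonDelta.
Context {R : realType}.

Lemma nbhs_epsP {V : normedModType R} (x : V) (A : set V) :
  nbhs x A <-> exists2 d : R, 0 < d & forall y, `|y - x| < d -> A y.
Proof.
split=> [/nbhs_ballP[d d0 dA]|[d d0 dA]].
  exists d => // y yx; apply: dA.
  by rewrite -ball_normE/= distrC.
apply/nbhs_ballP; exists d => // y; rewrite -ball_normE/= distrC; exact: dA.
Qed.

Lemma continuous_epsP {V W : normedModType R} (f : V -> W) x :
  {for x, continuous f} <->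
  forall e : R, 0 < e -> exists2 d : R, 0 < d &
    forall y, `|y - x| < d -> `|f y - f x| < e.
Proof.
split=> [/cvgrPdist_lt fx e e0|fx].
  have /nbhs_epsP[d d0 dP] := fx e e0; exists d => // y yx.
  by rewrite distrC; exact: dP.
apply/cvgrPdist_lt => e e0; apply/nbhs_epsP.
by have [d d0 dP] := fx e e0; exists d => // y yx; rewrite distrC; exact: dP.
Qed.

(** Multiplied out, the condition also holds at [h = 0] and avoids deleted neighbourhoods. *)
Lemma is_derive_epsP {V : normedModType R} (f : R -> V) (t : R) (l : V) :
  is_derive t 1 f l <->
  forall e : R, 0 < e -> exists2 d : R, 0 < d &
    forall h, `|h| < d -> `|f (t + h) - f t - h *: l| <= e * `|h|.
Proof.
have quot h : h != 0 ->
    `|f (t + h) - f t - h *: l| = `|h| * `|l - h^-1 *: ((f \o shift t) (h *: 1) - f t)|.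
  move=> h0; rewrite -normrZ scalerBr scalerA mulfV// scale1r/= -normrN opprB.
  by rewrite [h *: 1]mulr1 [h + t]addrC.
split=> [[fd fl] e e0|fl].
  have : h^-1 *: ((f \o shift t) (h *: 1) - f t) @[h --> 0^'] --> l.
    by rewrite -fl; exact: fd.
  move=> /cvgrPdist_le/(_ e e0) [d /= d0 dP]; exists d => // h hd.
  have [->|h0] := eqVneq h 0; first by rewrite addr0 scale0r subrr subr0 !normr0 mulr0.
  rewrite quot// mulrC ler_pM2r ?normr_gt0//; apply: dP => //=.
  by rewrite sub0r normrN.
have cvgl : h^-1 *: ((f \o shift t) (h *: 1) - f t) @[h --> 0^'] --> l.
  apply/cvgrPdist_le => e e0; have [d d0 dP] := fl e e0.
  exists d => // h /=; rewrite sub0r normrN => hd h0.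
  by rewrite -(ler_pM2l (x := `|h|)) ?normr_gt0// -quot// mulrC dP.
by split; [apply/cvg_ex; exists l|exact/cvg_lim].
Qed.

Lemma is_derive_near {V : normedModType R} (f g : R -> V) (t : R) (l : V) :
  (exists2 d : R, 0 < d & forall s, `|s - t| < d -> f s = g s) ->
  is_derive t 1 f l -> is_derive t 1 g l.
Proof.
move=> [d d0 fg] /is_derive_epsP fl; apply/is_derive_epsP => e e0.
have [d' d'0 dP] := fl e e0; exists (Num.min d d'); first by rewrite lt_min d0.
move=> h; rewrite lt_min => /andP[hd hd'].
have <- : f (t + h) = g (t + h) by apply: fg; rewrite addrAC subrr add0r.
have <- : f t = g t by apply: fg; rewrite subrr normr0.
exact: dP.
Qed.

Lemma is_derive_continuous {V : normedModType R} (f : R -> V) (t : R) (l : V) :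
  is_derive t 1 f l -> {for t, continuous f}.
Proof. by move=> [fd _]; apply/differentiable_continuous/derivable1_diffP. Qed.

Lemma is_derive_affine (k a t : R) : is_derive t 1 (fun t => k * (t - a)) k.
Proof.
apply/is_derive_epsP => e e0; exists 1 => // h _.
have hk : h *: k = h * k by [].
have -> : k * (t + h - a) - k * (t - a) - h *: k = 0 by rewrite hk; ring.
by rewrite normr0 mulr_ge0// ltW.
Qed.

Lemma is_derive_expR_affine (c k a t : R) :
  is_derive t 1 (fun t => c * expR (k * (t - a))) (c * (k * expR (k * (t - a)))).
Proof.
have de : is_derive t 1 (expR \o (fun t => k * (t - a))) (expR (k * (t - a)) * k).
  exact: is_derive1_comp (is_derive_affine k a t).
apply: (is_derive_eq (is_deriveZ c de)).
by rewrite /GRing.scale/= [_ * k]mulrC.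
Qed.

End EpsilonDelta.

(** * Comparison of a curve with a scalar majorant *)

Section Gronwall.
Context {R : realType} {V : normedModType R}.

(** Let [c] be the last time up to which the bound holds. Equality there forces the speed of [D]
    below the slope of [M], so the bound continues past [c]. The norm need not be differentiable;
    its growth is estimated through the expansion of [D]. *)
Lemma gronwall_strict (D : R -> V) (M : R -> R) (L a b : R) : a < b -> 0 <= L ->
  continuous D -> continuous M ->
  (forall t, a < t < b -> exists D' M', [/\ is_derive t 1 D D', is_derive t 1 M M'
     & `|D'| - L * `|D t| < M' - L * M t]) ->
  `|D a| < M a -> `|D b| <= M b.
Proof.
move=> ab L0 cD cM der DMa.
pose G t := M t - `|D t|.
have cG : continuous G.
  by move=> t; apply: cvgB; [exact: cM|apply: cvg_norm; exact: cD].
rewrite leNgt; apply/negP => DMb.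
pose A := [set t | a <= t <= b /\ forall s, a <= s <= t -> 0 <= G s].
have Aa : A a.
  split=> [|s]; first by rewrite lexx ltW.
  by rewrite -eq_le => /eqP <-; rewrite subr_ge0 ltW.
have supA : has_sup A by split; [exists a|exists b => t [/andP[]]].
pose c := sup A.
have ac : a <= c by exact: (ub_le_sup supA.2).
have cb : c <= b by apply: ge_sup; [exists a|move=> t [/andP[]]].
have Gc' s : a <= s < c -> 0 <= G s.
  move=> /andP[as_ sc].
  have [t [_ tA] st] := sup_gt supA.1 sc.
  by apply: tA; rewrite as_ ltW.
have G_near t e : 0 < e -> exists2 d : R, 0 < d & forall s, `|s - t| < d -> `|G s - G t| < e.
  by move=> e0; exact: (proj1 (continuous_epsP G t) (@cG t) e e0).
have Gac : a < c.
  have G0 : 0 < G a by rewrite subr_gt0.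
  have [d d0 dP] := G_near a _ G0.
  have m0 : 0 < Num.min (d / 2) (b - a) by rewrite lt_min divr_gt0// subr_gt0.
  apply: (@lt_le_trans _ _ (a + Num.min (d / 2) (b - a))); first by rewrite ltrDl.
  apply: (ub_le_sup supA.2); split.
    by rewrite lerDl ltW//= -lerBrDl ge_min lexx orbT.
  move=> s /andP[as_]; rewrite -lerBlDl le_min => /andP[sd _].
  have /dP : `|s - a| < d by rewrite ger0_norm ?subr_ge0// (le_lt_trans sd)// ltr_pdivrMr// ltr_pMr// ltr1n.
  by rewrite ltr_norml; lra.
have Gc : 0 <= G c.
  rewrite leNgt; apply/negP => Gc0.
  have [d d0 dP] := G_near c (- G c) ltac:(lra).
  pose s := Num.max a (c - d / 2).
  have sc : s < c by rewrite gt_max Gac; lra.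
  have cs : c - s <= d / 2 by rewrite lerBlDr -lerBlDl le_max lexx orbT.
  have := Gc' s; rewrite sc le_max lexx/= => /(_ isT).
  have := dP s; rewrite ltr0_norm ?subr_lt0// => /(_ ltac:(lra)).
  by rewrite ltr_norml; lra.
have cb' : c < b.
  rewrite lt_neqAle cb andbT; apply: contraTneq Gc => ->.
  by rewrite -ltNge subr_lt0.
suff [d d0 dP] : exists2 d, 0 < d & forall h, 0 < h < d -> 0 <= G (c + h).
  have m0 : 0 < Num.min (d / 2) (b - c) by rewrite lt_min divr_gt0// subr_gt0.
  have : c + Num.min (d / 2) (b - c) <= c; last by rewrite gerDl leNgt m0.
  apply: (ub_le_sup supA.2); split.
    apply/andP; split; first by rewrite (le_trans ac)// lerDl ltW.
    by rewrite -lerBrDl ge_min lexx orbT.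
  move=> s /andP[as_ sle]; have [sc|cs|->//] := ltgtP s c.
    by apply: Gc'; rewrite as_.
  rewrite -(subrK c s) addrC; apply: dP; rewrite subr_gt0 cs/=.
  move: sle; rewrite -lerBlDl le_min => /andP[+ _]; lra.
have [G0|G0] := ltP 0 (G c).
  have [d d0 dP] := G_near c _ G0; exists d => // h /andP[h0 hd].
  have := dP (c + h); rewrite [c + h]addrC addrK gtr0_norm// => /(_ hd).
  by rewrite ltr_norml; lra.
have Dc : `|D c| = M c by apply/eqP; rewrite eq_sym -subr_eq0 -/(G c) eq_le G0.
have [D' [M' [dD dM D'M']]] := der c ltac:(lra).
rewrite Dc in D'M'.
(* Half the gap between the slopes: one [e] for the expansion of [D], one for that of [M]. *)
pose e := (M' - `|D'|) / 2; have e0 : 0 < e by rewrite /e; lra.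
have [d1 d10 dP1] := proj1 (is_derive_epsP _ _ _) dD e e0.
have [d2 d20 dP2] := proj1 (is_derive_epsP _ _ _) dM e e0.
exists (Num.min d1 d2); first by rewrite lt_min d10.
move=> h; rewrite lt_min => /and3P[h0 hd1 hd2].
have := dP1 h; rewrite gtr0_norm// => /(_ hd1) h1.
have := dP2 h; rewrite gtr0_norm// => /(_ hd2); rewrite ler_norml => /andP[h2 _].
have : `|D (c + h)| <= M c + h * `|D'| + e * h.
  rewrite -Dc -(gtr0_norm h0) -normrZ (gtr0_norm h0).
  have -> : D (c + h) = D c + h *: D' + (D (c + h) - D c - h *: D').
    by rewrite -[D (c + h) - _ - _]addrA -opprD addrCA subrr addr0.
  by rewrite (le_trans (ler_normD _ _))// lerD// ler_normD.
have hM : h *: M' = h * M' by [].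
rewrite /G; move: h2; rewrite hM /e; lra.
Qed.

(** Adding a small multiple of [expR ((L + 1) * (t - a))] to [M] makes the inequalities strict,
    since its derivative exceeds [L] times itself. The factor [k] makes the addition equal to [e] at
    [b]. *)
Lemma gronwall_open (D : R -> V) (M : R -> R) (L a b : R) : a < b -> 0 <= L ->
  continuous D -> continuous M ->
  (forall t, a < t < b -> exists D' M', [/\ is_derive t 1 D D', is_derive t 1 M M'
     & `|D'| - L * `|D t| <= M' - L * M t]) ->
  `|D a| <= M a -> `|D b| <= M b.
Proof.
move=> ab L0 cD cM der DMa; apply/ler_addgt0Pr => e e0.
pose k := e / expR ((L + 1) * (b - a)).
have k0 : 0 < k by rewrite divr_gt0// expR_gt0.
pose N t := M t + k * expR ((L + 1) * (t - a)).
have dE t := is_derive_expR_affine k (L + 1) a t.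
have <- : N b = M b + e by rewrite /N /k divfK// gt_eqF// expR_gt0.
apply: (@gronwall_strict D N L a b) => //.
- move=> t; apply: cvgD; first exact: cM.
  exact: is_derive_continuous (dE t).
- move=> t tab; have [D' [M' [dD dM D'M']]] := der t tab.
  exists D', (M' + k * ((L + 1) * expR ((L + 1) * (t - a)))); split=> //.
    exact: is_deriveD.
  rewrite /N; have : 0 < k * expR ((L + 1) * (t - a)) by rewrite mulr_gt0// expR_gt0.
  lra.
- by rewrite /N subrr mulr0 expR0; lra.
Qed.

(** Induction on the exceptional points: the interval is cut at each one inside it, and the bound at
    the cut starts the second piece. *)
Lemma gronwall (S : seq R) (D : R -> V) (M : R -> R) (L a b : R) : a <= b -> 0 <= L ->
  continuous D -> continuous M ->
  (forall t, a < t < b -> t \notin S ->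
     exists D' M', [/\ is_derive t 1 D D', is_derive t 1 M M'
     & `|D'| - L * `|D t| <= M' - L * M t]) ->
  `|D a| <= M a -> `|D b| <= M b.
Proof.
move=> ab L0 cD cM; elim: S a b ab => [|s S IH] a b ab der.
  have [<-//|anb] := eqVneq a b; apply: (@gronwall_open D M L a b) => //.
    by rewrite lt_neqAle anb.
  move=> t tab; exact: (der t tab isT).
have [/andP[as_ sb]|sab] := boolP (a < s < b); last first.
  apply: IH => // t tab tS; apply: der => //; rewrite inE negb_or tS andbT.
  by apply: contraNneq sab => <-.
move=> DMa; apply: (IH s b (ltW sb)).
  move=> t /andP[st tb] tS; apply: der; first by rewrite tb (lt_trans as_ st).
  by rewrite inE negb_or tS (gt_eqF st).
apply: (IH a s (ltW as_)) => // t /andP[at_ ts] tS; apply: der.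
  by rewrite at_ (lt_trans ts sb).
by rewrite inE negb_or tS (lt_eqF ts).
Qed.

End Gronwall.

Lemma subrACA_swap (V : zmodType) (a b c d : V) : a - b - (c - d) = a - c - (b - d).
Proof. by rewrite !opprB addrACA [RHS]addrACA [- b - c]addrC. Qed.

(** Rearranges the remainder in the product rules for an operator applied to a vector and for a
    scalar times a vector. *)
Lemma zmod_telescope (V : zmodType) (a b w c u v : V) :
  a - c - (u + v) = (a - b - w) + (b - c - v) + (w - u).
Proof.
rewrite [a - b - w]addrAC -[b - c - v]addrA (subrKA b) [a - w + _]addrAC (subrKA w).
by rewrite opprD !addrA addrAC.
Qed.

Lemma max_nonexpansive (R : realFieldType) (x y s : R) :
  `|Num.max x s - Num.max y s| <= `|x - y|.
Proof.
have h1 := ler_norm (x - y); have h2 := ler_norm (y - x); rewrite distrC in h2.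
by rewrite ler_norml !maxEle; case: (leP x s); case: (leP y s); lra.
Qed.

Lemma min_nonexpansive (R : realFieldType) (x y s : R) :
  `|Num.min x s - Num.min y s| <= `|x - y|.
Proof.
have h1 := ler_norm (x - y); have h2 := ler_norm (y - x); rewrite distrC in h2.
by rewrite ler_norml !minEle; case: (leP x s); case: (leP y s); lra.
Qed.

Section MeanValue.
Context {R : realType} {V : normedModType R}.
Implicit Types (S : seq R).

Lemma lipschitz_continuous {W : normedModType R} (f : W -> V) (k : R) :
  (forall x y, `|f x - f y| <= k * `|x - y|) -> continuous f.
Proof.
move=> fk x; apply/continuous_epsP => e e0.
exists (e / (`|k| + 1)); first exact: divr_gt0.
move=> y yx; rewrite (le_lt_trans (fk _ _))//.
rewrite (@le_lt_trans _ _ ((`|k| + 1) * `|y - x|))//.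
  by rewrite ler_wpM2r// (le_trans (ler_norm k))// lerDl.
by rewrite mulrC -ltr_pdivlMr.
Qed.

Lemma mean_value_le S (D : R -> V) (C a b : R) : a <= b -> continuous D ->
  (forall t, a < t < b -> t \notin S -> exists2 l, is_derive t 1 D l & `|l| <= C) ->
  `|D b - D a| <= C * (b - a).
Proof.
move=> ab cD dD; apply: (@gronwall R V S (fun t => D t - D a)
    (fun t => C * (t - a)) 0 a b) => //.
- by move=> t; apply: cvgB; [exact: cD|exact: cvg_cst].
- by move=> t; exact: is_derive_continuous (is_derive_affine C a t).
- move=> t tab tS; have [l dl lC] := dD t tab tS; exists l, C; split.
  + apply/is_derive_epsP => e e0; have [d d0 dP] := proj1 (is_derive_epsP _ _ _) dl e e0.
    exists d => // h hd; rewrite (_ : D (t + h) - D a - (D t - D a) = D (t + h) - D t).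
      exact: dP.
    by rewrite opprB addrA subrK.
  + exact: is_derive_affine.
  + by rewrite !mul0r !subr0.
- by rewrite !subrr normr0 mulr0.
Qed.

Lemma mean_value_abs S (D : R -> V) (C a b s t : R) : 
  a <= s <= b -> a <= t <= b -> continuous D ->
  (forall t, a < t < b -> t \notin S -> exists2 l, is_derive t 1 D l & `|l| <= C) ->
  `|D t - D s| <= C * `|t - s|.
Proof.
wlog st : s t / s <= t.
  move=> H sab tab cD dD; have [st|/ltW ts] := leP s t; first exact: H.
  by rewrite distrC [`|t - s|]distrC; apply: H.
move=> /andP[as_ sb] /andP[at_ tb] cD dD.
rewrite [`|t - s|]ger0_norm ?subr_ge0//; apply: (@mean_value_le S) => // r /andP[sr rt].
by apply: dD; rewrite (le_lt_trans as_ sr)/= (lt_le_trans rt).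
Qed.

Lemma is_derive_sub (f g : R -> V) (t : R) (l m : V) :
  is_derive t 1 f l -> is_derive t 1 g m ->
  is_derive t 1 (fun t => f t - g t) (l - m).
Proof. by move=> df dg; exact: is_deriveB. Qed.

Lemma is_derive_addl (c : V) (f : R -> V) (t : R) (l : V) :
  is_derive t 1 f l -> is_derive t 1 (fun t => c + f t) l.
Proof.
move=> /is_derive_epsP df; apply/is_derive_epsP => e /df[d d0 dP].
by exists d => // h /dP; rewrite opprD addrACA subrr add0r.
Qed.

Lemma is_derive_subr (c : V) (f : R -> V) (t : R) (l : V) :
  is_derive t 1 f l -> is_derive t 1 (fun t => f t - c) l.
Proof.
move=> /(is_derive_addl (- c)) df; apply: is_derive_near df.
by exists 1 => // s _; rewrite addrC.
Qed.

Lemma is_derive_linear (c v : V) (s t : R) :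
  is_derive t 1 (fun t => c + (t - s) *: v) v.
Proof.
apply/is_derive_epsP => e e0; exists 1 => // h _.
rewrite opprD addrACA subrr add0r -scalerBl -scalerBl.
have -> : t + h - s - (t - s) - h = 0 by ring.
by rewrite scale0r normr0 mulr_ge0// ltW.
Qed.

Lemma same_derivative S (F G : R -> V) (a b : R) : a <= b ->
  continuous F -> continuous G ->
  (forall t, a < t < b -> t \notin S ->
    exists2 l, is_derive t 1 F l & is_derive t 1 G l) ->
  F b - F a = G b - G a.
Proof.
move=> ab cF cG dFG; apply/eqP; rewrite -subr_eq0 -normr_le0.
have := @mean_value_le S (fun t => F t - G t) 0 a b ab.
rewrite mul0r subrACA_swap.
apply; first by move=> t; apply: cvgB; [exact: cF|exact: cG].
move=> t tab tS; have [l dF dG] := dFG t tab tS; exists (l - l).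
  exact: is_derive_sub.
by rewrite subrr normr0.
Qed.

End MeanValue.

(** * Induction along the real line *)

Section RealInduction.
Context {R : realType}.

(** At the supremum of the good points of [[a, b]], the step starts from a good point just before
    it, reaches the supremum and, if it is below [b], passes beyond it. *)
Lemma real_induction (P : R -> Prop) (a b : R) : a <= b -> P a ->
  (forall c, a <= c -> exists2 d, 0 < d & forall s t,
     a <= s -> c - d < s <= c -> c <= t < c + d -> P s -> P t) -> P b.
Proof.
move=> ab Pa step; pose A := [set t | a <= t <= b /\ P t].
have supA : has_sup A.
  by split; [exists a; split=> //; rewrite lexx|exists b => t [/andP[]]].
pose c := sup A.
have ac : a <= c by apply: (ub_le_sup supA.2); split=> //; rewrite lexx.
have cb : c <= b by apply: ge_sup; [exact: supA.1|move=> t [/andP[]]].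
have [d d0 dP] := step c ac.
have cdc : c - d < c by rewrite ltrBlDr ltrDl.
have [s [/andP[as_ sb] Ps] cds] := sup_gt supA.1 cdc.
have sc : s <= c by apply: (ub_le_sup supA.2); split=> //; rewrite as_.
pose t := Num.min b (c + d / 2).
have ct : c <= t by rewrite le_min cb/= lerDl ltW// divr_gt0.
have Pt : P t.
  apply: (dP s) => //; first by rewrite cds.
  by rewrite ct /t gt_min ltrD2l ltr_pdivrMr// ltr_pMr// ltr1n orbT.
have [bc|cb'] := leP b c.
  by rewrite (_ : b = t)//; apply/eqP; rewrite eq_le (le_trans bc ct) ge_min lexx.
have : t <= c.
  by apply: (ub_le_sup supA.2); split=> //; rewrite (le_trans ac ct)/= ge_min lexx.
by rewrite leNgt /t lt_min cb' ltrDl divr_gt0.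
Qed.

End RealInduction.

Section CauchySequences.
Context {R : realType} {V : completeNormedModType R}.

Lemma cauchy_epsN (u : nat -> V) :
  (forall e : R, 0 < e -> exists N, forall n m, (N <= n)%N -> (N <= m)%N ->
     `|u n - u m| <= e) ->
  exists l, forall e : R, 0 < e -> exists N, forall n, (N <= n)%N -> `|u n - l| <= e.
Proof.
move=> uC; have : cvg (u n @[n --> \oo]).
  apply: cauchy_cvg; apply: cauchy_exP => e e0.
  have [N NP] := uC (e / 2) (divr_gt0 e0 (ltr0n _ 2)).
  exists (u N); exists N => // n /= Nn.
  rewrite -ball_normE/= (le_lt_trans (NP N n (leqnn _) Nn))//.
  by rewrite ltr_pdivrMr// ltr_pMr// ltr1n.
move=> /cvg_ex[/= l /cvgrPdist_le ul]; exists l => e /ul[N _ NP].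
by exists N => n Nn; rewrite distrC; exact: NP.
Qed.

End CauchySequences.

Section OneSidedLimits.
Context {R : realType} {V : normedModType R}.

Lemma cvg_right_epsP (g : R -> V) (t : R) (l : V) :
  g x @[x --> t^'+] --> l <-> forall e : R, 0 < e -> exists2 d : R, 0 < d &
    forall s, t < s < t + d -> `|g s - l| <= e.
Proof.
split=> [/cvgrPdist_le gl e e0|gl].
  have [d /= d0 dP] := gl e e0; exists d => // s /andP[ts std].
  by rewrite distrC; apply: dP => //=; rewrite ltr0_norm ?subr_lt0//; lra.
apply/cvgrPdist_le => e e0; have [d d0 dP] := gl e e0.
exists d => //= s /=; rewrite ltr_norml => /andP[h1 h2] ts.
by rewrite distrC; apply: dP; lra.
Qed.

Lemma cvg_left_epsP (g : R -> V) (t : R) (l : V) :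
  g x @[x --> t^'-] --> l <-> forall e : R, 0 < e -> exists2 d : R, 0 < d &
    forall s, t - d < s < t -> `|g s - l| <= e.
Proof.
split=> [/cvgrPdist_le gl e e0|gl].
  have [d /= d0 dP] := gl e e0; exists d => // s /andP[ts std].
  by rewrite distrC; apply: dP => //=; rewrite gtr0_norm ?subr_gt0//; lra.
apply/cvgrPdist_le => e e0; have [d d0 dP] := gl e e0.
exists d => //= s /=; rewrite ltr_norml => /andP[h1 h2] ts.
by rewrite distrC; apply: dP; lra.
Qed.

Definition regulated (g : R -> V) := forall t,
  (exists l : V, g x @[x --> t^'-] --> l) /\ (exists l : V, g x @[x --> t^'+] --> l).

Definition pwc (S : seq R) (g : R -> V) :=
  regulated g /\ forall t, t \notin S -> {for t, continuous g}.

End OneSidedLimits.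

(** * Primitives of vector valued regulated functions *)

Section Primitive.
Context {R : realType} {V : completeNormedModType R}.
Implicit Types (S : seq R) (g G : R -> V) (s t : R) (v l : V).

Let bent (G : R -> V) (s : R) (v : V) (t : R) := G (Num.min t s) + (Num.max t s - s) *: v.

Let bent_continuous G s v : continuous G -> continuous (bent G s v).
Proof.
move=> cG t; apply: cvgD; last first.
  have : continuous (fun t => (Num.max t s - s) *: v); last exact.
  apply: (@lipschitz_continuous _ _ _ _ `|v|) => x y.
  rewrite -scalerBl normrZ mulrC ler_wpM2l//.
  have -> : Num.max x s - s - (Num.max y s - s) = Num.max x s - Num.max y s by ring.
  exact: max_nonexpansive.
have cm : continuous (fun t => Num.min t s).
  apply: (@lipschitz_continuous _ _ _ _ 1) => x y; rewrite mul1r.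
  exact: min_nonexpansive.
exact: (@continuous_comp _ _ _ (fun t => Num.min t s) G t (cm t) (cG _)).
Qed.

Let bent_lt G s v t l : t < s -> is_derive t 1 G l -> is_derive t 1 (bent G s v) l.
Proof.
move=> ts; apply: is_derive_near; exists (s - t); first by rewrite subr_gt0.
move=> r; rewrite ltr_norml => /andP[_ rt]; have rs : r <= s by lra.
by rewrite /bent (min_idPl rs) (max_idPr rs) subrr scale0r addr0.
Qed.

Let bent_gt G s v t : s < t -> is_derive t 1 (bent G s v) v.
Proof.
move=> st; apply: is_derive_near (is_derive_linear (G s) v s t).
exists (t - s); first by rewrite subr_gt0.
move=> r; rewrite ltr_norml => /andP[rt _]; have rs : s <= r by lra.
by rewrite /bent (min_idPr rs) (max_idPl rs).
Qed.

Let approx_primitive g (e a b : R) := exists2 S : seq R, True & exists2 G : R -> V,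
  continuous G & forall t, a < t < b -> t \notin S ->
    exists2 l, is_derive t 1 G l & `|l - g t| <= e.

(** Near [c] the function stays within [e] of its two one-sided limits, so an approximate primitive
    is prolonged by segments with these slopes ([bent]), at the price of two more exceptional
    points. *)
Lemma regulated_approx g (e a b : R) : a <= b -> 0 < e -> regulated g ->
  approx_primitive g e a b.
Proof.
move=> ab e0 rg; apply: (@real_induction _ (approx_primitive g e a) a b ab).
  exists [::] => //.
  exists (fun=> 0); first exact: cst_continuous.
  by move=> t /andP[h1 h2]; have := lt_trans h1 h2; rewrite ltxx.
move=> c ac; have [[l1 gl1] [l2 gl2]] := rg c.
have [d1 d10 dP1] := proj1 (cvg_left_epsP _ _ _) gl1 e e0.
have [d2 d20 dP2] := proj1 (cvg_right_epsP _ _ _) gl2 e e0.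
exists (Num.min d1 d2); first by rewrite lt_min d10.
move=> s t as_ /andP[cs sc] /andP[ct tc] [S _ [G cG dG]].
have {}cs : c - d1 < s.
  by apply: le_lt_trans cs; rewrite lerD2l lerN2 ge_min lexx.
have {}tc : t < c + d2.
  by apply: lt_le_trans tc _; rewrite lerD2l ge_min lexx orbT.
exists [:: s, c & S] => //.
exists (bent (bent G s l1) c l2); first by do 2 apply: bent_continuous.
move=> r /andP[ar rt]; rewrite !inE !negb_or => /and3P[rs rc rS].
have [rc'|cr|/eqP] := ltgtP r c; last by rewrite (negbTE rc).
  have [rs'|sr|/eqP] := ltgtP r s; last by rewrite (negbTE rs).
    have [l dl lg] := dG r (introT andP (conj ar rs')) rS.
    by exists l => //; apply: bent_lt => //; apply: bent_lt.
  exists l1; first by apply: bent_lt => //; exact: bent_gt.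
  by rewrite distrC; apply: dP1; rewrite rc' (lt_trans cs).
exists l2; first exact: bent_gt.
by rewrite distrC; apply: dP2; rewrite cr (lt_trans rt).
Qed.

(** Replaces the integral for functions with values in a Banach space. Approximate primitives with
    error [n.+1%:R^-1] on [[-n, n]] and value 0 at 0 are Cauchy by the mean value inequality; their
    limit has the right derivative at each continuity point. *)
Lemma regulated_primitive g : regulated g ->
  exists G : R -> V, continuous G /\
    forall t, {for t, continuous g} -> is_derive t 1 G (g t).
Proof.
move=> rg.
have app (n : nat) : exists G : R -> V, [/\ continuous G, G 0 = 0 &
    exists S, forall t, - n%:R < t < n%:R -> t \notin S ->
      exists2 l, is_derive t 1 G l & `|l - g t| <= n.+1%:R^-1].
  have nn : - n%:R <= n%:R :> R by have := ler0n R n; lra.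
  have [|S _ [G cG dG]] := @regulated_approx g n.+1%:R^-1 _ _ nn _ rg.
    by rewrite invr_gt0.
  exists (fun t => G t - G 0); split; last 1 first.
  - exists S => t tn tS; have [l dl lg] := dG t tn tS; exists l => //.
    exact: is_derive_subr.
  - by move=> t; apply: cvgB; [exact: cG|exact: cvg_cst].
  - by rewrite subrr.
have [G GP] := choice app.
have inv_small (e : R) : 0 < e -> exists N, forall n, (N <= n)%N -> n.+1%:R^-1 <= e.
  move=> e0; exists (Num.truncn e^-1) => n Nn; rewrite -[leRHS]invrK.
  rewrite lef_pV2 ?posrE ?invr_gt0// ltW// (lt_le_trans (truncnS_gt _))//.
  by rewrite ler_nat.
have GB n m t : (n <= m)%N -> `|t| <= n%:R ->
    `|G m t - G n t| <= 2 * n.+1%:R^-1 * `|t|.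
  move=> nm tn; have [cGn Gn0 [Sn dGn]] := GP n; have [cGm Gm0 [Sm dGm]] := GP m.
  have := @mean_value_abs _ _ (Sn ++ Sm) (fun t => G m t - G n t) (2 * n.+1%:R^-1)
    (- n%:R) n%:R 0 t.
  rewrite Gn0 Gm0 subrr !subr0; apply.
  - by rewrite oppr_le0 ler0n.
  - by rewrite -ler_norml.
  - by move=> r; apply: cvgB; [exact: cGm|exact: cGn].
  - move=> r /andP[r1 r2]; rewrite mem_cat negb_or => /andP[rn rm].
    have nmR : n%:R <= m%:R :> R by rewrite ler_nat.
    have [ln dln lgn] := dGn r ltac:(by rewrite r1) rn.
    have [lm dlm lgm] := dGm r ltac:(lra) rm.
    exists (lm - ln); first exact: is_derive_sub.
    rewrite (le_trans (ler_distD (g r) _ _))// mulrDl mul1r lerD//; last by rewrite distrC.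
    by rewrite (le_trans lgm)// lef_pV2 ?posrE// ler_nat.
have lim t : exists l, forall e : R, 0 < e -> exists N, forall n, (N <= n)%N -> `|G n t - l| <= e.
  apply: cauchy_epsN => e e0.
  have t0 : 0 < 4 * (`|t| + 1) :> R by rewrite mulr_gt0// ltr_wpDl.
  have [N NP] := inv_small (e / (4 * (`|t| + 1))) (divr_gt0 e0 t0).
  pose N' := maxn N (Num.truncn `|t|).+1.
  have key n : (N' <= n)%N -> `|G n t - G N' t| <= e / 2.
    move=> N'n; rewrite (le_trans (GB _ _ _ N'n _))//.
      by rewrite ltW// (lt_le_trans (truncnS_gt _))// ler_nat leq_maxr.
    have := NP N' (leq_maxl _ _); rewrite ler_pdivlMr//.
    have : 0 < N'.+1%:R^-1 :> R by rewrite invr_gt0.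
    by move: (N'.+1%:R^-1) => w; have := normr_ge0 t; nra.
  exists N' => n m N'n N'm; rewrite (le_trans (ler_distD (G N' t) _ _))// [e]splitr lerD ?key//.
  by rewrite distrC key.
have [F FP] := choice lim.
have FG n t : `|t| <= n%:R -> `|F t - G n t| <= 2 * n.+1%:R^-1 * `|t|.
  move=> tn; apply/ler_addgt0Pr => e e0.
  have [N NP] := FP t e e0.
  rewrite (le_trans (ler_distD (G (maxn N n) t) _ _))// addrC lerD//.
    by rewrite GB// leq_maxr.
  by rewrite distrC NP// leq_maxl.
exists F; split.
  move=> t; apply/continuous_epsP => e e0.
  pose r := `|t| + 1; have r0 : 0 < r by rewrite ltr_wpDl.
  have e3 : 0 < e / 4 by rewrite divr_gt0.
  have [N NP] := inv_small (e / 4 / 4 / r) ltac:(by rewrite !divr_gt0).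
  pose n := maxn N (Num.truncn r).+1.
  have rn : r <= n%:R by rewrite ltW// (lt_le_trans (truncnS_gt _))// ler_nat leq_maxr.
  have near s : `|s| <= r -> `|F s - G n s| <= e / 4.
    move=> sr; rewrite (le_trans (FG _ _ (le_trans sr rn)))//.
    have := NP n (leq_maxl _ _); rewrite ler_pdivlMr//.
    have : 0 < n.+1%:R^-1 :> R by rewrite invr_gt0.
    by move: (n.+1%:R^-1) => w; have := normr_ge0 s; nra.
  have [cGn _ _] := GP n.
  have [d d0 dP] := proj1 (continuous_epsP (G n) t) (@cGn t) (e / 4) e3.
  exists (Num.min d 1); first by rewrite lt_min d0/=.
  move=> s; rewrite lt_min => /andP[/dP Gs s1].
  have tr : `|t| <= r by rewrite lerDl.
  have sr : `|s| <= r.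
    by rewrite -[s](subrK t) (le_trans (ler_normD _ _))// addrC lerD2l ltW.
  have := near s sr; have := near t tr; rewrite distrC => h1 h2.
  have := ler_distD (G n s) (F s) (F t); have := ler_distD (G n t) (G n s) (F t).
  by move: e0; lra.
move=> t ct; apply/is_derive_epsP => e e0.
have [d d0 dP] := proj1 (continuous_epsP g t) ct (e / 2) (divr_gt0 e0 (ltr0n _ 2)).
exists (Num.min d 1); first by rewrite lt_min d0/=.
move=> h; rewrite lt_min => /andP[hd h1].
pose r := `|t| + 1; have r0 : 0 < r by rewrite ltr_wpDl.
(* The radius for [h] does not depend on [n], so [n] may be chosen after [h]. *)
have Gn n : r <= n%:R -> `|G n (t + h) - G n t - h *: g t| <= (e / 2 + n.+1%:R^-1) * `|h|.
  move=> rn; have [cGn _ [Sn dGn]] := GP n.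
  have := @mean_value_abs _ _ Sn (fun s => G n s - (0 + (s - t) *: g t)) (e / 2 + n.+1%:R^-1)
    (Num.min t (t + h)) (Num.max t (t + h)) t (t + h).
  rewrite subrr scale0r addr0 subr0 add0r [t + h - t]addrAC subrr add0r addrAC; apply.
  - by rewrite ge_min le_max lexx.
  - by rewrite ge_min le_max lexx !orbT.
  - move=> s; apply: cvgB; first exact: cGn.
    exact: is_derive_continuous (is_derive_linear 0 (g t) t s).
  - move=> s /andP[s1 s2] sS.
    have st : `|s - t| < `|h|.
      move: s1 s2; rewrite gt_min lt_max ltr_norml.
      by case: (ger0P h) => h0 /orP[] ? /orP[] ?; lra.
    have sn : - n%:R < s < n%:R.
      rewrite -ltr_norml (lt_le_trans _ rn)// -[s](subrK t).
      by rewrite (le_lt_trans (ler_normD _ _))// addrC ltrD2l (lt_trans st).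
    have [l dl lg] := dGn s sn sS; exists (l - g t).
      exact: is_derive_sub (is_derive_linear _ _ _ _).
    rewrite (le_trans (ler_distD (g s) _ _))// addrC lerD//.
    by rewrite ltW// dP// (lt_trans st).
apply/ler_addgt0Pr => e' e'0.
(* Replacing [G n] by [F] at both [t] and [t + h] costs at most [4 * r] times [n.+1%:R^-1]. *)
have k0 : 0 < 4 * r + 1 by rewrite addr_gt0// mulr_gt0.
have [N NP] := inv_small (Num.min (e / 2) (e' / (4 * r + 1))) ltac:(by rewrite lt_min !divr_gt0).
pose n := maxn N (Num.truncn r).+1.
have rn : r <= n%:R by rewrite ltW// (lt_le_trans (truncnS_gt _))// ler_nat leq_maxr.
have := NP n (leq_maxl _ _); rewrite le_min => /andP[n1 n2].
have tr : `|t| <= r by rewrite lerDl.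
have thr : `|t + h| <= r by rewrite (le_trans (ler_normD _ _))// lerD2l ltW.
have := Gn n rn; have := FG n t (le_trans tr rn); have := FG n (t + h) (le_trans thr rn).
rewrite (_ : F (t + h) - F t - h *: g t = (F (t + h) - G n (t + h)) - (F t - G n t)
   + (G n (t + h) - G n t - h *: g t)); last first.
  by rewrite [in RHS]subrACA_swap [RHS]addrA subrK.
move=> A1 A2 A3; rewrite (le_trans (ler_normD _ _))// addrC lerD//.
  by rewrite (le_trans A3)// ler_wpM2r// [leRHS]splitr lerD2l.
rewrite (le_trans (ler_normB _ _))//; move: n2 A1 A2; rewrite ler_pdivlMr//.
have : 0 < n.+1%:R^-1 :> R by rewrite invr_gt0.
by move: (n.+1%:R^-1) => w; have := normr_ge0 t; have := normr_ge0 (t + h); nra.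
Qed.

Lemma pwc_primitive S g : pwc S g -> exists G : R -> V, continuous G /\
  forall t, t \notin S -> is_derive t 1 G (g t).
Proof.
move=> [/regulated_primitive[G [cG dG]] cg]; exists G; split=> // t tS.
by apply: dG; exact: cg.
Qed.

End Primitive.

Section Helpers.
Context {R : realType} {V : normedModType R}.
Implicit Types (S : seq R).

Lemma mean_value_fun S (D : R -> V) (M : R -> R) (a b : R) : a <= b ->
  continuous D -> continuous M ->
  (forall t, a < t < b -> t \notin S ->
     exists l m, [/\ is_derive t 1 D l, is_derive t 1 M m & `|l| <= m]) ->
  `|D b - D a| <= M b - M a.
Proof.
move=> ab cD cM dDM; apply: (@gronwall R V S (fun t => D t - D a)
    (fun t => M t - M a) 0 a b) => //.
- by move=> t; apply: cvgB; [exact: cD|exact: cvg_cst].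
- by move=> t; apply: cvgB; [exact: cM|exact: cvg_cst].
- move=> t tab tS; have [l [m [dl dm lm]]] := dDM t tab tS; exists l, m; split.
  + exact: is_derive_subr.
  + exact: is_derive_subr.
  + by rewrite !mul0r !subr0.
- by rewrite !subrr normr0.
Qed.

Lemma geometric_increments (u : nat -> V) (c : R) n m : (n <= m)%N ->
  (forall k, `|u k.+1 - u k| <= c / 2 ^+ k) -> `|u m - u n| <= 2 * c / 2 ^+ n.
Proof.
move=> nm uc; have c0 : 0 <= c.
  by have := le_trans (normr_ge0 _) (uc 0%N); rewrite expr0 divr1.
suff : `|u m - u n| <= 2 * c / 2 ^+ n - 2 * c / 2 ^+ m.
  have : 0 <= 2 * c / 2 ^+ m by rewrite divr_ge0// ?mulr_ge0// exprn_ge0.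
  lra.
elim: m nm => [|m IH].
  by rewrite leqn0 => /eqP ->; rewrite !subrr normr0.
rewrite leq_eqVlt => /predU1P[->|nm]; first by rewrite !subrr normr0.
rewrite (le_trans (ler_distD (u m) _ _))//.
have := uc m; have := IH nm; rewrite exprS invfM.
by move: (2 ^+ m)^-1 => w; lra.
Qed.

Lemma continuous_bounded (f : R -> V) (a b : R) : continuous f ->
  exists C, forall t, a <= t <= b -> `|f t| <= C.
Proof.
move=> cf; have [ab|ba] := leP a b; last first.
  by exists 0 => t /andP[h1 h2]; have := le_lt_trans (le_trans h1 h2) ba; rewrite ltxx.
have [|c _ cP] := @EVT_max R (fun t => `|f t|) a b ab.
  by apply: continuous_subspaceT => t; apply: cvg_norm; exact: cf.
by exists `|f c| => t tab; apply: cP; rewrite in_itv.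
Qed.

End Helpers.

Lemma pow2_small {R : realType} (c e : R) : 0 < e -> exists N, forall n, (N <= n)%N ->
  c / 2 ^+ n <= e.
Proof.
move=> e0; exists (Num.truncn (`|c| / e)) => n Nn.
rewrite ler_pdivrMr ?exprn_gt0// (le_trans (ler_norm c))//.
rewrite mulrC -ler_pdivrMr//; apply: ltW; apply: lt_le_trans (truncnS_gt _) _.
by rewrite -natrX ler_nat (leq_ltn_trans Nn)// ltn_expl.
Qed.

(** * Global solutions by Picard iteration *)

Section Picard.
Context {R : realType} {V : completeNormedModType R}.

(** The right-hand side enters only through a Lipschitz constant and the existence of primitives
    along continuous curves, so the state, linearized and adjoint equations are all covered. *)
Lemma ode_global_solution (S : seq R) (phi : R -> V -> V) (L : R) :
  0 <= L -> (forall t x y, `|phi t x - phi t y| <= L * `|x - y|) ->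
  (forall x : R -> V, continuous x -> exists G : R -> V, continuous G /\
     forall t, t \notin S -> is_derive t 1 G (phi t (x t))) ->
  forall (t0 : R) (xi : V), exists x : R -> V, [/\ continuous x, x t0 = xi &
     forall t, t \notin S -> is_derive t 1 x (phi t (x t))].
Proof.
move=> L0 phiL prim t0 xi.
have [J JP] : {J : (R -> V) -> R -> V & forall x, continuous x -> continuous (J x) /\
    forall t, t \notin S -> is_derive t 1 (J x) (phi t (x t))}.
  apply: (@choice _ _ (fun x G => continuous x -> continuous G /\
    forall t, t \notin S -> is_derive t 1 G (phi t (x t)))) => x.
  have [/prim[G GP]|nc] := pselect (continuous x); first by exists G.
  by exists x.
pose I x t := xi + (J x t - J x t0).
have cI x : continuous x -> continuous (I x).
  move=> /JP[cJ _] t; apply: cvgD; first exact: cvg_cst.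
  by apply: cvgB; [exact: cJ|exact: cvg_cst].
have dI x t : continuous x -> t \notin S -> is_derive t 1 (I x) (phi t (x t)).
  by move=> /JP[_ dJ] tS; apply/is_derive_addl/is_derive_subr; exact: dJ.
have I0 x : I x t0 = xi by rewrite /I subrr addr0.
pose u n := iter n I (fun=> xi).
have cu n : continuous (u n).
  by elim: n => [|n IH]; [exact: cst_continuous|exact: cI].
pose K := L + 1; have K0 : 0 < K by rewrite ltr_wpDl.
have LK : L <= K by rewrite lerDl.
(* In the weight [expR (2 * K * |s - t0|)] the integral operator contracts by 1/2 on the whole line:
   a primitive of the weight gains [(2 * K)^-1], the Lipschitz constant costs at most [K]. Times
   before and after [t0] are treated separately. *)
have dist_le (x y : R -> V) (c : R) t : continuous x -> continuous y -> 0 <= c ->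
    (forall s, `|s - t0| <= `|t - t0| -> `|x s - y s| <= c * expR (2 * K * `|s - t0|)) ->
    `|I x t - I y t| <= c / 2 * expR (2 * K * `|t - t0|).
  move=> cx cy c0 xy; pose D s := I x s - I y s.
  have cD : continuous D by move=> s; apply: cvgB; apply: cI.
  have D0 : D t0 = 0 by rewrite /D !I0 subrr.
  have dD s : s \notin S -> is_derive s 1 D (phi s (x s) - phi s (y s)).
    by move=> sS; apply: is_derive_sub; exact: dI.
  have [tt0|/ltW t0t] := leP t t0.
  - have := @mean_value_fun _ _ S D (fun s => - c / 2 * expR (- (2 * K) * (s - t0))) t t0 tt0 cD.
    rewrite D0 sub0r normrN subrr mulr0 expR0 mulr1.
    rewrite [`|t - t0|]ler0_norm ?subr_le0//.
    have -> : - (2 * K) * (t - t0) = 2 * K * - (t - t0) by ring.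
    move=> h; apply: (le_trans (h _ _)) => {h}.
    + by move=> s; exact: is_derive_continuous (is_derive_expR_affine _ _ _ _).
    + move=> s /andP[ts st] sS; eexists; eexists; split; [exact: dD|exact: is_derive_expR_affine|].
      rewrite (le_trans (phiL _ _ _))//.
      have sle := ltW st; have := xy s; rewrite !ler0_norm ?subr_le0//.
      have -> : - (2 * K) * (s - t0) = 2 * K * - (s - t0) by ring.
      move=> /(_ ltac:(lra)) h; have := expR_gt0 (2 * K * - (s - t0)).
      move: h; move: (expR _) => E h E0.
      have := normr_ge0 (x s - y s); nra.
    + have := expR_gt0 (2 * K * - (t - t0)); move: (expR _) => E E0; lra.
  - have := @mean_value_fun _ _ S D (fun s => c / 2 * expR (2 * K * (s - t0))) t0 t t0t cD.
    rewrite D0 subr0 subrr mulr0 expR0 mulr1.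
    rewrite [`|t - t0|]ger0_norm ?subr_ge0//.
    move=> h; apply: (le_trans (h _ _)) => {h}.
    + by move=> s; exact: is_derive_continuous (is_derive_expR_affine _ _ _ _).
    + move=> s /andP[ts st] sS; eexists; eexists; split; [exact: dD|exact: is_derive_expR_affine|].
      rewrite (le_trans (phiL _ _ _))//.
      have sle := ltW ts; have := xy s; rewrite !ger0_norm ?subr_ge0//.
      move=> /(_ ltac:(lra)) h; have := expR_gt0 (2 * K * (s - t0)).
      move: h; move: (expR _) => E h E0.
      have := normr_ge0 (x s - y s); nra.
    + lra.
have incr B : exists2 c, 0 <= c & forall n t, `|t - t0| <= B ->
    `|u n.+1 t - u n t| <= c / 2 ^+ n * expR (2 * K * `|t - t0|).
  have [C CP] := @continuous_bounded _ _ (fun t => u 1%N t - u 0%N t) (t0 - B) (t0 + B)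
     (fun t => cvgB (@cu 1%N t) (@cu 0%N t)).
  exists `|C| => //; elim=> [|n IH] t tB.
    rewrite expr0 divr1 -[leLHS]mulr1 ler_pM//.
      by rewrite (le_trans (CP _ _) (ler_norm C))// -ler_distlC distrC.
    by rewrite -expR0 ler_expR mulr_ge0// mulr_ge0// ltW.
  rewrite exprSr invfM mulrA.
  have C0 : 0 <= `|C| / 2 ^+ n by rewrite divr_ge0// exprn_ge0.
  apply: (dist_le (u n.+1) (u n) _ t (@cu _) (@cu _) C0).
  by move=> s st; apply: IH; exact: le_trans tB.
have unif B : exists c, forall n t, `|t - t0| <= B -> `|u n.+1 t - u n t| <= c / 2 ^+ n.
  have [c c0 cP] := incr B; exists (c * expR (2 * K * B)) => n t tB.
  rewrite (le_trans (cP n t tB))// mulrAC ler_wpM2r ?invr_ge0 ?exprn_ge0//.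
  by rewrite ler_wpM2l// ler_expR ler_wpM2l// mulr_ge0// ltW.
have lim t : exists l, forall e : R, 0 < e -> exists N, forall n, (N <= n)%N -> `|u n t - l| <= e.
  have [c cP] := unif `|t - t0|; apply: cauchy_epsN => e e0.
  have [N NP] := pow2_small (2 * c) (divr_gt0 e0 (ltr0n R 2)).
  have step k : `|u k.+1 t - u k t| <= c / 2 ^+ k by exact: cP.
  have key n : (N <= n)%N -> `|u n t - u N t| <= e / 2.
    by move=> Nn; rewrite (le_trans (geometric_increments Nn step))// NP.
  exists N => n m Nn Nm; rewrite (le_trans (ler_distD (u N t) _ _))// [e]splitr lerD ?key//.
  by rewrite distrC key.
have [x xP] := choice lim.
have ux B : exists c, forall n t, `|t - t0| <= B -> `|u n t - x t| <= c / 2 ^+ n.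
  have [c cP] := unif B; exists (2 * c) => n t tB; apply/ler_addgt0Pr => e e0.
  have [N NP] := xP t e e0.
  rewrite (le_trans (ler_distD (u (maxn N n) t) _ _))// lerD//.
    by rewrite distrC; exact: (@geometric_increments _ _ (fun k =>
      u k t) c n _ (leq_maxr N n) (fun k => cP k t tB)).
  by rewrite NP// leq_maxl.
have cx : continuous x.
  move=> t; apply/continuous_epsP => e e0.
  have [c cP] := ux (`|t - t0| + 1).
  have [n nP] := pow2_small c (divr_gt0 e0 (ltr0n R 4)).
  have [d d0 dP] := proj1 (continuous_epsP (u n) t) (@cu n t) _ (divr_gt0 e0 (ltr0n R 4)).
  exists (Num.min d 1); first by rewrite lt_min d0/=.
  move=> s; rewrite lt_min => /andP[/dP us s1].
  have st : `|s - t0| <= `|t - t0| + 1.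
    by rewrite (le_trans (ler_distD t _ _))// addrC lerD2l ltW.
  have := le_trans (cP n s st) (nP n (leqnn _)).
  have := le_trans (cP n t ltac:(by rewrite lerDl)) (nP n (leqnn _)).
  have := ler_distD (u n s) (x s) (x t); have := ler_distD (u n t) (u n s) (x t).
  rewrite [`|x s - u n s|]distrC; move: e0 us; lra.
have xI t : x t = I x t.
  apply/eqP; rewrite -subr_eq0 -normr_le0; apply/ler_addgt0Pr => e e0; rewrite add0r.
  have [c cP] := ux `|t - t0|.
  have [n nP] := pow2_small (`|c| * expR (2 * K * `|t - t0|)) (divr_gt0 e0 (ltr0n R 2)).
  have E1 : 1 <= expR (2 * K * `|t - t0|).
    by rewrite -expR0 ler_expR mulr_ge0// mulr_ge0// ltW.
  have h1 : `|u n.+1 t - x t| <= e / 2.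
    rewrite (le_trans (cP n.+1 t (lexx _)))// (le_trans _ (nP n.+1 (leqnSn _)))//.
    rewrite ler_wpM2r ?invr_ge0 ?exprn_ge0// (le_trans (ler_norm c))//.
    by rewrite ler_peMr.
  have h2 : `|u n.+1 t - I x t| <= e / 2.
    have w0 : 0 <= `|c| / 2 ^+ n by rewrite divr_ge0// exprn_ge0.
    have hs s : `|s - t0| <= `|t - t0| ->
        `|u n s - x s| <= `|c| / 2 ^+ n * expR (2 * K * `|s - t0|).
      move=> st; apply: (@le_trans _ _ (`|c| / 2 ^+ n)).
        by rewrite (le_trans (cP n s st))// ler_wpM2r ?invr_ge0 ?exprn_ge0// ler_norm.
      by rewrite ler_peMr// -expR0 ler_expR mulr_ge0// mulr_ge0// ltW.
    rewrite (le_trans (dist_le (u n) x _ t (@cu n) cx w0 hs))//.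
    have := nP n (leqnn _); rewrite mulrAC; have := expR_gt0 (2 * K * `|t - t0|).
    by move: w0; move: (expR _) (_ / _) => E w; nra.
  rewrite (le_trans (ler_distD (u n.+1 t) _ _))// [e]splitr lerD//.
  by rewrite distrC.
exists x; split=> // [|t tS]; first by rewrite xI I0.
have -> : x = I x by apply/funext.
have -> : phi t (I x t) = phi t (x t) by rewrite -xI.
exact: dI.
Qed.

End Picard.

(** * Piecewise continuous functions and their integrals *)

Section Within.
Context {R : realType}.

Lemma within_epsP {V W : normedModType R} (A : set V) (f : V -> W) :
  {within A, continuous f} <->
  forall x, A x -> forall e : R, 0 < e -> exists2 d : R, 0 < d &
    forall y, A y -> `|y - x| < d -> `|f y - f x| < e.
Proof.
split=> [/subspace_continuousP fA x Ax e e0|fA].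
  have /cvgrPdist_lt/(_ e e0)/nbhs_epsP[d d0 dP] := fA x Ax.
  by exists d => // y Ay yx; rewrite distrC; apply: dP.
apply/subspace_continuousP => x Ax; apply/cvgrPdist_lt => e e0.
have [d d0 dP] := fA x Ax e e0; apply/nbhs_epsP; exists d => // y yx Ay.
by rewrite distrC; apply: dP.
Qed.

Definition clamp (a b t : R) := Num.max (Num.min t b) a.

Lemma clamp_itv a b t : a <= b -> a <= clamp a b t <= b.
Proof. by move=> ab; rewrite /clamp le_max lexx orbT/= ge_max ge_min lexx orbT/=. Qed.

Lemma clampE a b t : a <= t <= b -> clamp a b t = t.
Proof. by move=> /andP[at_ tb]; rewrite /clamp (min_idPl tb) (max_idPl at_). Qed.

Lemma clamp_le a b t : a <= b -> b <= t -> clamp a b t = b.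
Proof. by move=> ab bt; rewrite /clamp (min_idPr bt) (max_idPl ab). Qed.

Lemma clamp_ge a b t : a <= b -> t <= a -> clamp a b t = a.
Proof.
by move=> ab ta; rewrite /clamp (min_idPl (le_trans ta ab)) (max_idPr ta).
Qed.

Lemma clamp_nonexpansive a b s t : `|clamp a b s - clamp a b t| <= `|s - t|.
Proof. exact: le_trans (max_nonexpansive _ _ _) (min_nonexpansive _ _ _). Qed.

Lemma clamp_continuous a b : continuous (clamp a b).
Proof.
apply: (@lipschitz_continuous _ _ _ _ 1) => s t; rewrite mul1r.
exact: clamp_nonexpansive.
Qed.

Lemma continuous_clamp {V : normedModType R} (f : R -> V) (a b : R) : a <= b ->
  {within `[a, b], continuous f} -> continuous (fun t => f (clamp a b t)).
Proof.
move=> ab /within_epsP fc t; apply/continuous_epsP => e e0.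
have cl s : `[a, b]%classic (clamp a b s) by rewrite /= in_itv; exact: clamp_itv.
have [d d0 dP] := fc _ (cl t) e e0; exists d => // s st; apply: dP => //.
exact: le_lt_trans (clamp_nonexpansive _ _ _ _) st.
Qed.

Lemma is_derive_clamp {V : normedModType R} (f : R -> V) (a b t : R) (l : V) : a < t < b ->
  is_derive t 1 f l -> is_derive t 1 (fun t => f (clamp a b t)) l.
Proof.
move=> /andP[at_ tb]; apply: is_derive_near.
exists (Num.min (t - a) (b - t)); first by rewrite lt_min !subr_gt0 at_.
move=> s; rewrite lt_min !ltr_norml => /andP[/andP[s1 s2] /andP[s3 s4]].
by rewrite clampE//; lra.
Qed.

End Within.

Section PiecewiseContinuousIntegral.
Context {R : realType}.
Notation mu := (@lebesgue_measure R).

Lemma regulated_bounded {V : normedModType R} (g : R -> V) (a b : R) : a <= b ->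
  regulated g -> exists C, forall t, a <= t <= b -> `|g t| <= C.
Proof.
move=> ab rg.
apply: (@real_induction _ (fun b => exists C, forall t, a <= t <= b -> `|g t| <= C) a b ab).
  by exists `|g a| => t; rewrite -eq_le => /eqP <-.
move=> c ac; have [[l1 gl1] [l2 gl2]] := rg c.
have [d1 d10 dP1] := proj1 (cvg_left_epsP _ _ _) gl1 1 ltr01.
have [d2 d20 dP2] := proj1 (cvg_right_epsP _ _ _) gl2 1 ltr01.
exists (Num.min d1 d2); first by rewrite lt_min d10.
move=> s t as_ /andP[cs sc] /andP[ct tc] [C CP].
have cs' : c - d1 < s by apply: le_lt_trans cs; rewrite lerD2l lerN2 ge_min lexx.
have tc' : t < c + d2 by apply: lt_le_trans tc _; rewrite lerD2l ge_min lexx orbT.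
exists (`|C| + `|g c| + (`|l1| + 1) + (`|l2| + 1)) => r /andP[ar rt].
have n1 := normr_ge0 C; have n2 := normr_ge0 (g c); have n3 := normr_ge0 l1.
have n4 := normr_ge0 l2.
have [rs|sr] := leP r s.
  by have := CP r ltac:(by rewrite ar); have := ler_norm C; lra.
have [rc|cr|->] := ltgtP r c; last lra.
- have := dP1 r ltac:(by rewrite rc (lt_trans cs')); have := ler_normD (g r - l1) l1.
  rewrite subrK; lra.
- have := dP2 r ltac:(by rewrite cr (le_lt_trans rt)); have := ler_normD (g r - l2) l2.
  rewrite subrK; lra.
Qed.

(** Continuity handles the open complement of the finite set [S]; on [S] itself every function is
    measurable. *)
Lemma pwc_measurable (S : seq R) (g : R -> R) :
  (forall t, t \notin S -> {for t, continuous g}) -> measurable_fun [set: R] g.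
Proof.
move=> cg.
have cS : closed [set` S].
  by apply: (proj1 accessible_finite_set_closed); [exact: hausdorff_accessible (@Rhausdorff R)|
    exact: finite_seq].
rewrite -(setvU [set` S]); apply/measurable_funU.
- by apply: open_measurable; rewrite openC.
- exact: closed_measurable.
split.
  apply: open_continuous_measurable_fun; first by rewrite openC.
  by move=> t; rewrite inE/= => /negP tS; exact: cg.
elim: S {cg cS} => [|s S IH].
  by rewrite (_ : [set` [::]] = set0); [exact: measurable_fun_set0|apply/seteqP; split].
rewrite (_ : [set` s :: S] = [set s] `|` [set` S]); last first.
  apply/seteqP; split=> t /=; rewrite inE; first by case/predU1P; [left|right].
  by case=> [->|->]; rewrite ?eqxx ?orbT.
apply/measurable_funU => //.
  by apply: closed_measurable; apply: (proj1 accessible_finite_set_closed);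
    [exact: hausdorff_accessible (@Rhausdorff R)|exact: finite_seq].
by split=> //; exact: measurable_fun_set1.
Qed.

Lemma pwc_integrable (S : seq R) (g : R -> R) a b : a <= b ->
  pwc S g -> mu.-integrable `[a, b] (EFin \o g).
Proof.
move=> ab [rg cg]; have [C CP] := regulated_bounded ab rg.
apply: measurable_bounded_integrable.
- exact: measurable_itv.
- by rewrite /= lebesgue_measure_itv/=; case: ifP => _; rewrite ltry.
- exact: measurable_funTS (pwc_measurable cg).
- exists `|C|; split; first exact: num_real.
  move=> M CM t /=; rewrite in_itv/= => tab.
  by rewrite (le_trans (CP t tab))// (le_trans (ler_norm C))// ltW.
Qed.

(** Links the Lebesgue integral of the costs to primitives: the integral as a function of its upper
    bound and [G] are continuous with the same derivative off [S]. *)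
Lemma pwc_FTC (S : seq R) (g G : R -> R) T : 0 < T -> pwc S g -> continuous G ->
  (forall t, 0 < t < T -> t \notin S -> is_derive t 1 G (g t)) ->
  \int[mu]_(t in `[0, T]) g t = G T - G 0.
Proof.
move=> T0 gS cG dG; have [_ cg] := gS.
have T1 : 0 <= T + 1 by rewrite addr_ge0// ltW.
pose F x := (\int[mu]_(t in `[0, x]) g t)%R.
have intg := pwc_integrable T1 gS.
have intg' := pwc_integrable (ltW T0) gS.
have Fc := parameterized_integral_continuous (ltW T0) intg'.
have cF : continuous (fun t => F (clamp 0 T t)) := continuous_clamp (ltW T0) Fc.
have := @same_derivative _ _ S _ _ 0 T (ltW T0) cF cG.
have F0 : F 0 = 0 by rewrite /F set_itv1 Rintegral_set1.
rewrite !clampE ?lexx ?ltW// F0 subr0; apply.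
move=> t /andP[t0 tT] tS; exists (g t); last by apply: dG; rewrite ?t0.
apply: is_derive_clamp; first by rewrite t0.
have tT1 : t < T + 1 by rewrite (lt_trans tT)// ltrDl.
have [dF Fg] := continuous_FTC1_closed tT1 intg t0 (cg t tS).
by split; [exact: dF|rewrite -derive1E].
Qed.

End PiecewiseContinuousIntegral.

(** * Bounded linear maps and differentials *)

Section BoundedLinearMaps.
Context {R : realType}.

Lemma blin_bound (V W : normedModType R) (f : blin V W) x : `|f x| <= `|f| * `|x|.
Proof.
have [->|x0] := eqVneq x 0; first by rewrite linear0 !normr0 mulr0.
have nx : 0 < `|x| by rewrite normr_gt0.
rewrite -ler_pdivrMr//.
have := @opnorm_ub R V W f (`|x|^-1 *: x).
rewrite linearZ/= !normrZ normfV normr_id mulVf ?gt_eqF// => /(_ (lexx _)).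
by rewrite mulrC.
Qed.

Lemma blin_norm_le (V W : normedModType R) (f : blin V W) (C : R) : 0 <= C ->
  (forall x, `|f x| <= C * `|x|) -> `|f| <= C.
Proof.
move=> C0 fC; apply: opnorm_le => x x1.
by rewrite (le_trans (fC x))// -[leRHS]mulr1 ler_wpM2l.
Qed.

Lemma blin_ext (V W : normedModType R) (f g : blin V W) : (forall x, f x = g x) -> f = g.
Proof. by move=> fg; apply/val_inj/funext. Qed.

Lemma bounded_linearP (V W : normedModType R) (f : V -> W) (C : R) :
  linear f -> (forall x, `|f x| <= C * `|x|) -> f \in bounded_linear V W.
Proof.
move=> lf fC; apply/asboolP; split=> //.
apply: (@lipschitz_continuous _ _ _ _ C) => x y.
have -> : f x - f y = f (x - y) by rewrite [x - y]addrC -[- y]scaleN1r lf scaleN1r addrC.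
exact: fC.
Qed.

Definition mkblin (V W : normedModType R) (f : V -> W) (C : R) (lf : linear f)
  (fC : forall x, `|f x| <= C * `|x|) : blin V W := BLin (bounded_linearP lf fC).

Lemma comp_linear (U V W : normedModType R) (g : blin V W) (f : blin U V) :
  linear (g \o f).
Proof. by move=> a x y /=; rewrite !linearP. Qed.

Lemma comp_bound (U V W : normedModType R) (g : blin V W) (f : blin U V) x :
  `|(g \o f) x| <= (`|g| * `|f|) * `|x|.
Proof.
rewrite /= (le_trans (blin_bound _ _))// -mulrA ler_wpM2l//; exact: blin_bound.
Qed.

Definition blin_comp (U V W : normedModType R) (g : blin V W) (f : blin U V) :
  blin U W := mkblin (comp_linear g f) (comp_bound g f).

Lemma blin_compE (U V W : normedModType R) (g : blin V W) (f : blin U V) x :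
  blin_comp g f x = g (f x).
Proof. by []. Qed.

Lemma blin_comp_norm (U V W : normedModType R) (g : blin V W) (f : blin U V) :
  `|blin_comp g f| <= `|g| * `|f|.
Proof.
apply: blin_norm_le; first by rewrite mulr_ge0.
exact: comp_bound.
Qed.

Lemma blin_addE (V W : normedModType R) (f g : blin V W) x : (f + g) x = f x + g x.
Proof. by []. Qed.
Lemma blin_oppE (V W : normedModType R) (f : blin V W) x : (- f) x = - f x.
Proof. by []. Qed.
Lemma blin_scaleE (V W : normedModType R) a (f : blin V W) x : (a *: f) x = a *: f x.
Proof. by []. Qed.
Lemma blin_zeroE (V W : normedModType R) x : (0 : blin V W) x = 0.
Proof. by []. Qed.
Lemma blin_sumE (V W : normedModType R) I (s : seq I) (P : pred I) (F : I -> blin V W) x :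
  (\sum_(i <- s | P i) F i) x = \sum_(i <- s | P i) F i x.
Proof. by elim/big_rec2 : _ => // i _ y _ <-. Qed.

Lemma is_derive_blin_apply (V W : normedModType R) (p : R -> blin V W) (y : R -> V) (t : R)
    (p' : blin V W) (y' : V) :
  is_derive t 1 p p' -> is_derive t 1 y y' ->
  is_derive t 1 (fun t => p t (y t)) (p' (y t) + p t y').
Proof.
move=> /is_derive_epsP dp dy0; have /is_derive_continuous/continuous_epsP cy := dy0.
move: dy0 => /is_derive_epsP dy.
apply/is_derive_epsP => e e0.
pose A := `|p t| + 1; pose B := `|y t| + 1; pose C := `|p'| + 1.
have A0 : 0 < A by rewrite ltr_wpDl.
have B0 : 0 < B by rewrite ltr_wpDl.
have C0 : 0 < C by rewrite ltr_wpDl.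
have [d1 d10 P1] := dp (e / 3 / B) ltac:(by rewrite !divr_gt0).
have [d2 d20 P2] := dy (e / 3 / A) ltac:(by rewrite !divr_gt0).
have [d3 d30 P3] := cy (Num.min 1 (e / 3 / C)) ltac:(by rewrite lt_min ltr01 !divr_gt0).
exists (Num.min d1 (Num.min d2 d3)); first by rewrite !lt_min d10 d20.
move=> h; rewrite !lt_min => /and3P[/P1 h1 /P2 h2 hd3].
have := P3 (t + h); rewrite addrAC subrr add0r => /(_ hd3); rewrite lt_min => /andP[y1 y2].
have -> : p (t + h) (y (t + h)) - p t (y t) - h *: (p' (y t) + p t y') =
   (p (t + h) - p t - h *: p') (y (t + h)) + p t (y (t + h) - y t - h *: y')
   + h *: p' (y (t + h) - y t).
  rewrite !blin_addE !blin_oppE blin_scaleE !(linearB (p t)) (linearB p') (linearZ_LR (p t)) scalerDr.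
  rewrite scalerBr.
  exact: zmod_telescope.
rewrite (le_trans (ler_normD _ _))// (le_trans (lerD (ler_normD _ _) (lexx _)))//.
have yB : `|y (t + h)| <= B.
  by rewrite -[y (t + h)](subrK (y t)) (le_trans (ler_normD _ _))// addrC lerD2l ltW.
have tA : `|p t| <= A by rewrite lerDl.
have pC : `|p'| <= C by rewrite lerDl.
have k1 : `|(p (t + h) - p t - h *: p') (y (t + h))| <= e / 3 / B * `|h| * B.
  by rewrite (le_trans (blin_bound _ _))// ler_pM.
have k2 : `|p t (y (t + h) - y t - h *: y')| <= A * (e / 3 / A * `|h|).
  by rewrite (le_trans (blin_bound _ _))// ler_pM.
have k3 : `|h *: p' (y (t + h) - y t)| <= `|h| * (C * (e / 3 / C)).
  by rewrite normrZ ler_wpM2l// (le_trans (blin_bound _ _))// ler_pM// ltW.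
rewrite (le_trans (lerD (lerD k1 k2) k3))//.
rewrite [X in X + _ + _]mulrAC divfK ?gt_eqF// mulrA [A * _]mulrC divfK ?gt_eqF//.
rewrite [C * _]mulrC divfK ?gt_eqF//; lra.
Qed.

End BoundedLinearMaps.

Section BlinComplete.
Context {R : realType} {V : normedModType R} {W : completeNormedModType R}.

Lemma blin_limit (f : nat -> blin V W) :
  (forall n m, (n <= m)%N -> `|f n - f m| <= 2 / 2 ^+ n) ->
  exists g : blin V W, forall n, `|f n - g| <= 2 / 2 ^+ n.
Proof.
move=> fC.
have fx x n m : (n <= m)%N -> `|f n x - f m x| <= 2 / 2 ^+ n * `|x|.
  move=> nm; rewrite (_ : f n x - f m x = (f n - f m) x)//.
  by rewrite (le_trans (blin_bound _ _))// ler_wpM2r// fC.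
have lim x : exists l, forall e : R, 0 < e ->
    exists N, forall n, (N <= n)%N -> `|f n x - l| <= e.
  apply: cauchy_epsN => e e0; have [N NP] := pow2_small (2 * `|x|) (divr_gt0 e0 (ltr0n R 2)).
  have key n : (N <= n)%N -> `|f N x - f n x| <= e / 2.
    by move=> Nn; rewrite (le_trans (fx _ _ _ Nn))// mulrAC NP.
  exists N => n m Nn Nm; rewrite (le_trans (ler_distD (f N x) _ _))// [e]splitr lerD ?key//.
  by rewrite distrC key.
have [g gP] := choice lim.
have fg n x : `|f n x - g x| <= 2 / 2 ^+ n * `|x|.
  apply/ler_addgt0Pr => e e0; have [N NP] := gP x e e0.
  rewrite (le_trans (ler_distD (f (maxn N n) x) _ _))// lerD//.
    by rewrite fx// leq_maxr.
  by rewrite NP// leq_maxl.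
have lg : linear g.
  move=> a x y; apply/eqP; rewrite -subr_eq0 -normr_le0; apply/ler_addgt0Pr => e e0; rewrite add0r.
  have [n nP] := pow2_small (2 * `|a *: x + y| + `|a| * (2 * `|x|) + 2 * `|y|) e0.
  apply: le_trans (nP n (leqnn _)).
  have := fg n (a *: x + y); have := fg n x; have := fg n y.
  rewrite linearP => h1 h2 h3.
  have -> : g (a *: x + y) - (a *: g x + g y) =
     - (a *: f n x + f n y - g (a *: x + y)) + a *: (f n x - g x) + (f n y - g y).
    by rewrite opprB scalerBr -[RHS]addrA [X in _ = _ + X]addrACA subrKA opprD.
  rewrite (le_trans (ler_normD _ _))// [leRHS]mulrDl lerD//; last by rewrite mulrAC.
  rewrite (le_trans (ler_normD _ _))// [leRHS]mulrDl lerD//; first by rewrite normrN mulrAC.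
  by rewrite normrZ -mulrA ler_wpM2l// mulrAC.
have gB x : `|g x| <= (`|f 0%N| + 2) * `|x|.
  rewrite -[g x](subrK (f 0%N x)) (le_trans (ler_normD _ _))// addrC mulrDl lerD//.
    exact: blin_bound.
  by rewrite distrC; have := fg 0%N x; rewrite expr0 divr1.
exists (mkblin lg gB) => n; apply: blin_norm_le; first by rewrite divr_ge0// exprn_ge0.
exact: fg.
Qed.

(** Completeness of the operator space lets the adjoint equation be solved by [ode_global_solution],
    with values in [blin E R]. *)
Lemma blin_complete (F : set_system (blin V W)) {FF : ProperFilter F} :
  cauchy F -> cvg F.
Proof.
move=> /cauchyP Fc.
have small (n : nat) : exists f : blin V W, F (ball f (2 ^+ n)^-1).
  by apply: Fc; rewrite invr_gt0 exprn_gt0.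
have [f fP] := choice small.
have [|g gP] := @blin_limit f.
  move=> n m nm; have [h [h1 h2]] := filter_ex (filterI (fP n) (fP m)).
  rewrite -ball_normE/= in h1; rewrite -ball_normE/= in h2.
  rewrite (le_trans (ler_distD h _ _))// mulrDl mul1r lerD ?ltW//.
  rewrite distrC in h2; apply: lt_le_trans h2 _.
  by rewrite lef_pV2 ?posrE ?exprn_gt0// ler_weXn2l// ler1n.
apply/cvg_ex; exists g; apply/cvg_ballP => e e0.
have [n nP] := pow2_small 3 (divr_gt0 e0 (ltr0n R 2)).
apply: filterS (fP n) => h; rewrite -!ball_normE/= => hn.
rewrite (le_lt_trans (ler_distD (f n) _ _))//.
have := gP n; rewrite distrC => gn; have := nP n (leqnn _).
by move: gn hn; move: (2 ^+ n)^-1 => w; lra.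
Qed.

HB.instance Definition _ := Uniform_isComplete.Build (blin V W) blin_complete.

End BlinComplete.

Section DifferentialFacts.
Context {R : realType} {V W : normedModType R}.
Implicit Types (f : V -> W) (x : V) (L : blin V W).

Lemma is_Gdiff_epsP f x L : is_Gdiff f x L <->
  forall h (e : R), 0 < e -> exists2 d : R, 0 < d &
    forall t, 0 < t < d -> `|f (x + t *: h) - f x - t *: L h| <= e * t.
Proof.
have quot h t : 0 < t -> `|f (x + t *: h) - f x - t *: L h| =
    t * `|t^-1 *: (f (x + t *: h) - f x) - L h|.
  move=> t0; have tz (z : W) : t * `|z| = `|t *: z| by rewrite normrZ gtr0_norm.
  by rewrite tz scalerBr scalerA mulfV ?gt_eqF// scale1r.
split=> [fL h e e0|fL h].
  have [d d0 dP] := proj1 (cvg_right_epsP _ _ _) (fL h) e e0; exists d => // t /andP[t0 td].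
  by rewrite quot// mulrC ler_pM2r// dP// t0 add0r.
apply/cvg_right_epsP => e e0; have [d d0 dP] := fL h e e0.
exists d => // t; rewrite add0r => td; have /andP[t0 _] := td.
by rewrite -(ler_pM2l t0) -quot// mulrC dP.
Qed.

Lemma is_Gdiff_unique f x L L' : is_Gdiff f x L -> is_Gdiff f x L' -> L = L'.
Proof.
move=> fL fL'; apply: blin_ext => h.
exact: (cvg_unique (@norm_hausdorff _ _) (fL h) (fL' h)).
Qed.

Lemma is_Fdiff_epsP f x L : is_Fdiff f x L <->
  forall e : R, 0 < e -> exists2 d : R, 0 < d &
    forall h, `|h| < d -> `|f (x + h) - f x - L h| <= e * `|h|.
Proof.
split=> [[df fL] e e0|fL].
  have /eqaddoP/(_ e e0)/nbhs_epsP[d d0 dP] := diff_locally df.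
  exists d => // h hd; have := dP h; rewrite subr0 => /(_ hd).
  rewrite fL !fctE/= [h + x]addrC.
  by rewrite (_ : f (x + h) - (f x + L h) = f (x + h) - f x - L h)// opprD addrA.
have fo : f \o shift x = cst (f x) + (L : V -> W) +o_ 0 id.
  apply/eqaddoP => e e0; have [d d0 dP] := fL e e0.
  apply/nbhs_epsP; exists d => // h; rewrite subr0 => /dP.
  by rewrite !fctE/= [h + x]addrC opprD addrA.
have dL : 'd f x = L :> (V -> W) := diff_unique (@blin_continuous _ _ _ L) fo.
split=> //; apply/diff_locallyP; rewrite dL; split=> //; exact: blin_continuous.
Qed.

Lemma is_Fdiff_Gdiff f x L : is_Fdiff f x L -> is_Gdiff f x L.
Proof.
move=> /is_Fdiff_epsP fL; apply/is_Gdiff_epsP => h e e0.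
have h1 : 0 < `|h| + 1 by rewrite ltr_wpDl.
have [d d0 dP] := fL (e / (`|h| + 1)) (divr_gt0 e0 h1).
exists (d / (`|h| + 1)); first exact: divr_gt0.
move=> t /andP[t0 td]; rewrite -linearZ/=.
rewrite (le_trans (dP _ _))// normrZ (gtr0_norm t0).
  rewrite (@le_lt_trans _ _ (t * (`|h| + 1)))// ?ler_pM2l// ?lerDl// -ltr_pdivlMr//.
rewrite mulrCA mulrC ler_pM2r// mulrAC ler_pdivrMr// ler_pM2l// lerDl//.
Qed.

Lemma is_Fdiff_unique f x L L' : is_Fdiff f x L -> is_Fdiff f x L' -> L = L'.
Proof. by move=> /is_Fdiff_Gdiff fL /is_Fdiff_Gdiff; exact: is_Gdiff_unique. Qed.

Lemma DGP f x : Gdifferentiable f x -> is_Gdiff f x (DG f x).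
Proof. by move=> [L fL]; exact: (@getPex _ [set L | is_Gdiff f x L] (ex_intro _ L fL)). Qed.

Lemma DFP f x : Fdifferentiable f x -> is_Fdiff f x (DF f x).
Proof. by move=> [L fL]; exact: (@getPex _ [set L | is_Fdiff f x L] (ex_intro _ L fL)). Qed.

Lemma DHP f x : Hdifferentiable f x -> is_Hdiff f x (DH f x).
Proof. by move=> [L fL]; exact: (@getPex _ [set L | is_Hdiff f x L] (ex_intro _ L fL)). Qed.

Lemma DFE f x L : is_Fdiff f x L -> DF f x = L.
Proof.
move=> fL; have fd : Fdifferentiable f x by exists L.
exact: (is_Fdiff_unique (DFP fd) fL).
Qed.

(** A Gateaux differential is defined by one-sided limits; the derivative along a line combines
    those in the directions [h] and [- h]. *)
Lemma is_Gdiff_derive f x h s L : is_Gdiff f (x + s *: h) L ->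
  is_derive s 1 (fun s : R => f (x + s *: h)) (L h).
Proof.
move=> /is_Gdiff_epsP fL; apply/is_derive_epsP => e e0.
have [d1 d10 dP1] := fL h e e0; have [d2 d20 dP2] := fL (- h) e e0.
exists (Num.min d1 d2); first by rewrite lt_min d10.
move=> t; rewrite lt_min => /andP[td1 td2].
rewrite scalerDl addrA; have [t0|t0|->] := ltgtP t 0.
- have := dP2 (- t); rewrite scalerN -scaleNr opprK linearN/= scalerN -scaleNr opprK.
  by rewrite ltr0_norm//; apply; rewrite oppr_gt0 t0/= -(ltr0_norm t0).
- by rewrite gtr0_norm//; apply: dP1; rewrite t0 -(gtr0_norm t0).
- by rewrite !scale0r addr0 subrr subr0 !normr0 mulr0.
Qed.

(** Mean value inequality along the segment. The parameter is clamped to [[0, 1]] because nothing is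
    known of [f] on the rest of the line. *)
Lemma Gdiff_lipschitz f x y (C : R) :
  (forall s, 0 <= s <= 1 -> exists2 L, is_Gdiff f (x + s *: (y - x)) L & `|L| <= C) ->
  `|f y - f x| <= C * `|y - x|.
Proof.
move=> fL; pose clamp (s : R) := Num.max (Num.min s 1) 0.
have cl01 (s : R) : 0 <= clamp s <= 1.
  by rewrite /clamp le_max lexx orbT/= ge_max ge_min lexx orbT/=.
have clE (s : R) : 0 <= s <= 1 -> clamp s = s.
  by move=> /andP[s0 s1]; rewrite /clamp (min_idPl s1) (max_idPl s0).
have cc : continuous clamp.
  apply: (@lipschitz_continuous _ _ _ _ 1) => s t; rewrite mul1r.
  exact: le_trans (max_nonexpansive _ _ _) (min_nonexpansive _ _ _).
pose D (s : R) := f (x + s *: (y - x)).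
have dD (s : R) : 0 <= s <= 1 -> exists2 l, is_derive s 1 D l & `|l| <= C * `|y - x|.
  move=> /fL[L sL LC]; exists (L (y - x)); first exact: is_Gdiff_derive.
  by rewrite (le_trans (blin_bound _ _))// ler_wpM2r.
have := @mean_value_le _ _ [::] (fun s => D (clamp s)) (C * `|y - x|) 0 1 ler01.
rewrite !clE ?lexx ?ler01// /D scale1r scale0r addr0 addrCA subrr addr0 subr0 mulr1.
apply.
- move=> s; have [l dl _] := dD _ (cl01 s).
  exact: (@continuous_comp _ _ _ clamp D s (@cc s) (is_derive_continuous dl)).
- move=> s /andP[s0 s1] _; have [|l dl lC] := dD s; first by rewrite !ltW.
  exists l => //; apply: is_derive_near dl; exists (Num.min s (1 - s)).
    by rewrite lt_min s0 subr_gt0.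
  move=> r; rewrite lt_min !ltr_norml => /andP[/andP[r1 _] /andP[_ r2]].
  rewrite clE//; lra.
Qed.

End DifferentialFacts.

(** * Piecewise continuous controls *)

Section Subdivisions.
Context {R : realType}.
Implicit Types (S : seq R) (T t : R).

Lemma tau_lt T s i j : itv_partition 0 T s -> (i < j <= size s)%N -> tau s i < tau s j.
Proof.
move=> [ps _] /andP[ij js]; have ss : sorted <%O (0 :: s) by [].
by rewrite /tau (lt_sorted_ltn_nth 0 ss) ?inE//= ltnS (leq_trans (ltnW ij)).
Qed.

Lemma tau_size T s : itv_partition 0 T s -> tau s (size s) = T.
Proof. by move=> [_ /eqP <-]; rewrite /tau -(last_nth 0 0 s)//. Qed.

Lemma tau_bounds T s i : itv_partition 0 T s -> (i < size s)%N ->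
  [/\ 0 <= tau s i, tau s i < tau s i.+1 & tau s i.+1 <= T].
Proof.
move=> sT si; split.
- case: i si => [//|i] si; rewrite ltW//.
  by apply: (@tau_lt T s 0 i.+1 sT); rewrite /= ltnW.
- by apply: (tau_lt sT); rewrite ltnSn.
- rewrite -(tau_size sT); move: si; rewrite leq_eqVlt => /predU1P[->//|si].
  by rewrite ltW// (tau_lt sT)// si leqnn.
Qed.

Lemma tau_neighbour T s t : itv_partition 0 T s -> 0 < t -> t <= T ->
  exists2 i, (i < size s)%N & tau s i < t <= tau s i.+1.
Proof.
move=> sT t0 tT; have [ts|ts] := boolP (t \in 0 :: s); last first.
  have [|i si /andP[h1 h2]] := itv_partition_mem sT _ ts; first by rewrite ltW.
  by exists i => //; rewrite h1 ltW.
move: ts; rewrite inE (gt_eqF t0)/= => ts.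
exists (index t s); first by rewrite index_mem.
have E : tau s (index t s).+1 = t by rewrite /tau/= nth_index.
by rewrite E lexx andbT -{2}E (tau_lt sT)// ltnSn index_mem.
Qed.

(** Sorting the points of [S] in []0, T]] together with [T] turns a list of exceptional points back
    into a subdivision. *)
Lemma partition_avoiding S T : 0 < T -> exists2 s, itv_partition 0 T s &
  forall i t, (i < size s)%N -> tau s i < t < tau s i.+1 -> t \notin S.
Proof.
move=> T0; pose s := sort <=%O (undup [seq x <- T :: S | 0 < x <= T]).
have sE x : (x \in s) = (0 < x <= T) && (x \in T :: S).
  by rewrite mem_sort mem_undup mem_filter.
have ss : sorted <%O s by rewrite sort_lt_sorted undup_uniq.
have Ts : T \in s by rewrite sE T0 lexx mem_head.
have s0 : path <%O 0 s.
  by rewrite lt_path_sortedE ss andbT; apply/allP => x; rewrite sE => /andP[/andP[]].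
have lastT : last 0 s == T.
  have : last 0 s \in s by case: (s) Ts => // a s' _; rewrite /= mem_last.
  move=> ls; have := ls; rewrite sE => /andP[/andP[_ lT] _]; rewrite eq_le lT/=.
  have /(nthP 0)[j js <-] := Ts; rewrite -nth_last.
  rewrite (lt_sorted_leq_nth 0 ss) ?inE//; first by rewrite -ltnS prednK// (leq_trans _ js).
  by rewrite prednK// (leq_trans _ js).
have sT : itv_partition 0 T s by [].
exists s => // i t si /andP[it ti]; apply/negP => tS.
have [i0 _ iT] := tau_bounds sT si.
have ts : t \in s by rewrite sE (le_lt_trans i0 it) (ltW (lt_le_trans ti iT)) inE tS orbT.
have js : (index t s < size s)%N by rewrite index_mem.
have E : tau s (index t s).+1 = t by rewrite /tau/= nth_index.
have [ij|ij] := leqP (index t s).+1 i.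
  have : tau s (index t s).+1 <= tau s i.
    move: ij; rewrite leq_eqVlt => /predU1P[->//|ij].
    by rewrite ltW// (tau_lt sT)// ij ltnW.
  by rewrite E leNgt it.
have : tau s i.+1 <= tau s (index t s).+1.
  move: ij; rewrite ltnS leq_eqVlt => /predU1P[->//|ij].
  by rewrite ltW// (tau_lt sT)// ltnS ij.
by rewrite E leNgt ti.
Qed.

Lemma seq_isolated S (t : R) : exists2 d : R, 0 < d & forall s, `|s - t| < d -> s != t ->
  s \notin S.
Proof.
elim: S => [|a S [d d0 dP]]; first by exists 1.
have [->|at_] := eqVneq a t.
  by exists d => // s st snt; rewrite inE negb_or snt; exact: dP.
exists (Num.min d `|a - t|); first by rewrite lt_min d0 normr_gt0 subr_eq0.
move=> s; rewrite lt_min => /andP[sd sa] snt; rewrite inE negb_or dP// andbT.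
by apply: contraTneq sa => ->; rewrite ltxx.
Qed.

End Subdivisions.

Section Cadlag.
Context {R : realType}.
Implicit Types (S : seq R).

(** Left limits are asked to lie in [U] because the data are continuous on [U] only. *)
Definition cadlag {Y : normedModType R} S (U : set Y) (u : R -> Y) : Prop :=
  [/\ forall t, U (u t), forall t, t \notin S -> {for t, continuous u},
      forall t, u s @[s --> t^'+] --> u t &
      forall t, exists2 y : Y, U y & u s @[s --> t^'-] --> y].

Lemma cadlag_pwc {Y : normedModType R} S (U : set Y) u : cadlag S U u -> pwc S u.
Proof.
move=> [_ uc ur ul]; split=> // t; split; last by exists (u t).
by have [y _ uy] := ul t; exists y.
Qed.

Lemma cadlag_sub {Y : normedModType R} S S' (U : set Y) u :
  {subset S <= S'} -> cadlag S U u -> cadlag S' U u.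
Proof.
by move=> SS' [h1 h2 h3 h4]; split=> // t tS; apply: h2; apply: contra tS; exact: SS'.
Qed.

Lemma continuous_right {V : normedModType R} (f : R -> V) (t : R) :
  {for t, continuous f} -> f s @[s --> t^'+] --> f t.
Proof. exact: cvg_at_right_filter. Qed.

Lemma continuous_left {V : normedModType R} (f : R -> V) (t : R) :
  {for t, continuous f} -> f s @[s --> t^'-] --> f t.
Proof. exact: cvg_at_left_filter. Qed.

Lemma cvg_right_near {V : normedModType R} (f g : R -> V) (t d : R) (l : V) : 0 < d ->
  (forall s, t < s < t + d -> f s = g s) -> f s @[s --> t^'+] --> l -> g s @[s --> t^'+] --> l.
Proof.
move=> d0 fg /cvg_right_epsP fl; apply/cvg_right_epsP => e e0.
have [d' d'0 dP] := fl e e0; exists (Num.min d d'); first by rewrite lt_min d0.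
move=> s /andP[ts]; rewrite -ltrBlDl lt_min => /andP[s1 s2].
by rewrite -fg ?ts -?ltrBlDl//; apply: dP; rewrite ts -ltrBlDl.
Qed.

Lemma cvg_left_near {V : normedModType R} (f g : R -> V) (t d : R) (l : V) : 0 < d ->
  (forall s, t - d < s < t -> f s = g s) -> f s @[s --> t^'-] --> l -> g s @[s --> t^'-] --> l.
Proof.
move=> d0 fg /cvg_left_epsP fl; apply/cvg_left_epsP => e e0.
have [d' d'0 dP] := fl e e0; exists (Num.min d d'); first by rewrite lt_min d0.
move=> s /andP[s1 st]; have := s1; rewrite ltrBlDl -ltrBlDr lt_min => /andP[s2 s3].
by rewrite -fg ?st ?andbT; [apply: dP; rewrite st andbT; lra|lra].
Qed.

Lemma continuous_near {V : normedModType R} (f g : R -> V) (t d : R) : 0 < d ->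
  (forall s, `|s - t| < d -> f s = g s) -> {for t, continuous f} -> {for t, continuous g}.
Proof.
move=> d0 fg /continuous_epsP fc; apply/continuous_epsP => e e0.
have [d' d'0 dP] := fc e e0; exists (Num.min d d'); first by rewrite lt_min d0.
move=> s; rewrite lt_min => /andP[s1 s2]; rewrite -!fg ?subrr ?normr0//; exact: dP.
Qed.

Lemma cadlag_comp {Y V : normedModType R} S (U : set Y) (u : R -> Y) (Phi : R * Y -> V) :
  {within setT `*` U, continuous Phi} -> cadlag S U u ->
  cadlag S setT (fun t => Phi (t, u t)).
Proof.
move=> /within_epsP Phic [uU uc ur ul].
have close (t : R) (y : Y) e : U y -> 0 < e -> exists2 d : R, 0 < d & forall s y',
    U y' -> `|s - t| < d -> `|y' - y| < d -> `|Phi (s, y') - Phi (t, y)| < e.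
  move=> Uy e0; have [//|d d0 dP] := Phic (t, y) _ e e0.
  by exists d => // s y' Uy' st yy'; apply: dP => //; rewrite prod_normE/= gt_max st.
split=> // t.
- move=> tS; apply/continuous_epsP => e e0; have [d d0 dP] := close t (u t) e (uU t) e0.
  have [d' d'0 uP] := proj1 (continuous_epsP _ _) (uc t tS) d d0.
  exists (Num.min d d'); first by rewrite lt_min d0.
  by move=> s; rewrite lt_min => /andP[s1 s2]; apply: dP => //; exact: uP.
- apply/cvg_right_epsP => e e0; have [d d0 dP] := close t (u t) e (uU t) e0.
  have [d' d'0 uP] := proj1 (cvg_right_epsP _ _ _) (ur t) (d / 2) (divr_gt0 d0 (ltr0n R 2)).
  exists (Num.min d d'); first by rewrite lt_min d0.
  move=> s /andP[ts]; rewrite -ltrBlDl lt_min => /andP[s1 s2].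
  rewrite ltW// dP//; first by rewrite gtr0_norm// subr_gt0.
  by rewrite (le_lt_trans (uP s _)) ?ts -?ltrBlDl// ltr_pdivrMr// ltr_pMr// ltr1n.
- have [y Uy uy] := ul t; exists (Phi (t, y)) => //.
  apply/cvg_left_epsP => e e0; have [d d0 dP] := close t y e Uy e0.
  have [d' d'0 uP] := proj1 (cvg_left_epsP _ _ _) uy (d / 2) (divr_gt0 d0 (ltr0n R 2)).
  exists (Num.min d d'); first by rewrite lt_min d0.
  move=> s /andP[s1 st]; have := s1; rewrite ltrBlDl -ltrBlDr lt_min => /andP[s2 s3].
  rewrite ltW// dP//; first by rewrite ltr0_norm ?subr_lt0//; lra.
  by rewrite (le_lt_trans (uP s _)) ?st ?andbT//; [lra|rewrite ltr_pdivrMr// ltr_pMr// ltr1n].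
Qed.

End Cadlag.

Section Conversions.
Context {R : realType}.
Variables (T : R).
Hypothesis T0 : 0 < T.

(** Freezing outside [[0, T]] creates no jump, thanks to right continuity at 0 and to
    [u(T-) = u(T)]. Keeping [T] out of [S] records the second fact, which the converse needs. *)
Lemma NPC0_cadlag {Y : normedModType R} (U : set Y) (u : R -> Y) : NPC0 T U u ->
  exists2 S, T \notin S & cadlag S U (fun t => u (clamp 0 T t)).
Proof.
move=> [uU [s sT sP] ur uT]; exists [seq x <- s | x < T].
  by rewrite mem_filter ltxx.
have T0' := ltW T0.
have cvgr t : u (clamp 0 T r) @[r --> t^'+] --> u (clamp 0 T t).
  have [t0|t0] := ltP t 0.
    rewrite (clamp_ge T0' (ltW t0)).
    apply: (@cvg_right_near _ _ (fun=> u 0) _ t (- t)); rewrite ?oppr_gt0//; last exact: cvg_cst.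
    by move=> r /andP[_ rt]; rewrite clamp_ge//; lra.
  have [tT|tT] := ltP t T; last first.
    rewrite (clamp_le T0' tT).
    apply: (@cvg_right_near _ _ (fun=> u T) _ t 1); rewrite ?ltr01//; last exact: cvg_cst.
    by move=> r /andP[tr _]; rewrite clamp_le// (le_trans tT)// ltW.
  rewrite (clampE (t := t)) ?t0 ?ltW//.
  apply: (@cvg_right_near _ _ u _ t (T - t)); rewrite ?subr_gt0//.
    by move=> r /andP[tr rT]; rewrite clampE//; lra.
  by apply: ur; rewrite in_itv/= t0.
have contu t : 0 < t < T -> t \notin s -> {for t, continuous u}.
  move=> /andP[t0 tT] ts; have [||i si it] := itv_partition_mem sT (t := t).
  - by rewrite !ltW.
  - by rewrite inE negb_or ts gt_eqF.
  by have [ci _ _] := sP i si; apply: ci; rewrite in_itv.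
have cvgl t : exists2 y, U y & u (clamp 0 T r) @[r --> t^'-] --> y.
  have [t0|t0] := leP t 0.
    exists (u 0); first by apply: uU; rewrite in_itv/= lexx.
    apply: (@cvg_left_near _ _ (fun=> u 0) _ t 1); rewrite ?ltr01//; last exact: cvg_cst.
    by move=> r /andP[_ rt]; rewrite clamp_ge//; lra.
  have [Tt|tT] := ltP T t.
    exists (u T); first by apply: uU; rewrite in_itv/= lexx T0'.
    apply: (@cvg_left_near _ _ (fun=> u T) _ t (t - T)); rewrite ?subr_gt0//; last exact: cvg_cst.
    by move=> r /andP[rt _]; rewrite clamp_le//; lra.
  have [i si /andP[it]] := tau_neighbour sT t0 tT.
  have [i0 _ iT] := tau_bounds sT si.
  have [ci _ [y Uy uy]] := sP i si.
  rewrite le_eqVlt => /predU1P[ti|ti].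
    exists y => //; rewrite ti; apply: (@cvg_left_near _ _ u _ _ (tau s i.+1 - tau s i)) uy.
      by rewrite subr_gt0 -ti.
    by move=> r /andP[r1 r2]; rewrite clampE//; lra.
  exists (u t); first by apply: uU; rewrite in_itv/= tT ltW.
  apply: (@cvg_left_near _ _ u _ _ t) => //.
    by move=> r /andP[r1 r2]; rewrite clampE//; lra.
  by apply: continuous_left; apply: ci; rewrite in_itv/= it.
split=> // t.
  by apply: uU; rewrite in_itv/=; exact: clamp_itv.
rewrite mem_filter negb_and => tS.
have [tT|tT|tT] := ltgtP t T; last 1 first.
- apply/continuous_epsP => e e0.
  have [d1 d10 P1] := proj1 (cvg_right_epsP _ _ _) (cvgr t) (e / 2) (divr_gt0 e0 (ltr0n R 2)).
  have [d2 d20 P2] := proj1 (cvg_left_epsP _ _ _) uT (e / 2) (divr_gt0 e0 (ltr0n R 2)).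
  have e2 : e / 2 < e by rewrite ltr_pdivrMr// ltr_pMr// ltr1n.
  exists (Num.min d1 (Num.min d2 T)); first by rewrite !lt_min d10 d20.
  move=> r; rewrite !lt_min => /and3P[r1 r2 r3]; have [rt|rt|->] := ltgtP r t.
  + rewrite (le_lt_trans _ e2)// tT (clampE (t := T)) ?lexx ?T0'// clampE.
      by apply: P2; move: r2; rewrite tT ltr_norml -tT rt; lra.
    by move: r3; rewrite tT ltr_norml; lra.
  + by rewrite (le_lt_trans _ e2)// P1// rt; move: r1; rewrite ltr_norml; lra.
  + by rewrite subrr normr0.
- have [t0|t0|->] := ltgtP t 0.
  + apply: (@continuous_near _ _ (fun=> u 0) _ t (- t)); rewrite ?oppr_gt0//;
    last exact: cst_continuous.
    by move=> r; rewrite ltr_norml => /andP[_ r2]; rewrite clamp_ge//; lra.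
  + apply: (@continuous_near _ _ u _ t (Num.min t (T - t))).
    * by rewrite lt_min t0 subr_gt0.
    * by move=> r; rewrite lt_min !ltr_norml => ?; rewrite clampE//; lra.
    * by apply: contu; [rewrite t0|move: tS; rewrite tT].
  + have := cvgr 0; rewrite (clampE (t := 0)) ?lexx ?T0'// => cr.
    apply/continuous_epsP => e e0.
    have [d1 d10 P1] := proj1 (cvg_right_epsP _ _ _) cr (e / 2) (divr_gt0 e0 (ltr0n R 2)).
    have e2 : e / 2 < e by rewrite ltr_pdivrMr// ltr_pMr// ltr1n.
    exists d1 => // r; rewrite subr0 => rd; rewrite (clampE (t := 0)) ?lexx ?T0'//.
    have [r0|r0] := leP r 0; first by rewrite clamp_ge// subrr normr0.
    by rewrite (le_lt_trans _ e2)// P1// add0r r0 -(gtr0_norm r0).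
- apply: (@continuous_near _ _ (fun=> u T) _ t (t - T)); rewrite ?subr_gt0//;
  last exact: cst_continuous.
  by move=> r; rewrite ltr_norml => /andP[r1 _]; rewrite clamp_le//; lra.
Qed.

Lemma cadlag_NPC0 {Y : normedModType R} S (U : set Y) (u : R -> Y) :
  T \notin S -> cadlag S U u -> NPC0 T U u.
Proof.
move=> TS [uU uc ur ul]; have [s sT sS] := partition_avoiding S T0.
split=> //; last exact: continuous_left (uc T TS).
exists s => // i si; split=> //.
  by move=> t; rewrite in_itv/= => ti; apply: uc; exact: sS ti.
by exists (u (tau s i)).
Qed.

(** Off [S] the derivative of [x] is [phi], so its one-sided limits are those of [phi]. Right
    continuity of [phi], and its continuity at [T], match the conventions of [ext_derive]. *)
Lemma cadlag_PC1 {V : normedModType R} S (G : set V) (x phi : R -> V) :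
  T \notin S -> {within `[0, T], continuous x} -> (forall t, t \in `[0, T] -> G (x t)) ->
  cadlag S setT phi -> (forall t, 0 < t < T -> t \notin S -> is_derive t 1 x (phi t)) ->
  PC1 T G x /\ forall t, t \in `[0, T] -> ext_derive T x t = phi t.
Proof.
move=> TS cx Gx [_ pc pr pl] dx; have [s sT sS] := partition_avoiding S T0.
have dE t : 0 < t < T -> t \notin S -> derive1 x t = phi t.
  by move=> t0T tS; rewrite derive1E; have [_ ->] := dx t t0T tS.
have right t : 0 <= t -> t < T -> derive1 x r @[r --> t^'+] --> phi t.
  move=> t0 tT; have [d d0 dP] := seq_isolated S t.
  apply: (@cvg_right_near _ _ phi _ t (Num.min d (T - t))) (pr t).
    by rewrite lt_min d0 subr_gt0.
  move=> r /andP[tr]; rewrite -ltrBlDl lt_min => /andP[r1 r2]; rewrite dE//; first by lra.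
  by apply: dP; [rewrite gtr0_norm// subr_gt0|rewrite gt_eqF].
have left t (l : V) : 0 < t -> t <= T -> phi r @[r --> t^'-] --> l ->
  derive1 x r @[r --> t^'-] --> l.
  move=> t0 tT phil; have [d d0 dP] := seq_isolated S t.
  apply: (@cvg_left_near _ _ phi _ t (Num.min d t)) phil.
    by rewrite lt_min d0.
  move=> r /andP[r1 tr]; have := r1; rewrite ltrBlDl -ltrBlDr lt_min => /andP[r2 r3].
  rewrite dE//; first by lra.
  by apply: dP; [rewrite ltr0_norm ?subr_lt0//; lra|rewrite lt_eqF].
have xs : PC1_along T s x.
  split=> // i si; have [i0 ii iT] := tau_bounds sT si.
  have inT t : tau s i < t < tau s i.+1 -> 0 < t < T.
    by move=> /andP[h1 h2]; rewrite (le_lt_trans i0 h1) (lt_le_trans h2 iT).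
  split.
  - move=> t; rewrite in_itv/= => ti.
    by have [] := dx t (inT _ ti) (sS _ _ si ti).
  - move=> t; rewrite in_itv/= => ti; have /andP[t1 t2] := ti.
    apply: (@continuous_near _ _ phi _ t (Num.min (t - tau s i) (tau s i.+1 - t))).
    + by rewrite lt_min !subr_gt0 t1.
    + move=> r; rewrite lt_min !ltr_norml => r12.
      have ri : tau s i < r < tau s i.+1 by lra.
      by rewrite dE//; [exact: inT|exact: sS ri].
    + by apply: pc; exact: sS ti.
  - by apply/cvg_ex; exists (phi (tau s i)); apply: right => //; exact: lt_le_trans iT.
  - have [l _ pl'] := pl (tau s i.+1).
    by apply/cvg_ex; exists l; apply: left => //; exact: le_lt_trans ii.
split; first by split=> //; exists s.
move=> t t0T; rewrite (ext_deriveE xs t0T) (ext_derive_alongE xs t0T).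
move: t0T; rewrite in_itv/= => /andP[t0 tT].
case: ifPn => [tT'|]; first by apply/cvg_lim => //; exact: right.
rewrite -leNgt => Tt; have -> : t = T by apply/eqP; rewrite eq_le tT.
by apply/cvg_lim => //; apply: left => //; apply: continuous_left; exact: pc.
Qed.

Lemma ext_derive_is_derive {V : normedModType R} s (x phi : R -> V) :
  PC1_along T s x -> (forall t, t \in `[0, T] -> ext_derive T x t = phi t) ->
  forall t, 0 < t < T -> t \notin s -> is_derive t 1 x (phi t).
Proof.
move=> xs xphi t /andP[t0 tT] ts; have t0T : t \in `[0, T] by rewrite in_itv/= !ltW.
have tS : t \notin 0 :: s by rewrite inE negb_or ts gt_eqF.
have := xphi t t0T; rewrite (ext_deriveE xs t0T) /ext_derive_along tS derive1E => xd.
have [sT _ xP] := xs; have [|i si it] := itv_partition_mem sT _ tS; first by rewrite !ltW.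
by have [xder _ _ _] := xP i si; split=> //; apply: xder; rewrite in_itv.
Qed.

End Conversions.

(** * Compactness and regularity along the reference trajectory *)

Section Compactness.
Context {R : realType}.

Lemma at_right0_epsP (P : R -> Prop) : (\forall e \near (0 : R)^'+, P e) <->
  exists2 d : R, 0 < d & forall e, 0 < e < d -> P e.
Proof.
split=> [[d /= d0 dP]|[d d0 dP]].
  exists d => // e /andP[e0 ed]; apply: dP => //=.
  by rewrite sub0r normrN gtr0_norm.
exists d => // e /=; rewrite sub0r normrN => ed e0.
by apply: dP; rewrite e0 -(gtr0_norm e0).
Qed.

Definition tends0 (u : nat -> R) := forall e : R, 0 < e ->
  exists N, forall n, (N <= n)%N -> `|u n| <= e.

Lemma tends0_inv : tends0 (fun n => n.+1%:R^-1).
Proof.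
move=> e e0; exists (Num.truncn e^-1) => n Nn; rewrite ger0_norm ?invr_ge0//.
rewrite -[leRHS]invrK lef_pV2 ?posrE ?invr_gt0// ltW// (lt_le_trans (truncnS_gt _))//.
by rewrite ler_nat.
Qed.

(** The filter [F] is that of the covering form of compactness; the thickness [e] comes from a
    second parameter tending to 0. *)
Lemma compact_neighborhood {V : normedModType R} (K : set V) (I : Type) (F : set_system I)
    (P : I -> V -> Prop) : Filter F -> compact K ->
  (forall x, K x -> \forall x' \near x & i \near F, P i x') ->
  exists2 e : R, 0 < e & \forall i \near F,
    forall x y, K x -> `|y - x| < e -> P i y.
Proof.
move=> FF cK nearP.
have := proj1 (compact_near_coveringP K) cK (I * R)%type (filter_prod F (0^'+))
  (fun p x => forall y, `|y - x| < p.2 -> P p.1 y) _.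
case=> [x Kx|[A B] /= [FA /at_right0_epsP[d d0 dB]] AB].
  have [[A B] /= [/nbhs_epsP[d d0 dA] FB] AB] := nearP x Kx.
  exists (ball x (d / 2), (B `*` [set e | e < d / 2])).
    split; first by apply: nbhsx_ballx; rewrite divr_gt0.
    exists (B, [set e | e < d / 2]) => //; split=> //.
    apply/at_right0_epsP; exists (d / 2); first by rewrite divr_gt0.
    by move=> e /andP[].
  move=> [x' [i e]] [/=]; rewrite -ball_normE/= => xx' [/= Bi ed] y yx'.
  apply: (AB (y, i)); split=> //=; apply: dA.
  rewrite (le_lt_trans (ler_distD x' _ _))// [d]splitr ltrD//.
    exact: lt_trans ed.
  by rewrite distrC.
exists (d / 2); first by rewrite divr_gt0.
apply: filterS FA => i Ai x y Kx yx; apply: (AB (i, d / 2)) yx => //; split=> //=.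
by apply: dB; rewrite divr_gt0// ltr_pdivrMr// ltr_pMr// ltr1n.
Qed.

(** A neighbourhood of [K] contains all but finitely many terms of the sequence. This makes compact
    sets out of points off the trajectory in a space without local compactness. *)
Lemma compact_setU_seq {V : normedModType R} (K : set V) (y k : nat -> V) :
  compact K -> (forall n, K (k n)) -> tends0 (fun n => `|y n - k n|) ->
  compact (K `|` range y).
Proof.
move=> cK Kk yk; apply: (proj2 (compact_near_coveringP _)) => I F P FF nearP.
have [e e0 FK] := @compact_neighborhood _ K I F P FF cK (fun x Kx => nearP x (or_introl Kx)).
have [N NP] := yk (e / 2) (divr_gt0 e0 (ltr0n R 2)).
have Fy m : \forall i \near F, forall n, (n < m)%N -> P i (y n).
  elim: m => [|m IH]; first by apply: nearW.
  have [|[A B] /= [/nbhs_epsP[d d0 dA] FB] AB] := nearP (y m); first by right; exists m.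
  apply: filterS (filterI IH FB) => i [Pi Bi] n; rewrite ltnS leq_eqVlt => /predU1P[->|];
    last exact: Pi.
  by apply: (AB (y m, i)); split=> //; apply: dA; rewrite subrr normr0.
apply: filterS (filterI FK (Fy N)) => i [Pi Pyi] x [Kx|[n _ <-]].
  by apply: (Pi x) => //; rewrite subrr normr0.
have [nN|Nn] := ltnP n N; first exact: Pyi.
apply: (Pi (k n)) => //; rewrite -[`|_|]normr_id (le_lt_trans (NP n Nn))//.
by rewrite ltr_pdivrMr// ltr_pMr// ltr1n.
Qed.

(** Adding the left limits to the values gives a compact set: just after [t] both cluster at [u t],
    just before [t] at the left limit. *)
Lemma cadlag_range_compact {Y : normedModType R} S (U : set Y) (u : R -> Y) (a b : R) :
  cadlag S U u -> exists M : set Y, [/\ compact M, M `<=` U & forall t, a <= t <= b -> M (u t)].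
Proof.
move=> [uU _ ur ul].
have ylex t : exists y : Y, U y /\ u s @[s --> t^'-] --> y.
  by have [y Uy uy] := ul t; exists y.
have [yl ylP] := choice ylex.
pose M := [set u t | t in `[a, b]] `|` [set yl t | t in `[a, b]].
exists M; split; last by move=> t tab; left; exists t => //=; rewrite in_itv.
  apply: (proj2 (compact_near_coveringP _)) => I F P FF nearP.
  have : \forall i \near F, `[a, b]%classic `<=` (fun t => P i (u t) /\ P i (yl t)).
    apply: (proj1 (compact_near_coveringP _) (@segment_compact R a b)) => t tab.
    have [|[A1 B1] /= [/nbhs_epsP[d1 d10 dA1] FB1] AB1] := nearP (u t); first by left; exists t.
    have [|[A2 B2] /= [/nbhs_epsP[d2 d20 dA2] FB2] AB2] := nearP (yl t); first by right; exists t.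
    have [e1 e10 P1] := proj1 (cvg_right_epsP _ _ _) (ur t) (d1 / 2) (divr_gt0 d10 (ltr0n R 2)).
    have [e2 e20 P2] := proj1 (cvg_left_epsP _ _ _) (ylP t).2 (d2 / 2) (divr_gt0 d20 (ltr0n R 2)).
    have d12 : d1 / 2 < d1 by rewrite ltr_pdivrMr// ltr_pMr// ltr1n.
    have d22 : d2 / 2 < d2 by rewrite ltr_pdivrMr// ltr_pMr// ltr1n.
    exists (ball t (Num.min e1 e2), B1 `&` B2).
      by split; [apply: nbhsx_ballx; rewrite lt_min e10|exact: filterI].
    move=> [t' i] [/=]; rewrite -ball_normE/= lt_min !ltr_norml => t't [Bi1 Bi2].
    (* A bound valid just before [t'] passes to the left limit at [t']. *)
    have limle l z d e0 : 0 < e0 -> (forall s, t' - e0 < s < t' -> `|u s - z| <= d) ->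
        u s @[s --> t'^'-] --> l -> `|l - z| <= d.
      move=> e00 uz /cvg_left_epsP ul'; apply/ler_addgt0Pr => e e_gt0.
      have [d' d'0 dP'] := ul' e e_gt0; pose s := t' - Num.min e0 d' / 2.
      have m0 : 0 < Num.min e0 d' by rewrite lt_min e00.
      have me : Num.min e0 d' <= e0 by rewrite ge_min lexx.
      have md : Num.min e0 d' <= d' by rewrite ge_min lexx orbT.
      have := dP' s; have := uz s; rewrite /s => h1 h2.
      have {}h1 := h1 ltac:(lra); have {}h2 := h2 ltac:(lra).
      have := ler_distD (u s) l z; rewrite [`|l - u s|]distrC; move: h1 h2; rewrite -/s; lra.
    have [tt'|tt'|->] := ltgtP t' t.
    - have near s : t - e2 < s < t -> `|u s - yl t| <= d2 / 2 by move=> ?; apply: P2.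
      split; apply: (AB2 (_, i)); split=> //=; apply: dA2; apply: le_lt_trans d22.
        by apply: near; lra.
      apply: (limle _ _ _ (t' - (t - e2))) (ylP t').2; first lra.
      by move=> s st; apply: near; lra.
    - have near s : t < s < t + e1 -> `|u s - u t| <= d1 / 2 by move=> ?; apply: P1.
      split; apply: (AB1 (_, i)); split=> //=; apply: dA1; apply: le_lt_trans d12.
        by apply: near; lra.
      apply: (limle _ _ _ (t' - t)) (ylP t').2; first lra.
      by move=> s st; apply: near; lra.
    - by split; [apply: (AB1 (_, i))|apply: (AB2 (_, i))]; split=> //=;
        [apply: dA1|apply: dA2]; rewrite subrr normr0.
  by apply: filterS => i Pi _ [[t tab <-]|[t tab <-]]; have [] := Pi t tab.
by move=> _ [[t _ <-]|[t _ <-]]; [exact: uU|exact: (ylP t).1].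
Qed.

Lemma open_tube {V : normedModType R} (X : R -> V) (Om : set V) (a b : R) :
  continuous X -> open Om -> (forall t, a <= t <= b -> Om (X t)) ->
  exists2 r : R, 0 < r & forall t z, a <= t <= b -> `|z - X t| < r -> Om z.
Proof.
move=> cX oO OX; have cK : compact [set X t | t in `[a, b]].
  by apply: continuous_compact; [exact: continuous_subspaceT|exact: segment_compact].
have [x [t /=]|e e0 eP] := @compact_neighborhood _ _ nat \oo (fun _ => Om) _ cK.
  rewrite in_itv/= => tab <-.
  exists (Om, setT) => /=; last by move=> [x' i] [].
  split; last exact: filterT; by apply: open_nbhs_nbhs; split=> //; exact: OX.
exists e => // t z tab zX; have [i iP] := filter_ex eP.
by apply: (iP (X t)) => //; exists t => //=; rewrite in_itv.
Qed.

End Compactness.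

(** * Radial retraction onto a ball *)

Section RadialRetraction.
Context {R : realType} {V : normedModType R}.
Variables (r : R).
Hypothesis r0 : 0 < r.

Let k (z : V) := r / Num.max `|z| r.

Definition retract (z : V) : V := k z *: z.

Let m0 (z : V) : 0 < Num.max `|z| r. Proof. by rewrite lt_max r0 orbT. Qed.

Lemma retract_norm z : `|retract z| <= r.
Proof.
rewrite /retract normrZ ger0_norm; last by rewrite divr_ge0// ltW.
by rewrite /k mulrAC ler_pdivrMr// ler_pM2l// le_max lexx.
Qed.

Lemma retract_id z : `|z| <= r -> retract z = z.
Proof. by move=> zr; rewrite /retract /k (max_idPr zr) mulfV ?scale1r// gt_eqF. Qed.

(** One unit of the constant comes from moving the point, the other from the change of the factor
    [k]; the norm is arbitrary. *)
Lemma retract_lipschitz z w : `|retract z - retract w| <= 2 * `|z - w|.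
Proof.
have -> : retract z - retract w = k z *: (z - w) + (k z - k w) *: w.
  by rewrite /retract scalerBr scalerBl addrA subrK.
rewrite (le_trans (ler_normD _ _))// mulr2n mulrDl mul1r (normrZ (k z)) (normrZ (k z - k w)) lerD//.
  have k0 : 0 <= k z by rewrite /k divr_ge0// ltW.
  have k1 : k z <= 1 by rewrite /k ler_pdivrMr// mul1r le_max lexx orbT.
  by rewrite (ger0_norm k0) ler_piMl.
have -> : k z - k w = r * (Num.max `|w| r - Num.max `|z| r) / Num.max `|z| r / Num.max `|w| r.
  by rewrite /k; field; rewrite !gt_eqF.
rewrite !normrM !normfV !(ger0_norm (ltW (m0 _))) (gtr0_norm r0).
have h1 := max_nonexpansive `|w| `|z| r.
have h2 := ler_dist_dist w z; rewrite [`|w - z|]distrC in h2.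
have h3 : `|Num.max `|w| r - Num.max `|z| r| <= `|z - w| := le_trans h1 h2.
have h4 : `|w| <= Num.max `|w| r by rewrite le_max lexx.
have h5 : r <= Num.max `|z| r by rewrite le_max lexx orbT.
have h6 : `|w| * r <= Num.max `|w| r * Num.max `|z| r by apply: ler_pM => //; exact: ltW.
have h7 : 0 <= `|w| * r by rewrite mulr_ge0// ltW.
have h8 := normr_ge0 (Num.max `|w| r - Num.max `|z| r).
have h9 := ler_pM h7 h8 h6 h3.
have mw := m0 w; have mz := m0 z.
rewrite (_ : _ * `|w| = `|w| * r * `|Num.max `|w| r - Num.max `|z| r|
    / (Num.max `|w| r * Num.max `|z| r)); last by field; rewrite !gt_eqF.
by rewrite ler_pdivrMr ?mulr_gt0// [leRHS]mulrC.
Qed.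

End RadialRetraction.

Section Hadamard.
Context {R : realType} {V W : normedModType R}.

(** The directions [h n] need only approach [K]: together with [K] they form a compact set, to which
    Hadamard differentiability applies. *)
Lemma Hdiff_sequence (f : V -> W) (x : V) (L : blin V W) (K : set V)
    (s : nat -> R) (h k : nat -> V) :
  is_Hdiff f x L -> compact K -> (forall n, K (k n)) ->
  tends0 (fun n => `|h n - k n|) -> (forall n, 0 < s n) -> tends0 s ->
  forall e : R, 0 < e -> exists N, forall n, (N <= n)%N ->
    `|f (x + s n *: h n) - f x - s n *: L (h n)| <= e * s n.
Proof.
move=> fL cK Kk hk s0 sc e e0.
have cK' := compact_setU_seq cK Kk hk.
have K'0 : (K `|` range h) !=set0 by exists (k 0%N); left.
have [d /= d0 dP] := fL _ K'0 cK' _ (@nbhs_open_ereal_lt R 0 (fun=> e) e0).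
have [N NP] := sc (d / 2) (divr_gt0 d0 (ltr0n R 2)).
exists N => n Nn; have := dP (s n); rewrite /= sub0r normrN => /(_ _ (s0 n)).
have sd : `|s n| < d by rewrite (le_lt_trans (NP n Nn))// ltr_pdivrMr// ltr_pMr// ltr1n.
move=> /(_ sd) sup_lt.
have : ((`|(s n)^-1 *: (f (x + s n *: h n) - f x) - L (h n)|)%:E < e%:E)%E.
  apply: le_lt_trans sup_lt; apply: ereal_sup_ubound.
  by exists (h n) => //; right; exists n.
rewrite lte_fin => /ltW lee.
have tz (z : W) : `|s n *: z| = s n * `|z| by rewrite normrZ gtr0_norm.
have := tz ((s n)^-1 *: (f (x + s n *: h n) - f x) - L (h n)).
rewrite scalerBr scalerA mulfV ?gt_eqF// scale1r => ->.
by rewrite mulrC ler_pM2r.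
Qed.

End Hadamard.

Section WithinContinuity.
Context {R : realType}.

Lemma within_comp {V1 V2 V3 : normedModType R} (A : set V1) (B : set V2)
    (h : V1 -> V2) (g : V2 -> V3) : (forall x, A x -> B (h x)) ->
  {within A, continuous h} -> {within B, continuous g} ->
  {within A, continuous (fun x => g (h x))}.
Proof.
move=> AB /within_epsP ch /within_epsP cg; apply/within_epsP => x Ax e e0.
have [d d0 dP] := cg (h x) (AB x Ax) e e0; have [d' d'0 dP'] := ch x Ax d d0.
by exists d' => // y Ay yx; apply: dP; [exact: AB|exact: dP'].
Qed.

Lemma within_pair {V1 V2 V3 : normedModType R} (A : set V1)
    (f : V1 -> V2) (g : V1 -> V3) :
  {within A, continuous f} -> {within A, continuous g} ->
  {within A, continuous (fun x => (f x, g x))}.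
Proof.
move=> /within_epsP cf /within_epsP cg; apply/within_epsP => x Ax e e0.
have [d d0 dP] := cf x Ax e e0; have [d' d'0 dP'] := cg x Ax e e0.
exists (Num.min d d'); first by rewrite lt_min d0.
move=> y Ay; rewrite lt_min => /andP[/dP yd /dP' yd'].
by rewrite prod_normE/= gt_max yd// yd'.
Qed.

Lemma within_continuous {V W : normedModType R} (A : set V) (f : V -> W) :
  continuous f -> {within A, continuous f}.
Proof. exact: continuous_subspaceT. Qed.

Lemma fst_continuous {V W : normedModType R} : continuous (@fst V W).
Proof.
move=> z; apply/continuous_epsP => e e0; exists e => // y.
by rewrite prod_normE/= gt_max => /andP[].
Qed.

Lemma snd_continuous {V W : normedModType R} : continuous (@snd V W).
Proof.
move=> z; apply/continuous_epsP => e e0; exists e => // y.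
by rewrite prod_normE/= gt_max => /andP[].
Qed.

Lemma within_sub {V W : normedModType R} (A : set V) (f g : V -> W) :
  {within A, continuous f} -> {within A, continuous g} ->
  {within A, continuous (fun x => f x - g x)}.
Proof. by move=> cf cg x; apply: cvgB; [exact: cf|exact: cg]. Qed.

Lemma within_add {V W : normedModType R} (A : set V) (f g : V -> W) :
  {within A, continuous f} -> {within A, continuous g} ->
  {within A, continuous (fun x => f x + g x)}.
Proof. by move=> cf cg x; apply: cvgD; [exact: cf|exact: cg]. Qed.

Lemma within_norm {V W : normedModType R} (A : set V) (f : V -> W) :
  {within A, continuous f} -> {within A, continuous (fun x => `|f x|)}.
Proof. by move=> cf x; apply: cvg_norm; exact: cf. Qed.

(** Covers both the evaluation of an operator at a vector and the composition of two operators. *)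
Lemma within_bilinear {V V1 V2 W : normedModType R} (A : set V) (b : V1 -> V2 -> W)
    (p : V -> V1) (y : V -> V2) :
  (forall p y, `|b p y| <= `|p| * `|y|) ->
  (forall p p' y, b (p - p') y = b p y - b p' y) ->
  (forall p y y', b p (y - y') = b p y - b p y') ->
  {within A, continuous p} -> {within A, continuous y} ->
  {within A, continuous (fun x => b (p x) (y x))}.
Proof.
move=> bn bl br /within_epsP cp /within_epsP cy; apply/within_epsP => x Ax e e0.
pose a := `|p x| + 1; pose c := `|y x| + 1.
have a0 : 0 < a by rewrite ltr_wpDl.
have c0 : 0 < c by rewrite ltr_wpDl.
have [d d0 dP] := cp x Ax (e / 2 / c) ltac:(by rewrite !divr_gt0).
have [d' d'0 dP'] := cy x Ax (Num.min 1 (e / 2 / a)) ltac:(by rewrite lt_min ltr01 !divr_gt0).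
exists (Num.min d d'); first by rewrite lt_min d0.
move=> z Az; rewrite lt_min => /andP[/(dP _ Az) h1 /(dP' _ Az)]; rewrite lt_min => /andP[h2 h3].
have -> : b (p z) (y z) - b (p x) (y x) = b (p z - p x) (y z) + b (p x) (y z - y x).
  by rewrite bl br addrA subrK.
have yb : `|y z| <= c.
  by rewrite -[y z](subrK (y x)) (le_trans (ler_normD _ _))// addrC lerD2l ltW.
have k1 : `|b (p z - p x) (y z)| <= e / 2 / c * `|y z|.
  by rewrite (le_trans (bn _ _))// ler_wpM2r// ltW.
have k2 : `|b (p x) (y z - y x)| < a * (e / 2 / a).
  rewrite (le_lt_trans (bn _ _))// (@le_lt_trans _ _ (a * `|y z - y x|))//.
    by rewrite ler_wpM2r// lerDl.
  by rewrite ltr_pM2l.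
have k3 : e / 2 / c * `|y z| <= e / 2.
  by rewrite mulrAC ler_pdivrMr// ler_pM2l// divr_gt0.
rewrite (le_lt_trans (ler_normD _ _))// [e]splitr ler_ltD//.
  exact: le_trans k1 k3.
by move: k2; rewrite mulrC divfK// gt_eqF.
Qed.

Lemma within_blin {V V' W : normedModType R} (A : set V) (p : V -> blin V' W) (y : V -> V') :
  {within A, continuous p} -> {within A, continuous y} ->
  {within A, continuous (fun x => p x (y x))}.
Proof.
apply: (within_bilinear (b := fun (p : blin V' W) y => p y)) => // [q z|q z z'].
  exact: blin_bound.
by rewrite linearB.
Qed.

Lemma within_blin_comp {V V1 V2 W : normedModType R} (A : set V)
    (p : V -> blin V2 W) (q : V -> blin V1 V2) :
  {within A, continuous p} -> {within A, continuous q} ->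
  {within A, continuous (fun x => blin_comp (p x) (q x))}.
Proof.
apply: (within_bilinear (b := fun p q => blin_comp p q)) => [p1 q1|p1 p2 q1|p1 q1 q2].
- exact: blin_comp_norm.
- exact: blin_ext.
- by apply: blin_ext => h; rewrite blin_compE !blin_addE !blin_oppE linearB.
Qed.

Lemma compact_bound {V W : normedModType R} (K : set V) (f : V -> W) : compact K ->
  {within K, continuous f} -> exists2 B : R, 0 <= B & forall x, K x -> `|f x| <= B.
Proof.
move=> cK cf; have /compact_bounded[M [_ MP]] := continuous_compact cf cK.
exists (`|M| + 1) => // x Kx; apply: (MP (`|M| + 1)); last by exists x.
by rewrite (le_lt_trans (ler_norm M))// ltrDl.
Qed.

Lemma within_subset {V W : normedModType R} (A B : set V) (f : V -> W) : A `<=` B ->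
  {within B, continuous f} -> {within A, continuous f}.
Proof.
move=> AB /within_epsP cf; apply/within_epsP => x Ax e e0.
have [d d0 dP] := cf x (AB _ Ax) e e0; exists d => // y /AB; exact: dP.
Qed.

End WithinContinuity.

Section Regularity.
Context {R : realType} {E Y F : normedModType R}.

(* Time is extended to the whole line by freezing it outside [0, T], so that no
   boundary point needs a separate treatment. *)
Record reg (Om : set E) (U : set Y) (X : R -> E) (phi : R -> E -> Y -> F)
    (D : R -> Y -> blin E F) : Prop := Reg {
  reg_cont : {within setT `*` Om `*` U, continuous
    (fun z : R * E * Y => phi z.1.1 z.1.2 z.2)} ;
  reg_diff : forall t zeta, U zeta -> is_Fdiff (phi t ^~ zeta) (X t) (D t zeta) ;
  reg_Dcont : {within setT `*` U, continuous (fun z : R * Y => D z.1 z.2)} ;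
  reg_lip : forall M : set Y, M !=set0 -> compact M -> M `<=` U ->
    exists r L : R, [/\ 0 < r, 0 <= L & forall t zeta xi xi', M zeta ->
      `|xi - X t| <= r -> `|xi' - X t| <= r ->
      Om xi /\ `|phi t xi zeta - phi t xi' zeta| <= L * `|xi - xi'|] }.

Variables (T : R) (Om : set E) (U : set Y) (x0 : R -> E).
Hypotheses (T0 : 0 < T) (Om_open : open Om).
Hypotheses (x0c : {within `[0, T], continuous x0}).
Hypothesis (x0Om : forall t, t \in `[0, T] -> Om (x0 t)).

Let X t := x0 (clamp 0 T t).

Let cX : continuous X. Proof. exact: continuous_clamp (ltW T0) x0c. Qed.

Let XE t : 0 <= t <= T -> X t = x0 t. Proof. by move=> tT; rewrite /X clampE. Qed.

Let XOm t : Om (X t).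
Proof. by apply: x0Om; rewrite in_itv/=; apply: clamp_itv; exact: ltW. Qed.

(** Otherwise there are points at distance at most [n.+1%:R^-1] from the trajectory where the
    differential exceeds [n]. With the trajectory they form a compact subset of [Om], on which the
    differential is bounded by hypothesis. *)
Lemma DG_tube_bound (phi : R -> E -> Y -> F) (M : set Y) :
  regular_along T Om U x0 phi -> M !=set0 -> compact M -> M `<=` U ->
  exists r L : R, [/\ 0 < r, 0 <= L & forall t zeta xi, 0 <= t <= T -> M zeta ->
    `|xi - x0 t| <= r -> Om xi /\ `|DG (phi t ^~ zeta) xi| <= L].
Proof.
move=> [_ _ _ _ phib] M0 cM MU.
have [r0 r00 r0P] := @open_tube _ _ X Om 0 T cX Om_open (fun t _ => XOm t).
apply: contrapT => nob.
have bad (n : nat) : exists p : R * Y * E, [/\ 0 <= p.1.1 <= T, M p.1.2,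
    `|p.2 - x0 p.1.1| <= Num.min (r0 / 2) n.+1%:R^-1 & n%:R < `|DG (phi p.1.1 ^~ p.1.2) p.2|].
  apply: contrapT => nobad; apply: nob; exists (Num.min (r0 / 2) n.+1%:R^-1), n%:R.
  split; [by rewrite lt_min divr_gt0//= invr_gt0|by []|].
  move=> t zeta xi tT Mz xit; split.
    apply: (r0P t) => //; rewrite XE// (le_lt_trans xit)// gt_min ltr_pdivrMr//.
    by rewrite ltr_pMr// ltr1n.
  by rewrite leNgt; apply/negP => big; apply: nobad; exists (t, zeta, xi).
have [p pP] := choice bad.
pose K := [set X t | t in `[0, T]].
have cK : compact K.
  by apply: continuous_compact; [exact: continuous_subspaceT|exact: segment_compact].
have cK' : compact (K `|` range (fun n => (p n).2)).
  apply: (@compact_setU_seq _ _ K _ (fun n => X (p n).1.1)) => // [n|e e0].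
    have [tT _ _ _] := pP n; exists (p n).1.1 => //=; by rewrite in_itv.
  have [N NP] := @tends0_inv R e e0; exists N => n Nn; have [tT _ h _] := pP n.
  rewrite normr_id XE//; have := NP n Nn; rewrite ger0_norm ?invr_ge0//.
  by apply: le_trans; rewrite (le_trans h)// ge_min lexx orbT.
have KOm : K `|` range (fun n => (p n).2) `<=` Om.
  move=> _ [[t _ <-]|[n _ <-]]; first exact: XOm.
  have [tT _ h _] := pP n; apply: (r0P (p n).1.1) => //; rewrite XE//.
  rewrite (le_lt_trans h)// gt_min ltr_pdivrMr//.
  by rewrite ltr_pMr// ltr1n.
have K'0 : (K `|` range (fun n => (p n).2)) !=set0 by exists (p 0%N).2; right; exists 0%N.
have [B BP] := phib _ _ K'0 M0 cK' cM KOm MU.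
have [tT Mz _ big] := pP (Num.truncn `|B|).+1.
have := BP `|DG (phi (p (Num.truncn `|B|).+1).1.1 ^~ (p (Num.truncn `|B|).+1).1.2)
  (p (Num.truncn `|B|).+1).2|.
have H : forall b, b <= B -> (Num.truncn `|B|).+1%:R < b -> False.
  move=> b bB Bb; have := truncnS_gt `|B|; rewrite ltNge; apply/negP; rewrite negbK.
  by rewrite (le_trans _ (ler_norm B))// (le_trans (ltW Bb)).
move=> h; apply: (H _ (h _)) big.
exists ((p (Num.truncn `|B|).+1).1.1, (p (Num.truncn `|B|).+1).2, (p (Num.truncn `|B|
  ).+1).1.2) => //.
split=> //; split=> /=; first by rewrite in_itv.
by right; exists (Num.truncn `|B|).+1.
Qed.

Lemma regular_along_reg (phi : R -> E -> Y -> F) : regular_along T Om U x0 phi ->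
  reg Om U X (fun t => phi (clamp 0 T t))
    (fun t zeta => DF (phi (clamp 0 T t) ^~ zeta) (X t)).
Proof.
move=> phir; have [phic phiG phiF phiD _] := phir.
have cl t : `[0, T]%classic (clamp 0 T t).
  by rewrite /= in_itv/=; exact: clamp_itv (ltW T0).
split.
- apply: (@within_comp _ _ _ _ _ (`[0, T] `*` Om `*` U)
    (fun z : R * E * Y => (clamp 0 T z.1.1, z.1.2, z.2))
    (fun z : R * E * Y => phi z.1.1 z.1.2 z.2)) phic.
    by move=> [[t xi] zeta] [[_ /= Oxi] Uz]; split=> //; split=> //=; exact: cl.
  apply: within_pair; last by apply: within_continuous; exact: snd_continuous.
  have c1 : continuous (fun z : R * E * Y => z.1) := @fst_continuous _ _ _.
  apply: within_pair; apply: within_continuous => z.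
    apply: (@continuous_comp _ _ _ (fun z : R * E * Y => z.1.1) (clamp 0 T)).
      apply: (@continuous_comp _ _ _ (fun z : R * E * Y => z.1) fst); [exact: c1|
        exact: fst_continuous].
    exact: clamp_continuous.
  apply: (@continuous_comp _ _ _ (fun z : R * E * Y => z.1) snd); [exact: c1|exact: snd_continuous].
- by move=> t zeta Uz; apply: DFP; apply: phiF => //; exact: cl.
- apply: (@within_comp _ _ _ _ _ (`[0, T] `*` U) (fun z : R * Y => (clamp 0 T z.1, z.2))
    (fun z : R * Y => DF (phi z.1 ^~ z.2) (x0 z.1))) phiD.
    by move=> [t zeta] [/= _ Uz]; split=> //=; exact: cl.
  apply: within_pair; apply: within_continuous => z; last exact: snd_continuous.
  by apply: (@continuous_comp _ _ _ fst (clamp 0 T)); [exact: fst_continuous|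
    exact: clamp_continuous].
- move=> M M0 cM MU; have [r [L [r0 L0 rL]]] := DG_tube_bound phir M0 cM MU.
  exists r, L; split=> // t zeta xi xi' Mz xit xit'.
  have tT : 0 <= clamp 0 T t <= T by exact: clamp_itv (ltW T0).
  have [Oxi _] := rL _ _ xi tT Mz xit; split; first exact: Oxi.
  rewrite distrC [`|xi - xi'|]distrC;
    apply: (@Gdiff_lipschitz _ _ _ (phi (clamp 0 T t) ^~ zeta) xi xi' L) => s /andP[s0 s1].
  (* Balls are convex, so the whole segment stays in the tube and the mean value inequality
     applies. *)
  have sr : `|xi + s *: (xi' - xi) - x0 (clamp 0 T t)| <= r.
    have -> : xi + s *: (xi' - xi) - x0 (clamp 0 T t) =
        (1 - s) *: (xi - x0 (clamp 0 T t)) + s *: (xi' - x0 (clamp 0 T t)).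
      set c := x0 _; have -> : xi' - xi = (xi' - c) - (xi - c).
        by rewrite opprB addrA subrK.
      by rewrite scalerBr scalerBl scale1r addrAC -[RHS]addrA [- _ + _]addrC.
    rewrite (le_trans (ler_normD _ _))// !normrZ !ger0_norm// ?subr_ge0//.
    have := xit; have := xit'; rewrite -/(X t) => h1 h2.
    move: h1 h2; move: (`|_|) (`|_|) => u v; nra.
  have [Ox DGL] := rL _ _ _ tT Mz sr.
  by exists (DG (phi (clamp 0 T t) ^~ zeta) (xi + s *: (xi' - xi))) => //; apply: DGP;
    apply: phiG => //; exact: MU.
Qed.

End Regularity.

(** * Needle variations *)

Section Ramps.
Context {R : realType}.
Implicit Types (b e t : R).

(** The time spent in [[b, e]] before [t]: a primitive of the indicator of the interval. *)
Definition ramp b e t := clamp b e t - b.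

Lemma ramp_continuous b e : continuous (ramp b e).
Proof. by move=> t; apply: cvgB; [exact: clamp_continuous|exact: cvg_cst]. Qed.

Lemma ramp_ge0 b e t : b <= e -> 0 <= ramp b e t.
Proof. by move=> be; rewrite subr_ge0; have /andP[] := clamp_itv t be. Qed.

Lemma ramp_le b e t : b <= e -> ramp b e t <= e - b.
Proof. by move=> be; rewrite lerD2r; have /andP[] := clamp_itv t be. Qed.

Lemma ramp_before b e t : b <= e -> t <= b -> ramp b e t = 0.
Proof. by move=> be tb; rewrite /ramp clamp_ge// subrr. Qed.

Lemma ramp_after b e t : b <= e -> e <= t -> ramp b e t = e - b.
Proof. by move=> be et; rewrite /ramp clamp_le. Qed.

Lemma is_derive_const {V : normedModType R} (c : V) (t : R) : is_derive t 1 (fun=> c) 0.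
Proof.
apply/is_derive_epsP => e e0; exists 1 => // h _.
by rewrite subrr scaler0 subrr normr0 mulr_ge0// ltW.
Qed.

Lemma is_derive_ramp b e t : b <= e -> t != b -> t != e ->
  is_derive t 1 (ramp b e) ((b < t < e)%R%:R).
Proof.
move=> be tb te; have [tb'|bt|/eqP] := ltgtP t b; last by rewrite (negbTE tb).
  apply: (is_derive_near _ (is_derive_const 0 t)); exists (b - t); first by rewrite subr_gt0.
  by move=> s; rewrite ltr_norml => ?; rewrite ramp_before//; lra.
have [te'|et|/eqP] := ltgtP t e; last by rewrite (negbTE te).
  apply: (is_derive_near _ (is_derive_affine 1 b t)); exists (Num.min (t - b) (e - t)).
    by rewrite lt_min !subr_gt0 bt.
  move=> s; rewrite lt_min !ltr_norml => ?; rewrite mul1r /ramp clampE//; lra.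
apply: (is_derive_near _ (is_derive_const (e - b) t)); exists (t - e); first by rewrite subr_gt0.
by move=> s; rewrite ltr_norml => ?; rewrite ramp_after//; lra.
Qed.

Lemma is_derive_mulr (f g : R -> R) (t : R) (l m : R) :
  is_derive t 1 f l -> is_derive t 1 g m -> is_derive t 1 (fun t => f t * g t) (l * g t + f t * m).
Proof.
move=> df dg; apply: (is_derive_eq (is_deriveM df dg)).
by rewrite /GRing.scale/= addrC [g t * l]mulrC.
Qed.

Lemma thirds (e a b c h : R) : 0 < a -> 0 < b -> 0 < c ->
  e / 3 / b * h * b + a * (e / 3 / a * h) + h * (c * (e / 3 / c)) = e * h.
Proof. by move=> a0 b0 c0; field; rewrite !gt_eqF. Qed.

Lemma is_derive_scale {V : normedModType R} (f : R -> R) (g : R -> V) (t : R) (l : R) (m : V) :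
  is_derive t 1 f l -> is_derive t 1 g m ->
  is_derive t 1 (fun t => f t *: g t) (l *: g t + f t *: m).
Proof.
move=> df0 dg; have /is_derive_epsP df := df0; have cf := is_derive_continuous df0.
have cg := is_derive_continuous dg; have /is_derive_epsP dg' := dg.
apply/is_derive_epsP => e e0.
pose a := `|f t| + 1; pose b := `|g t| + 1; pose c := `|l| + 1.
have a0 : 0 < a by rewrite ltr_wpDl.
have b0 : 0 < b by rewrite ltr_wpDl.
have c0 : 0 < c by rewrite ltr_wpDl.
have [d1 d10 P1] := df (e / 3 / b) ltac:(by rewrite !divr_gt0).
have [d2 d20 P2] := dg' (e / 3 / a) ltac:(by rewrite !divr_gt0).
have [d3 d30 P3] := proj1 (continuous_epsP g t) cg (Num.min 1 (e / 3 / c)) ltac:(by rewrite lt_min ltr01 !divr_gt0).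
exists (Num.min d1 (Num.min d2 d3)); first by rewrite !lt_min d10 d20.
move=> h; rewrite !lt_min => /and3P[/P1 h1 /P2 h2 hd3].
have := P3 (t + h); rewrite addrAC subrr add0r => /(_ hd3); rewrite lt_min => /andP[y1 y2].
have -> : f (t + h) *: g (t + h) - f t *: g t - h *: (l *: g t + f t *: m) =
   (f (t + h) - f t - h *: l) *: g (t + h) + f t *: (g (t + h) - g t - h *: m)
   + (h * l) *: (g (t + h) - g t).
  rewrite scalerDr !scalerBl !scalerBr !scalerA [h * f t]mulrC.
  exact: zmod_telescope.
rewrite (le_trans (ler_normD _ _))// (le_trans (lerD (ler_normD _ _) (lexx _)))//.
have yB : `|g (t + h)| <= b.
  by rewrite -[g (t + h)](subrK (g t)) (le_trans (ler_normD _ _))// addrC lerD2l ltW.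
have tA : `|f t| <= a by rewrite lerDl.
have pC : `|l| <= c by rewrite lerDl.
have k1 : `|(f (t + h) - f t - h *: l) *: g (t + h)| <= e / 3 / b * `|h| * b.
  by rewrite normrZ ler_pM.
have k2 : `|f t *: (g (t + h) - g t - h *: m)| <= a * (e / 3 / a * `|h|).
  by rewrite normrZ ler_pM.
have k3 : `|(h * l) *: (g (t + h) - g t)| <= `|h| * (c * (e / 3 / c)).
  by rewrite normrZ normrM -[leLHS]mulrA ler_wpM2l// ler_pM// ltW.
rewrite (le_trans (lerD (lerD k1 k2) k3))//.
by rewrite thirds.
Qed.

Lemma is_derive_sum {V : normedModType R} (I : Type) (r : seq I) (f : I -> R -> V) (l : I ->
  V) (t : R) :
  (forall i, is_derive t 1 (f i) (l i)) ->
  is_derive t 1 (fun t => \sum_(i <- r) f i t) (\sum_(i <- r) l i).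
Proof.
move=> df; elim: r => [|i r IH].
  rewrite big_nil; apply: (is_derive_near _ (is_derive_const 0 t)).
  by exists 1 => // s _; rewrite big_nil.
rewrite big_cons; apply: (is_derive_near _ (is_deriveD (df i) IH)).
by exists 1 => // s _; rewrite big_cons.
Qed.

Lemma continuous_sum {V : normedModType R} (I : Type) (r : seq I) (f : I -> R -> V) :
  (forall i, continuous (f i)) -> continuous (fun t => \sum_(i <- r) f i t).
Proof.
move=> cf; elim: r => [|i r IH].
  rewrite (_ : (fun t => \sum_(i <- [::]) f i t) = fun=> 0); first exact: cst_continuous.
  by apply/funext => t; rewrite big_nil.
rewrite (_ : (fun t => \sum_(j <- i :: r) f j t) = fun t => f i t + \sum_(j <- r) f j t).
  by move=> t; apply: cvgD; [exact: cf|exact: IH].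
by apply/funext => t; rewrite big_cons.
Qed.

(** Gronwall with majorant [G s * expR (L * s)]: its derivative is at least [L] times itself plus
    [g s], the exponential being at least 1. *)
Lemma gronwall_int {V : normedModType R} (S : seq R) (D : R -> V) (G g : R -> R) (L t : R) :
  0 <= t -> 0 <= L -> continuous D -> continuous G ->
  (forall s, 0 < s < t -> s \notin S -> exists l, [/\ is_derive s 1 D l,
     is_derive s 1 G (g s), 0 <= g s, 0 <= G s & `|l| <= L * `|D s| + g s]) ->
  D 0 = 0 -> G 0 = 0 -> `|D t| <= G t * expR (L * t).
Proof.
move=> t0 L0 cD cG dD D0 G0.
have dM s := is_derive_expR_affine 1 L 0 s.
have := @gronwall _ _ S D (fun s => G s * (1 * expR (L * (s - 0)))) L 0 t t0 L0 cD.
rewrite !subr0 !mul1r G0 mul0r D0 normr0; apply => //.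
  by move=> s; apply: cvgM; [exact: cG|exact: is_derive_continuous (dM s)].
move=> s st sS; have [l [dl dG gs0 Gs0 lD]] := dD s st sS.
exists l, (g s * (1 * expR (L * (s - 0))) + G s * (1 * (L * expR (L * (s - 0))))).
split=> //; first exact: is_derive_mulr.
have : 1 <= expR (L * (s - 0)).
  by rewrite -expR0 ler_expR mulr_ge0// subr0; have /andP[/ltW] := st.
rewrite !mul1r; move: (expR _) => e e1; move: lD gs0 Gs0; nra.
Qed.

End Ramps.

(** * Controls with stacked needles *)

Section Needles.
Context {R : realType} {Y : normedModType R} {N : nat}.
Variables (T : R) (S : seq R) (U : set Y) (u : R -> Y).
Variables (tk : 'I_N -> R) (vk : 'I_N -> Y).
Implicit Types (a : 'I_N -> R) (k : 'I_N).

(** The shift by the lengths of all earlier needles keeps needles with the same base instant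
    disjoint. *)
Definition nbeg a k := tk k + \sum_(j < N | (j < k)%N) a j.
Definition nend a k := nbeg a k + a k.
(** Half-open, so that the modified control stays right continuous. *)
Definition in_needle a k t := nbeg a k <= t < nend a k.
Definition needled a t :=
  if [pick k | in_needle a k t] is Some k then vk k else u t.
Definition breaks a := S ++ [seq nbeg a k | k : 'I_N] ++ [seq nend a k | k : 'I_N].

Definition fit a := [/\ forall k, 0 <= a k, forall k, nend a k < T &
  forall j k t, in_needle a j t -> in_needle a k t -> j = k].

Lemma nbeg_le_end a k : (forall k, 0 <= a k) -> nbeg a k <= nend a k.
Proof. by move=> a0; rewrite lerDl. Qed.

Lemma nbeg_ge a k : (forall k, 0 <= a k) -> tk k <= nbeg a k.
Proof. by move=> a0; rewrite lerDl sumr_ge0. Qed.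

Lemma nend_le a k : (forall k, 0 <= a k) -> nend a k <= tk k + \sum_j a j.
Proof.
move=> a0; rewrite /nend /nbeg -addrA lerD2l.
rewrite [leRHS](bigID (fun j : 'I_N => (j < k)%N))/= lerD2l.
by rewrite (bigD1 k)/= ?ltnn// lerDl sumr_ge0.
Qed.

Lemma needled_in a k t : fit a -> in_needle a k t -> needled a t = vk k.
Proof.
move=> [_ _ disj] kt; rewrite /needled; case: pickP => [j jt|/(_ k)]; last by rewrite kt.
by rewrite (disj j k t jt kt).
Qed.

Lemma needled_out a t : (forall k, ~~ in_needle a k t) -> needled a t = u t.
Proof. by move=> nt; rewrite /needled; case: pickP => // j; rewrite (negbTE (nt j)). Qed.

Lemma needled_local a a' s t : (forall k, in_needle a k s = in_needle a' k t) ->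
  u s = u t -> needled a s = needled a' t.
Proof. by move=> st us; rewrite /needled (eq_pick st) us. Qed.

(** A total length below every gap between distinct base instants, and below every [T - tk k],
    separates needles with different bases; equal bases are separated by the shift in [nbeg]. *)
Lemma small_fit : (forall k, 0 <= tk k < T) -> exists2 d : R, 0 < d &
  forall a, (forall k, 0 <= a k) -> \sum_k a k <= d -> fit a.
Proof.
move=> tkT.
have seqmin (s : seq R) : (forall x, x \in s -> 0 < x) ->
    exists2 d : R, 0 < d & forall x, x \in s -> d < x.
  elim: s => [|x s IH] sP; first by exists 1.
  have [|d d0 dP] := IH; first by move=> y ys; apply: sP; rewrite inE ys orbT.
  have x0 : 0 < x by apply: sP; rewrite mem_head.
  exists (Num.min d x / 2); first by rewrite divr_gt0// lt_min d0.
  have h : Num.min d x / 2 < Num.min d x.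
    by rewrite ltr_pdivrMr// ltr_pMr ?ltr1n// lt_min d0.
  move=> y; rewrite inE => /predU1P[->|/dP dy].
    by rewrite (lt_le_trans h)// ge_min lexx orbT.
  by rewrite (lt_trans (lt_le_trans h _) dy)// ge_min lexx.
pose gaps := [seq T - tk k | k : 'I_N] ++
  [seq `|tk p.1 - tk p.2| | p <- [seq p : 'I_N * 'I_N <- enum {: 'I_N * 'I_N} | tk p.1 != tk p.2]].
have [x|d d0 dP] := seqmin gaps.
  rewrite mem_cat => /orP[/mapP[k _ ->]|/mapP[[j k]]].
    by rewrite subr_gt0; have /andP[] := tkT k.
  by rewrite mem_filter => /andP[/= jk _] ->; rewrite normr_gt0 subr_eq0.
exists d => // a a0 ad; split=> //.
  move=> k; rewrite (le_lt_trans (nend_le k a0))// addrC -ltrBrDr (le_lt_trans ad)//.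
  by apply: dP; rewrite mem_cat; apply/orP; left; apply/mapP; exists k; rewrite ?mem_enum.
have sep j k t : in_needle a j t -> in_needle a k t -> tk j = tk k.
  move=> /andP[j1 j2] /andP[k1 k2]; apply/eqP; apply: contraT => jk.
  have : d < `|tk j - tk k|.
    apply: dP; rewrite mem_cat; apply/orP; right; apply/mapP; exists (j, k) => //.
    by rewrite mem_filter/= jk mem_enum.
  have := nend_le j a0; have := nend_le k a0; have := nbeg_ge j a0; have := nbeg_ge k a0.
  by rewrite ltNge ler_norml; move=> ? ? ? ? /negP; case; lra.
have ord (j k : 'I_N) (t : R) : (j < k)%N -> in_needle a j t -> in_needle a k t -> False.
  move=> jk jt kt; have tjk := sep j k t jt kt; move: jt kt => /andP[_ j2] /andP[k1 _].
  have : nend a j <= nbeg a k.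
    rewrite /nend /nbeg tjk -addrA lerD2l.
    have -> : \sum_(i < N | (i < k)%N) a i = \sum_(i < N | (i < j)%N) a i +
        \sum_(i < N | (i < k)%N && ~~ (i < j)%N) a i.
      rewrite (bigID (fun i : 'I_N => (i < j)%N))/=; congr (_ + _).
      by apply: eq_bigl => i; case: (ltnP i j); rewrite ?andbF// andbT => ij;
        rewrite (ltn_trans ij).
    by rewrite lerD2l (bigD1 j)/= ?jk ?ltnn// lerDl sumr_ge0.
  by move=> h; have := lt_le_trans j2 h; rewrite ltNge k1.
move=> j k t jt kt; have [jk|kj|/val_inj//] := ltngtP j k.
  by have := ord j k t jk jt kt.
by have := ord k j t kj kt jt.
Qed.

Lemma notin_breaks a t : t \notin breaks a ->
  [/\ t \notin S, forall k, t != nbeg a k & forall k, t != nend a k].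
Proof.
rewrite !mem_cat !negb_or => /and3P[tS tb te]; split=> // k.
  by apply: contra tb => /eqP ->; apply/mapP; exists k; rewrite ?mem_enum.
by apply: contra te => /eqP ->; apply/mapP; exists k; rewrite ?mem_enum.
Qed.

Lemma T_notin_breaks a : T \notin S -> fit a -> T \notin breaks a.
Proof.
move=> TS [a0 aT _]; rewrite !mem_cat !negb_or TS/=; apply/andP; split; apply/mapP => -[k _ Tk].
  by have := le_lt_trans (nbeg_le_end k a0) (aT k); rewrite -Tk ltxx.
by have := aT k; rewrite -Tk ltxx.
Qed.

Lemma needled_set a t (M : set Y) : M (u t) -> (forall k, M (vk k)) -> M (needled a t).
Proof. by move=> Mu Mv; rewrite /needled; case: pickP. Qed.

(** Near any [t] no needle begins or ends except possibly at [t], so on each side the control is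
    either a constant [vk k] or [u]. *)
Lemma needled_cadlag a : cadlag S U u -> (forall k, U (vk k)) -> fit a ->
  cadlag (breaks a) U (needled a).
Proof.
move=> [uU uc ur ul] vU af; have [a0 _ _] := af.
have iso t : exists2 d : R, 0 < d & forall k s, `|s - t| < d -> s != t ->
    s != nbeg a k /\ s != nend a k.
  have [d d0 dP] := seq_isolated (breaks a) t; exists d => // k s sd st.
  by have [_ h1 h2] := notin_breaks (dP s sd st).
split=> [t|t tb|t|t].
- exact: needled_set.
- have [tS tb1 tb2] := notin_breaks tb; have [d d0 dP] := iso t.
  have loc s : `|s - t| < d -> forall k, in_needle a k s = in_needle a k t.
    move=> st k.
    have fb : ~ `|nbeg a k - t| < d.
      move=> h; have [|+ _] := dP k _ h; first by rewrite eq_sym tb1.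
      by rewrite eqxx.
    have fe : ~ `|nend a k - t| < d.
      move=> h; have [|_] := dP k _ h; first by rewrite eq_sym tb2.
      by rewrite eqxx.
    move: fb fe st; rewrite /in_needle !ltr_norml => /negP fb /negP fe st.
    by apply/idP/idP; lra.
  have [kt|nt] := pselect (exists k, in_needle a k t).
    have [k kt'] := kt; apply: (@continuous_near _ _ (fun=> vk k) _ t d) => //;
      last exact: cst_continuous.
    by move=> s st; rewrite (needled_in af (k := k))// loc.
  apply: (@continuous_near _ _ u _ t d) => //; last exact: uc.
  move=> s st; rewrite needled_out// => k; rewrite loc//.
  by apply/negP => kt; apply: nt; exists k.
- have [d d0 dP] := iso t.
  have loc s : t < s < t + d -> forall k, in_needle a k s = in_needle a k t.
    move=> st k.
    have fb : ~ (t < nbeg a k < t + d).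
      move=> h; have [| |+ _] := dP k (nbeg a k); [rewrite gtr0_norm; lra|rewrite gt_eqF//; lra|].
      by rewrite eqxx.
    have fe : ~ (t < nend a k < t + d).
      move=> h; have [| |_] := dP k (nend a k); [rewrite gtr0_norm; lra|rewrite gt_eqF//; lra|].
      by rewrite eqxx.
    move: fb fe; rewrite /in_needle => /negP fb /negP fe.
    by apply/idP/idP; lra.
  have [[k kt]|nt] := pselect (exists k, in_needle a k t).
    rewrite (needled_in af kt).
    apply: (@cvg_right_near _ _ (fun=> vk k) _ t d) => //; last exact: cvg_cst.
    by move=> s st; rewrite (needled_in af (k := k))// loc.
  rewrite needled_out; last by move=> k; apply/negP => kt; apply: nt; exists k.
  apply: (@cvg_right_near _ _ u _ t d) => //.
  move=> s st; rewrite needled_out// => k; rewrite loc//.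
  by apply/negP => kt; apply: nt; exists k.
- have [d d0 dP] := iso t.
  have loc s : t - d < s < t -> forall k, in_needle a k s = (nbeg a k < t <= nend a k).
    move=> st k.
    have fb : ~ (t - d < nbeg a k < t).
      move=> h; have [| |+ _] := dP k (nbeg a k); [rewrite ltr0_norm; lra|rewrite lt_eqF//; lra|].
      by rewrite eqxx.
    have fe : ~ (t - d < nend a k < t).
      move=> h; have [| |_] := dP k (nend a k); [rewrite ltr0_norm; lra|rewrite lt_eqF//; lra|].
      by rewrite eqxx.
    move: fb fe; rewrite /in_needle => /negP fb /negP fe.
    by apply/idP/idP; lra.
  have [[k kt]|nt] := pselect (exists k, nbeg a k < t <= nend a k).
    exists (vk k) => //.
    apply: (@cvg_left_near _ _ (fun=> vk k) _ t d) => //; last exact: cvg_cst.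
    by move=> s st; rewrite (needled_in af (k := k))// loc.
  have [y Uy uy] := ul t; exists y => //.
  apply: (@cvg_left_near _ _ u _ t d) => //.
  move=> s st; rewrite needled_out// => k; rewrite loc//.
  by apply/negP => kt; apply: nt; exists k.
Qed.

End Needles.

Lemma reg_joint_cont {R : realType} {E Y F : normedModType R} Om U (X : R -> E)
    (phi : R -> E -> Y -> F) D (x : R -> E) : reg Om U X phi D -> continuous x ->
  (forall t, Om (x t)) ->
  {within setT `*` U, continuous (fun z : R * Y => phi z.1 (x z.1) z.2)}.
Proof.
move=> phir cx xO; apply: (@within_comp _ _ _ _ _ (setT `*` Om `*` U)
    (fun z : R * Y => (z.1, x z.1, z.2)) (fun z : R * E * Y => phi z.1.1 z.1.2 z.2)).
- by move=> [t y] [/= _ Uy]; split=> //; split=> //=.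
- apply: within_pair; last by apply: within_continuous; exact: snd_continuous.
  apply: within_pair; apply: within_continuous; first exact: fst_continuous.
  by move=> z; apply: (@continuous_comp _ _ _ fst x); [exact: fst_continuous|exact: cx].
- exact: reg_cont phir.
Qed.

Record setting {R : realType} {E Y : normedModType R} (T : R) (Om : set E) (U : set Y)
    (S : seq R) (u : R -> Y) (X : R -> E) (f : R -> E -> Y -> E) (Df : R -> Y -> blin E E)
    (M : set Y) (r L : R) : Prop := Setting {
  set_T0 : 0 < T ; set_TS : T \notin S ; set_u : cadlag S U u ;
  set_X : continuous X ; set_XOm : forall t, Om (X t) ;
  set_Xfreeze : forall t, X (clamp 0 T t) = X t ;
  set_ffreeze : forall t, f (clamp 0 T t) = f t ;
  set_reg : reg Om U X f Df ;
  set_ode : forall t, 0 < t < T -> t \notin S -> is_derive t 1 X (f t (X t) (u t)) ;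
  set_M : compact M ; set_MU : M `<=` U ; set_uM : forall t, M (u t) ;
  set_r0 : 0 < r ; set_L0 : 0 <= L ;
  set_lip : forall t zeta xi xi', M zeta -> `|xi - X t| <= r -> `|xi' - X t| <= r ->
     Om xi /\ `|f t xi zeta - f t xi' zeta| <= L * `|xi - xi'| }.

(** * Trajectories of needle controls *)

Section Trajectories.
Context {R : realType} {E : completeNormedModType R} {Y : normedModType R} {N : nat}.
Variables (T : R) (Om : set E) (U : set Y) (S : seq R) (u : R -> Y) (X : R -> E).
Variables (f : R -> E -> Y -> E) (Df : R -> Y -> blin E E) (M : set Y) (r L : R).
Variables (tk : 'I_N -> R) (vk : 'I_N -> Y).
Hypothesis H : setting T Om U S u X f Df M r L.
Hypothesis tkT : forall k, 0 <= tk k < T.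
Hypothesis vM : forall k, M (vk k).
Implicit Types (a : 'I_N -> R) (k : 'I_N) (x : R -> E).

Notation nbeg := (nbeg tk).
Notation nend := (nend tk).
Notation ua := (needled u tk vk).
Notation breaks := (breaks S tk).
Notation fit := (fit T tk).

Let r0 := set_r0 H.
Let L0 := set_L0 H.

(** Projecting the state onto the tube makes the equation globally Lipschitz, so solutions exist on
    the whole line; while [x] stays within [r] of [X] nothing is changed. *)
Definition tube x t := X t + retract r (x t - X t).

Definition traj a x := [/\ continuous x, x 0 = X 0 & forall t, t \notin breaks a ->
  is_derive t 1 x (f t (tube x t) (ua a t))].

Lemma tube_near x t : `|tube x t - X t| <= r.
Proof. by rewrite /tube addrAC subrr add0r; exact: retract_norm. Qed.

Lemma tube_center t : `|X t - X t| <= r.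
Proof. by rewrite subrr normr0 ltW. Qed.

Lemma tube_Om x t : Om (tube x t).
Proof.
by have [] := set_lip H (set_uM H t) (tube_near x t) (tube_near x t).
Qed.

Lemma tube_continuous x : continuous x -> continuous (tube x).
Proof.
move=> cx t; apply: cvgD; first exact: (set_X H).
have cd : {for t, continuous (fun t => x t - X t)}.
  by apply: cvgB; [exact: cx|exact: (set_X H)].
apply: (@continuous_comp _ _ _ (fun t => x t - X t) (retract r)) => //.
by apply: (@lipschitz_continuous _ _ _ _ 2); exact: retract_lipschitz.
Qed.

Lemma ua_M a t : M (ua a t).
Proof. by apply: needled_set => //; exact: (set_uM H). Qed.

Lemma ua_cadlag a : fit a -> cadlag (breaks a) U (ua a).
Proof. by apply: needled_cadlag; [exact: (set_u H)|move=> k; exact: (set_MU H)]. Qed.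

Lemma lip2 t zeta (xi xi' : E) : M zeta ->
  `|f t (X t + retract r (xi - X t)) zeta - f t (X t + retract r (xi' - X t)) zeta|
    <= 2 * L * `|xi - xi'|.
Proof.
move=> Mz; have near (y : E) : `|X t + retract r (y - X t) - X t| <= r.
  by rewrite addrAC subrr add0r; exact: retract_norm.
have [_ h] := set_lip H Mz (near xi) (near xi'); rewrite (le_trans h)//.
rewrite [2 * L]mulrC -mulrA ler_wpM2l// opprD addrACA subrr add0r.
by rewrite (le_trans (retract_lipschitz r0 _ _))// opprB addrA subrK.
Qed.

Lemma traj_exists a : fit a -> exists x, traj a x.
Proof.
move=> af.
have [|t x y|x cx|x [cx x0 dx]] := @ode_global_solution R E (breaks a)
  (fun t y => f t (X t + retract r (y - X t)) (ua a t)) (2 * L) _ _ _ 0 (X 0).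
- by rewrite mulr_ge0.
- by apply: lip2; exact: ua_M.
- have jc := reg_joint_cont (set_reg H) (tube_continuous cx) (tube_Om x).
  have [G [cG dG]] := pwc_primitive (cadlag_pwc (cadlag_comp jc (ua_cadlag af))).
  by exists G.
- by exists x.
Qed.

(** The derivative of [ramps] off the breaks, and there at least 1 wherever the control is
    modified. *)
Definition chi a s : R := \sum_k (nbeg a k < s < nend a k)%R%:R.

Definition ramps a s := \sum_k ramp (nbeg a k) (nend a k) s.

Lemma chi_ge0 a s : 0 <= chi a s.
Proof. by apply: sumr_ge0 => k _; exact: ler0n. Qed.

Lemma chi_ge1 a k s : in_needle tk a k s -> s != nbeg a k -> 1 <= chi a s.
Proof.
move=> /andP[b e] sb; rewrite /chi (bigD1 k)//= lt_neqAle eq_sym sb b e/=.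
by rewrite lerDl sumr_ge0// => j _; exact: ler0n.
Qed.

Lemma is_derive_ramps a s : (forall k, 0 <= a k) -> s \notin breaks a ->
  is_derive s 1 (ramps a) (chi a s).
Proof.
move=> a0 /notin_breaks[_ sb se]; apply: (@is_derive_sum _ _ _ _ (fun k =>
  ramp (nbeg a k) (nend a k))) => k.
by apply: is_derive_ramp => //; exact: nbeg_le_end.
Qed.

Lemma ramps_continuous a : continuous (ramps a).
Proof. by apply: continuous_sum => k; exact: ramp_continuous. Qed.

Lemma ramps_ge0 a s : (forall k, 0 <= a k) -> 0 <= ramps a s.
Proof. by move=> a0; apply: sumr_ge0 => k _; apply: ramp_ge0; exact: nbeg_le_end. Qed.

Lemma ramps_le a s : (forall k, 0 <= a k) -> ramps a s <= \sum_k a k.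
Proof.
move=> a0; apply: ler_sum => k _; rewrite (le_trans (ramp_le _ (nbeg_le_end tk k a0)))//.
by rewrite /nend addrAC subrr add0r.
Qed.

Lemma ramp0 a k : (forall k, 0 <= a k) -> ramp (nbeg a k) (nend a k) 0 = 0.
Proof.
move=> a0; apply: ramp_before; first exact: nbeg_le_end.
by have /andP[h _] := tkT k; rewrite (le_trans h)//; exact: nbeg_ge.
Qed.

Lemma ramps0 a : (forall k, 0 <= a k) -> ramps a 0 = 0.
Proof. by move=> a0; apply: big1 => k _; exact: ramp0. Qed.

Lemma control_gap : exists2 B : R, 0 <= B & forall t zeta zeta', M zeta -> M zeta' ->
  `|f t (X t) zeta - f t (X t) zeta'| <= B.
Proof.
have cK : compact (`[0, T]%classic `*` M) by apply: compact_setX; [exact: segment_compact|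
  exact: (set_M H)].
have jc := reg_joint_cont (set_reg H) (set_X H) (set_XOm H).
have [|B B0 BP] := compact_bound cK (f := fun z : R * Y => f z.1 (X z.1) z.2).
  by apply: within_subset jc => -[t y] [/= _ /(set_MU H)].
exists (B + B) => [|t z z' Mz Mz']; first by rewrite addr_ge0.
have cl : `[0, T]%classic (clamp 0 T t) by rewrite /= in_itv/=; exact: clamp_itv (ltW (set_T0 H)).
rewrite -(set_ffreeze H t) -(set_Xfreeze H t) (le_trans (ler_normB _ _))// lerD//.
  exact: (BP (clamp 0 T t, z)).
exact: (BP (clamp 0 T t, z')).
Qed.

Lemma ua_cases a s : (forall k, 0 <= a k) -> s \notin breaks a ->
  ua a s = u s \/ 1 <= chi a s.
Proof.
move=> a0 /notin_breaks[_ sb _].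
have [[k ks]|nk] := pselect (exists k, in_needle tk a k s).
  by right; apply: chi_ge1 ks _.
by left; apply: needled_out => k; apply/negP => ks; apply: nk; exists k.
Qed.

(** Off the needles the velocities differ by the Lipschitz term only, on them by at most [B] more;
    Gronwall turns the total length into the bound. *)
Lemma traj_close : exists2 C : R, 0 <= C & forall a x, fit a -> traj a x ->
  forall t, 0 <= t <= T -> `|x t - X t| <= C * \sum_k a k.
Proof.
have [B B0 BP] := control_gap.
exists (B * expR (2 * L * T)); first by rewrite mulr_ge0// ltW// expR_gt0.
move=> a x af [cx x0 dx] t /andP[t0 tT]; have [a0 aT _] := af.
have Bchi s : s \notin breaks a -> `|f s (X s) (ua a s) - f s (X s) (u s)| <= B * chi a s.
  move=> sb; have [->|c1] := ua_cases a0 sb.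
    by rewrite subrr normr0 mulr_ge0// chi_ge0.
  rewrite (le_trans (BP _ _ _ (ua_M a s) (set_uM H s)))//.
  by rewrite ler_peMr.
have LL : 0 <= 2 * L by rewrite mulr_ge0.
have := @gronwall_int _ _ (breaks a) (fun s => x s - X s) (fun s => B * ramps a s)
  (fun s => B * chi a s) (2 * L) t t0 LL.
move=> /(_ _ _ _ _ _)/le_trans; apply.
- by move=> s; apply: cvgB; [exact: cx|exact: (set_X H)].
- by move=> s; apply: cvgM; [exact: cvg_cst|exact: ramps_continuous].
- move=> s /andP[s0 st] sb; have [sS _ _] := notin_breaks sb.
  exists (f s (tube x s) (ua a s) - f s (X s) (u s)); split.
  + apply: is_derive_sub; first exact: dx.
    by apply: (set_ode H) => //; rewrite s0 (lt_le_trans st).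
  + apply: (is_derive_eq (is_derive_mulr (is_derive_const B s) (is_derive_ramps a0 sb))).
    by rewrite mul0r add0r.
  + by rewrite mulr_ge0// chi_ge0.
  + by rewrite mulr_ge0// ramps_ge0.
  + rewrite -[f s (tube x s) _](subrK (f s (X s) (ua a s))) -addrA.
    rewrite (le_trans (ler_normD _ _))// lerD ?Bchi//.
    have := @lip2 s (ua a s) (x s) (X s) (ua_M a s).
    have r00 : retract r (0 : E) = 0 by apply: (retract_id r0); rewrite normr0 ltW.
    by rewrite subrr r00 addr0.
- by rewrite x0 subrr.
- by rewrite ramps0// mulr0.
rewrite -[leLHS]mulrA -[leRHS]mulrA ler_wpM2l// [leRHS]mulrC ler_pM ?ramps_ge0 ?ramps_le ?expR_ge0//.
by rewrite ler_expR ler_wpM2l.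
Qed.

(** Two needle controls can differ only between corresponding beginnings or between corresponding
    ends, hence on a set of measure at most the sum on the right. *)
Lemma traj_cont : exists2 C : R, 0 <= C & forall a a' x x', fit a -> fit a' ->
  traj a x -> traj a' x' ->
  `|x T - x' T| <= C * \sum_k (`|nbeg a k - nbeg a' k| + `|nend a k - nend a' k|).
Proof.
(* [B] bounds a change of control at [X]; the two terms [L * r] pay for moving the state from the
   tube to [X] and back. *)
have [B B0 BP] := control_gap; pose B' := B + 2 * L * r.
have B'0 : 0 <= B' by rewrite addr_ge0// !mulr_ge0// ltW.
exists (B' * expR (2 * L * T)); first by rewrite mulr_ge0// ltW// expR_gt0.
move=> a a' x x' af af' [cx x0 dx] [cx' x0' dx']; have [a0 _ _] := af; have [a'0 _ _] := af'.
have T0 := ltW (set_T0 H); have LL : 0 <= 2 * L by rewrite mulr_ge0.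
pose lo (b c : R) := Num.min b c; pose hi (b c : R) := Num.max b c.
have lohi b c : lo b c <= hi b c by rewrite ge_min !le_max !lexx.
have hilo b c : hi b c - lo b c = `|b - c|.
  by rewrite /hi /lo maxEle minEle; case: leP => bc; [rewrite distrC ger0_norm ?subr_ge0|
    rewrite gtr0_norm ?subr_gt0].
pose q k s := ramp (lo (nbeg a k) (nbeg a' k)) (hi (nbeg a k) (nbeg a' k)) s
  + ramp (lo (nend a k) (nend a' k)) (hi (nend a k) (nend a' k)) s.
pose dq k s : R := (lo (nbeg a k) (nbeg a' k) < s < hi (nbeg a k) (nbeg a' k))%R%:R
  + (lo (nend a k) (nend a' k) < s < hi (nend a k) (nend a' k))%R%:R.
have q0 k s : 0 <= q k s by rewrite addr_ge0// ramp_ge0.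
have dq0 k s : 0 <= dq k s by rewrite addr_ge0 ?ler0n.
have qT : \sum_k q k T <= \sum_k (`|nbeg a k - nbeg a' k| + `|nend a k - nend a' k|).
  by apply: ler_sum => k _; rewrite lerD// -hilo ramp_le.
have q00 k : q k 0 = 0.
  have /andP[h _] := tkT k; have h1 := nbeg_ge tk k a0; have h2 := nbeg_ge tk k a'0.
  have h3 := nbeg_le_end tk k a0; have h4 := nbeg_le_end tk k a'0.
  rewrite /q !ramp_before ?addr0// le_min; apply/andP; split; lra.
have sep s : s \notin breaks a -> s \notin breaks a' ->
    ua a s = ua a' s \/ 1 <= \sum_k dq k s.
  move=> /notin_breaks[_ sb se] /notin_breaks[_ sb' se'].
  have [same|/existsNP[k /eqP diff]] := pselect (forall k,
    in_needle tk a k s = in_needle tk a' k s).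
    by left; apply: needled_local.
  right; rewrite (bigD1 k)//=; apply: (@le_trans _ _ (dq k s)); last by rewrite lerDl sumr_ge0.
  rewrite /dq /lo /hi !gt_min !lt_max.
  have := sb k; have := se k; have := sb' k; have := se' k; move: diff; rewrite /in_needle.
  case: (ltgtP (nbeg a k) s); case: (ltgtP (nend a k) s) => //=; case: (ltgtP (nbeg a' k) s);
    case: (ltgtP (nend a' k) s) => //=; rewrite ?eqxx ?addr0 ?add0r ?lexx ?lerDl ?lerDr//.
have := @gronwall_int _ _ (breaks a ++ breaks a') (fun s => x s - x' s)
  (fun s => B' * \sum_k q k s) (fun s => B' * \sum_k dq k s) (2 * L) T T0 LL.
move=> /(_ _ _ _ _ _)/le_trans; apply.
- by move=> s; apply: cvgB; [exact: cx|exact: cx'].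
- move=> s; apply: cvgM; first exact: cvg_cst.
  by apply: continuous_sum => k t; apply: cvgD; exact: ramp_continuous.
- move=> s /andP[s0 sT]; rewrite mem_cat negb_or => /andP[sb sb'].
  exists (f s (tube x s) (ua a s) - f s (tube x' s) (ua a' s)); split.
  + by apply: is_derive_sub; [exact: dx|exact: dx'].
  + have dsum : is_derive s 1 (fun s => \sum_k q k s) (\sum_k dq k s).
      have [_ h1 h2] := notin_breaks sb; have [_ h3 h4] := notin_breaks sb'.
      apply: (@is_derive_sum _ _ _ _ q) => k.
      apply: is_deriveD; apply: is_derive_ramp => //; rewrite /lo /hi ?minEle ?maxEle;
        case: ifP => _ //.
    apply: (is_derive_eq (is_derive_mulr (is_derive_const B' s) dsum)).
    by rewrite mul0r add0r.
  + by rewrite mulr_ge0// sumr_ge0.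
  + by rewrite mulr_ge0// sumr_ge0.
  + rewrite -[f s (tube x s) _](subrK (f s (tube x' s) (ua a s))) -addrA.
    rewrite (le_trans (ler_normD _ _))// lerD//; first exact: lip2 (ua_M a s).
    have [->|c1] := sep s sb sb'; first by rewrite subrr normr0 mulr_ge0// sumr_ge0.
    apply: (@le_trans _ _ B'); last by rewrite ler_peMr.
    have [_ h1] := set_lip H (ua_M a s) (tube_near x' s) (tube_center s).
    have [_ h2] := set_lip H (ua_M a' s) (tube_center s) (tube_near x' s).
    have h3 := BP s _ _ (ua_M a s) (ua_M a' s).
    have h4 : L * `|tube x' s - X s| <= L * r by rewrite ler_wpM2l// tube_near.
    rewrite [`|X s - _|]distrC in h2.
    have := ler_distD (f s (X s) (ua a s)) (f s (tube x' s) (ua a s)) (f s (tube x' s) (ua a' s)).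
    have := ler_distD (f s (X s) (ua a' s)) (f s (X s) (ua a s)) (f s (tube x' s) (ua a' s)).
    rewrite /B'; lra.
- by rewrite x0 x0' subrr.
- by rewrite big1 ?mulr0// => k _; exact: q00.
by rewrite mulrAC ler_wpM2l// mulr_ge0// expR_ge0.
Qed.

Lemma traj_admissible a x : fit a -> traj a x ->
  (forall t, 0 <= t <= T -> `|x t - X t| <= r) ->
  [/\ PC1 T Om x, NPC0 T U (ua a) &
      forall t, t \in `[0, T] -> ext_derive T x t = f t (x t) (ua a t)].
Proof.
move=> af [cx x0 dx] xr; have T0 := set_T0 H.
have tubeE t : 0 <= t <= T -> tube x t = x t.
  by move=> tT; rewrite /tube (retract_id r0) ?xr// addrC subrK.
have jc := reg_joint_cont (set_reg H) (tube_continuous cx) (tube_Om x).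
have cphi := cadlag_comp jc (ua_cadlag af).
have TS := T_notin_breaks (set_TS H) af.
have cx' : {within `[0, T], continuous x} by exact: continuous_subspaceT.
have xOm t : t \in `[0, T] -> Om (x t).
  by rewrite in_itv/= => tT; rewrite -tubeE//; exact: tube_Om.
have dx' t : 0 < t < T -> t \notin breaks a -> is_derive t 1 x (f t (tube x t) (ua a t)).
  by move=> _; exact: dx.
have [xPC xE] := cadlag_PC1 T0 TS cx' xOm cphi dx'.
split=> //; first exact: cadlag_NPC0 TS (ua_cadlag af).
move=> t tT; rewrite xE//= tubeE//.
Qed.

End Trajectories.

(** * First-order expansions *)

(** Dominated convergence with a constant bound, read on primitives. *)
Lemma pwc_dominated {R : realType} (S : seq R) (g G : nat -> R -> R) (C T : R) : 0 < T ->
  (forall n, pwc S (g n)) -> (forall n, continuous (G n)) ->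
  (forall n t, 0 < t < T -> t \notin S -> is_derive t 1 (G n) (g n t)) ->
  (forall n t, 0 <= t <= T -> `|g n t| <= C) ->
  (forall t, 0 <= t <= T -> tends0 (fun n => g n t)) ->
  tends0 (fun n => G n T - G n 0).
Proof.
move=> T0 pg cG dG gC g0.
have mg n := measurable_int _ (pwc_integrable (ltW T0) (pg n)).
have ig n : \int[lebesgue_measure]_(t in `[0, T]) g n t = G n T - G n 0.
  exact: pwc_FTC T0 (pg n) (cG n) (dG n).
have C_int : lebesgue_measure.-integrable `[0, T] (EFin \o (fun=> C : R)).
  apply: (@pwc_integrable _ [::]) => //; first exact: ltW.
  split=> [t|t _]; last exact: cst_continuous.
  by split; exists C; exact: cvg_cst.
have gt (t : R) : `[0, T]%classic t -> (EFin \o g n) t @[n --> \oo] --> 0%E.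
  rewrite /= in_itv/= => tT; apply/cvg_EFin => /=; first exact: nearW.
  apply/cvgrPdist_le => e e0; have [N NP] := g0 t tT e e0.
  by exists N => // n Nn; rewrite /= sub0r normrN; exact: NP.
have gb n (t : R) : `[0, T]%classic t -> (`|(EFin \o g n) t| <= (EFin \o (fun=> C : R)) t)%E.
  by rewrite /= in_itv/= => tT; rewrite lee_fin; exact: gC.
have : (\int[lebesgue_measure]_(t in `[0%R, T]) (EFin \o g n) t @[n --> \oo]
    --> \int[lebesgue_measure]_(t in `[0%R, T]) (fun=> 0) t)%E.
  apply: (@dominated_cvg _ _ _ _ _ _ _ _ (EFin \o (fun=> C : R))) => //.
rewrite integral0 => /fine_cvgP[_ /cvgrPdist_le lim0] e e0.
have [N _ NP] := lim0 e e0; exists N => n Nn; have := NP n Nn.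
by rewrite -ig sub0r normrN.
Qed.

Section Expansions.
Context {R : realType} {E : completeNormedModType R} {Y : normedModType R} {N : nat}.
Variables (T : R) (Om : set E) (U : set Y) (S : seq R) (u : R -> Y) (X : R -> E).
Variables (f : R -> E -> Y -> E) (Df : R -> Y -> blin E E) (M : set Y) (r L : R).
Hypothesis H : setting T Om U S u X f Df M r L.

Let r0 := set_r0 H.
Let T0 := set_T0 H.

Section Integrand.
Context {F : completeNormedModType R}.
Variables (phi : R -> E -> Y -> F) (D : R -> Y -> blin E F) (Lp : R).
Hypothesis phir : reg Om U X phi D.
Hypothesis Lp0 : 0 <= Lp.
Hypothesis phil : forall t zeta xi xi', M zeta -> `|xi - X t| <= r -> `|xi' - X t| <= r ->
  `|phi t xi zeta - phi t xi' zeta| <= Lp * `|xi - xi'|.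

(** A differential is bounded by a local Lipschitz constant: it is tested on a multiple of [h] short
    enough both for the expansion and for the tube. *)
Lemma reg_norm t zeta : M zeta -> `|D t zeta| <= Lp.
Proof.
move=> Mz; apply: blin_norm_le => // h; apply/ler_addgt0Pr => e e0.
have [->|h0] := eqVneq h 0; first by rewrite linear0 !normr0 mulr0 add0r ltW.
have hn : 0 < `|h| by rewrite normr_gt0.
have /is_Fdiff_epsP/(_ (e / `|h|))[|d d0 dP] := reg_diff phir t (set_MU H Mz).
  by rewrite divr_gt0.
pose s := Num.min (d / 2) r / `|h|.
have m0 : 0 < Num.min (d / 2) r by rewrite lt_min divr_gt0.
have s0 : 0 < s by rewrite divr_gt0.
have sh : `|s *: h| = Num.min (d / 2) r by rewrite normrZ gtr0_norm// divfK// gt_eqF.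
clearbody s.
have h1 : `|s *: h| < d by rewrite sh gt_min ltr_pdivrMr// ltr_pMr// ltr1n.
have h2 : `|s *: h| <= r by rewrite sh ge_min lexx orbT.
have h3 := dP _ h1.
have h4 := @phil t zeta (X t + s *: h) (X t) Mz.
rewrite addrAC subrr add0r normr0 in h4.
have {}h4 := h4 h2 (ltW r0).
have h5 : `|D t zeta (s *: h)| <= (Lp + e / `|h|) * `|s *: h|.
  rewrite -[D _ _ _](subrK (phi t (X t + s *: h) zeta - phi t (X t) zeta)).
  rewrite (le_trans (ler_normD _ _))// distrC mulrDl addrC lerD//.
move: h5; rewrite linearZ !normrZ (gtr0_norm s0) mulrCA ler_pM2l// mulrDl divfK//.
by rewrite gt_eqF.
Qed.

Lemma linearized_cadlag (y : R -> E) : continuous y -> cadlag S setT (fun t => D t (u t) (y t)).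
Proof.
move=> cy; apply: (@cadlag_comp _ _ _ _ U u (fun z : R * Y => D z.1 z.2 (y z.1))) (set_u H).
apply: within_blin; first exact: reg_Dcont phir.
by apply: within_continuous => z; apply: (@continuous_comp _ _ _ fst y); [exact: fst_continuous|
  exact: cy].
Qed.

Lemma linearized_primitive (y : R -> E) (t0 : R) (c : F) : continuous y ->
  exists psi, [/\ continuous psi, psi t0 = c &
    forall t, t \notin S -> is_derive t 1 psi (D t (u t) (y t))].
Proof.
move=> cy; have [G [cG dG]] := pwc_primitive (cadlag_pwc (linearized_cadlag cy)).
exists (fun t => c - G t0 + G t); split; last by move=> t /dG dt; exact: is_derive_addl.
- by move=> t; apply: cvgD; [exact: cvg_cst|exact: cG].
- by rewrite subrK.
Qed.

Variables (s : nat -> R) (B : R).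
Hypotheses (s_gt0 : forall n, 0 < s n) (s_to0 : tends0 s) (B0 : 0 <= B).

Section Remainder.
Variable tx : nat -> R -> E.
Hypotheses (ctx : forall n, continuous (tx n)) (txr : forall n t, `|tx n t - X t| <= r).
Hypothesis txs : forall n t, 0 <= t <= T -> `|tx n t - X t| <= B * s n.

Definition remainder n t : F :=
  phi t (tx n t) (u t) - phi t (X t) (u t) - D t (u t) (tx n t - X t).

(** Divided by [s n], the remainder tends to 0 at each fixed [t] by Frechet differentiability at
    [X t], and is at most [2 * Lp * B] on [[0, T]]: one half from the increment of [phi], one half
    from the differential. *)
Lemma remainder_primitive : exists G : nat -> R -> R, [/\ forall n, continuous (G n),
  forall n, G n 0 = 0,
  forall n t, t \notin S -> is_derive t 1 (G n) `|remainder n t|,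
  forall n t, 0 <= t <= T -> 0 <= G n t <= G n T &
  forall e, 0 < e -> exists n0, forall n, (n0 <= n)%N -> G n T <= e * s n].
Proof.
have txO n t : Om (tx n t).
  by have [] := set_lip H (set_uM H t) (txr n t) (txr n t).
have cr n : cadlag S setT (fun t => (s n)^-1 * `|remainder n t|).
  have j1 := reg_joint_cont phir (@ctx n) (txO n).
  have j2 := reg_joint_cont phir (set_X H) (set_XOm H).
  apply: (@cadlag_comp _ _ _ _ U u (fun z : R * Y => (s n)^-1 *
    `|phi z.1 (tx n z.1) z.2 - phi z.1 (X z.1) z.2 - D z.1 z.2 (tx n z.1 - X z.1)|)) (set_u H).
  move=> z; apply: cvgM; first exact: cvg_cst.
  move: z; apply: within_norm; apply: within_sub; first exact: within_sub.
  apply: within_blin; first exact: reg_Dcont phir.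
  apply: within_continuous => z.
  apply: (@continuous_comp _ _ _ fst (fun t => tx n t - X t)); first exact: fst_continuous.
  by apply: cvgB; [exact: ctx|exact: (set_X H)].
have ex n : exists G : R -> R, [/\ continuous G, G 0 = 0 &
    forall t, t \notin S -> is_derive t 1 G ((s n)^-1 * `|remainder n t|)].
  have [G [cG dG]] := pwc_primitive (cadlag_pwc (cr n)).
  exists (fun t => - G 0 + G t); split; last by move=> t /dG dt; exact: is_derive_addl.
  - by move=> t; apply: cvgD; [exact: cvg_cst|exact: cG].
  - by rewrite addNr.
have [Q QP] := choice ex.
have cQ n : continuous (Q n) by case: (QP n).
have Q0 n : Q n 0 = 0 by case: (QP n).
have dQ n t : t \notin S -> is_derive t 1 (Q n) ((s n)^-1 * `|remainder n t|).
  by case: (QP n) => _ _; apply.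
have lim : tends0 (fun n => Q n T - Q n 0).
  apply: (@pwc_dominated R S (fun n t => (s n)^-1 * `|remainder n t|) Q (2 * Lp * B)) => //.
  - by move=> n; exact: cadlag_pwc (cr n).
  - move=> n t tT; rewrite normrM normr_id gtr0_norm ?invr_gt0// ler_pdivrMl//.
    have h1 := @phil t (u t) (tx n t) (X t) (set_uM H t) (txr n t).
    rewrite subrr normr0 in h1; have {}h1 := h1 (ltW r0).
    have h2 := blin_bound (D t (u t)) (tx n t - X t).
    have h3 : `|D t (u t)| * `|tx n t - X t| <= Lp * `|tx n t - X t|.
      by rewrite ler_wpM2r// reg_norm//; exact: (set_uM H).
    have h4 : Lp * `|tx n t - X t| <= Lp * (B * s n) by rewrite ler_wpM2l// txs.
    rewrite /remainder (le_trans (ler_normB _ _))//.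
    have -> : s n * (2 * Lp * B) = Lp * (B * s n) + Lp * (B * s n) by ring.
    by rewrite lerD// ?(le_trans h1)// (le_trans h2)// (le_trans h3).
  move=> t tT e e0; have Uu := set_MU H (set_uM H t).
  have /is_Fdiff_epsP/(_ (e / (B + 1)))[|d d0 dP] := reg_diff phir t Uu.
    by rewrite divr_gt0// ltr_wpDl.
  have B1 : 0 < B + 1 by rewrite ltr_wpDl.
  have [n0 n0P] := s_to0 (divr_gt0 (divr_gt0 d0 B1) (ltr0n _ 2)).
  exists n0 => n nn; have := n0P n nn; rewrite gtr0_norm// => sd.
  rewrite normrM normr_id gtr0_norm ?invr_gt0// ler_pdivrMl//.
  have h1 := txs n tT.
  have h2 : `|tx n t - X t| < d.
    rewrite (le_lt_trans h1)//; apply: (@le_lt_trans _ _ ((B + 1) * (d / (B + 1) / 2))).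
      by rewrite ler_pM// ?lerDl// ltW.
    have -> : (B + 1) * (d / (B + 1) / 2) = d / 2 by field; rewrite gt_eqF.
    by rewrite ltr_pdivrMr// ltr_pMr// ltr1n.
  have := dP _ h2; rewrite addrCA subrr addr0 => /le_trans; apply.
  rewrite mulrAC ler_pdivrMr// [s n * e]mulrC -mulrA ler_pM2l// mulrC (le_trans h1)//.
  by rewrite ler_pM2r// lerDl.
have mono n a b : 0 <= a <= b -> Q n a <= Q n b.
  move=> /andP[_ ab]; rewrite -subr_ge0.
  have cc : continuous ((fun=> 0) : R -> R) by move=> t; exact: cvg_cst.
  have := @mean_value_fun _ _ S (fun=> 0) (Q n) a b ab cc (cQ n).
  rewrite subrr normr0; apply => t _ tS.
  exists 0, ((s n)^-1 * `|remainder n t|); split; [exact: is_derive_const|exact: dQ|].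
  by rewrite normr0 mulr_ge0// invr_ge0 ltW.
exists (fun n t => s n * Q n t); split.
- by move=> n t; apply: cvgM; [exact: cvg_cst|exact: cQ].
- by move=> n; rewrite Q0 mulr0.
- move=> n t tS; apply: (is_derive_eq (is_derive_mulr (is_derive_const (s n) t) (dQ n t tS))).
  by rewrite mul0r add0r mulrA mulfV ?gt_eqF// mul1r.
- move=> n t /andP[t0 tT].
  have q0 : 0 <= Q n t by rewrite -(Q0 n); apply: mono; rewrite lexx.
  by rewrite (mulr_ge0 (ltW (s_gt0 n)) q0)/= ler_pM2l// mono// t0.
- move=> e e0; have [n0 n0P] := lim e e0; exists n0 => n nn; have := n0P n nn.
  by rewrite Q0 subr0 => h; rewrite mulrC ler_pM2r// (le_trans (ler_norm _)).
Qed.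

End Remainder.
End Integrand.
End Expansions.

Lemma finite_lower_bound {R : realType} (I : finType) (d : I -> R) :
  (forall i, 0 < d i) -> exists2 d0 : R, 0 < d0 & forall i, d0 <= d i.
Proof.
move=> dP; have [e e0 eP] : exists2 e : R, 0 < e & forall i, i \in enum I -> e <= d i.
  elim: (enum I) => [|i s [e e0 eP]]; first by exists 1.
  exists (Num.min e (d i)); first by rewrite lt_min e0 dP.
  by move=> j; rewrite inE => /predU1P[->|/eP h]; rewrite ge_min ?lexx ?h ?orbT.
by exists e => // i; apply: eP; rewrite mem_enum.
Qed.

Lemma finite_rank (I : finType) (P : I -> nat -> Prop) :
  (forall i, exists n0, forall n, (n0 <= n)%N -> P i n) ->
  exists n0, forall n, (n0 <= n)%N -> forall i, P i n.
Proof.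
move=> ex; have [k kP] := choice ex; exists (\max_i k i)%N => n kn i.
by apply: kP; rewrite (leq_trans (leq_bigmax i)).
Qed.

(** * First-order expansion along a sequence of needle controls *)

Section Needles.
Context {R : realType} {E : completeNormedModType R} {Y : normedModType R} {N : nat}.
Variables (T : R) (Om : set E) (U : set Y) (S : seq R) (u : R -> Y) (X : R -> E).
Variables (f : R -> E -> Y -> E) (Df : R -> Y -> blin E E) (M : set Y) (r L : R).
Variables (tk : 'I_N -> R) (vk : 'I_N -> Y).
Hypothesis H : setting T Om U S u X f Df M r L.
Hypothesis tkT : forall k, 0 <= tk k < T.
Hypothesis vM : forall k, M (vk k).

Notation nbeg := (nbeg tk).
Notation nend := (nend tk).
Notation ua := (needled u tk vk).
Notation breaks := (breaks S tk).
Notation fit := (fit T tk).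
Notation tube := (tube X r).
Notation chi := (chi tk).
Notation ramps := (ramps tk).
Notation traj := (traj S u X f r tk vk).
Notation bump a k t := ((nbeg a k < t < nend a k)%R%:R : R).

Let r0 := set_r0 H.
Let T0 := set_T0 H.

Variables (s : nat -> R) (B : R) (a : nat -> 'I_N -> R) (x : nat -> R -> E).
Variable y : 'I_N -> R -> E.
Hypotheses (s_gt0 : forall n, 0 < s n) (s_to0 : tends0 s) (B0 : 0 <= B).
Hypotheses (afit : forall n, fit (a n)) (aB : forall n k, a n k <= B * s n).
Hypothesis xtraj : forall n, traj (a n) (x n).
Hypothesis xclose : forall n t, 0 <= t <= T -> `|x n t - X t| <= B * s n.
Hypothesis cy : forall k, continuous (y k).

Let a_ge0 n k : 0 <= a n k. Proof. by case: (afit n). Qed.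

(** What remains of the deviation after its first-order prediction. The arc [y k] is meant to solve
    the linearized equation from the velocity jump at [tk k]; the ramp is the part of needle [k]
    already run through. *)
Definition defect n t : E :=
  x n t - X t - \sum_k ramp (nbeg (a n) k) (nend (a n) k) t *: y k t.

Lemma sum_needles_le n : \sum_k a n k <= N%:R * B * s n.
Proof.
apply: (@le_trans _ _ (\sum_(k < N) B * s n)); first exact: ler_sum.
by rewrite sumr_const card_ord -[leLHS]mulr_natl mulrA.
Qed.

Lemma tube_close n t : 0 <= t <= T -> `|tube (x n) t - X t| <= 2 * B * s n.
Proof.
move=> tT; rewrite /tube addrAC subrr add0r -[retract _ _]subr0.
have r00 : retract r (0 : E) = 0 by apply: (retract_id r0); rewrite normr0 ltW.
rewrite -[X in _ - X]r00 (le_trans (retract_lipschitz r0 _ _))// subr0.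
by rewrite -mulrA ler_pM2l// xclose.
Qed.

Lemma tube_eq n t : 0 <= t <= T -> B * s n <= r -> tube (x n) t = x n t.
Proof.
move=> tT Br; rewrite /tube (retract_id r0) ?(le_trans (xclose _ tT))//.
by rewrite addrC subrK.
Qed.

Lemma defect_continuous n : continuous (defect n).
Proof.
have [cx _ _] := xtraj n => t; apply: cvgB; first by apply: cvgB; [exact: cx|exact: (set_X H)].
apply: (@continuous_sum _ _ _ _ (fun k t => ramp (nbeg (a n) k) (nend (a n) k) t *: y k t)).
by move=> k t'; apply: cvgZ; [exact: ramp_continuous|exact: cy].
Qed.

Lemma defect0 n : defect n 0 = 0.
Proof.
have [_ x0 _] := xtraj n; rewrite /defect x0 subrr sub0r big1 ?oppr0// => k _.
by rewrite (ramp0 tkT) ?scale0r.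
Qed.

Section Integrand.
Context {F : completeNormedModType R}.
Variables (phi : R -> E -> Y -> F) (D : R -> Y -> blin E F) (Lp : R) (psi : 'I_N -> R -> F).
Hypothesis phir : reg Om U X phi D.
Hypothesis Lp0 : 0 <= Lp.
Hypothesis phil : forall t zeta xi xi', M zeta -> `|xi - X t| <= r -> `|xi' - X t| <= r ->
  `|phi t xi zeta - phi t xi' zeta| <= Lp * `|xi - xi'|.
Hypothesis cpsi : forall k, continuous (psi k).
Hypothesis psi_tk : forall k, psi k (tk k) =
  phi (tk k) (X (tk k)) (vk k) - phi (tk k) (X (tk k)) (u (tk k)).

(** Right continuity of [u] suffices, because needles lie to the right of their base instants. *)
Lemma jump_near e : 0 < e -> exists2 d : R, 0 < d & forall k t, tk k <= t < tk k + d ->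
  `|phi t (X t) (vk k) - phi t (X t) (u t) - psi k t| <= e.
Proof.
move=> e0; have jc := reg_joint_cont phir (set_X H) (set_XOm H).
have ex k : exists d : R, 0 < d /\ forall t, tk k <= t < tk k + d ->
    `|phi t (X t) (vk k) - phi t (X t) (u t) - psi k t| <= e.
  have cv : cadlag [::] U (fun=> vk k).
    split=> // [t|t _|t|t]; first exact: (set_MU H).
    - exact: cvg_cst.
    - exact: cvg_cst.
    by exists (vk k); [exact: (set_MU H)|exact: cvg_cst].
  have [_ _ rv _] := cadlag_comp jc cv; have [_ _ ru _] := cadlag_comp jc (set_u H).
  have rr : phi t (X t) (vk k) - phi t (X t) (u t) - psi k t @[t --> (tk k)^'+] -->
      phi (tk k) (X (tk k)) (vk k) - phi (tk k) (X (tk k)) (u (tk k)) - psi k (tk k).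
    apply: cvgB; last exact: continuous_right (@cpsi k _).
    by apply: cvgB; [exact: rv|exact: ru].
  rewrite -psi_tk subrr in rr; have /cvg_right_epsP/(_ e e0)[d d0 dP] := rr.
  exists d; split=> // t /andP[t1 t2]; have [->|tt] := eqVneq t (tk k).
    by rewrite psi_tk subrr normr0 ltW.
  by have := dP t; rewrite subr0; apply; rewrite lt_neqAle eq_sym tt t1 t2.
have [d dP] := choice ex; have [e' e'0 eP] := finite_lower_bound (fun k => (dP k).1).
exists e' => // k t /andP[t1 t2]; apply: (dP k).2; rewrite t1 (lt_le_trans t2)//.
by rewrite lerD2l.
Qed.

(** Outside the needles the left-hand side vanishes. Inside, one [eta] pays for moving two values of
    [phi] from the tube to [X], each over at most [2 * B * s n], and one for the jump. *)
Lemma jump_sum (d eta : R) n t : (forall k t, tk k <= t < tk k + d ->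
    `|phi t (X t) (vk k) - phi t (X t) (u t) - psi k t| <= eta) ->
  0 <= eta ->
  0 <= t <= T -> t \notin breaks (a n) -> N%:R * B * s n < d -> Lp * (4 * B * s n) <= eta ->
  `|phi t (tube (x n) t) (ua (a n) t) - phi t (tube (x n) t) (u t)
    - \sum_k bump (a n) k t *: psi k t| <= 2 * eta * chi (a n) t.
Proof.
move=> dP eta0 tT tb nd neta; have [_ sb se] := notin_breaks tb.
have [[k ks]|nk] := pselect (exists k, in_needle tk (a n) k t); last first.
  have nk' k : ~~ in_needle tk (a n) k t by apply/negP => ks; apply: nk; exists k.
  rewrite needled_out// subrr sub0r normrN big1 ?normr0 ?mulr_ge0 ?chi_ge0// => k _.
  have := nk' k; rewrite /in_needle le_eqVlt eq_sym (negbTE (sb k))/=.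
  by move=> /negbTE ->; rewrite scale0r.
have sum0 : \sum_(j < N | j != k) bump (a n) j t *: psi j t = 0.
  apply: big1 => j jk; case: (boolP (_ < _ < _)) => [/andP[j1 j2]|]; last by rewrite scale0r.
  have [_ _ disj] := afit n; have := disj j k t; rewrite /in_needle (ltW j1) j2 => /(_ isT ks) jk'.
  by rewrite jk' eqxx in jk.
rewrite (needled_in u vk (afit n) ks) (bigD1 k)//= sum0.
have c1 := chi_ge1 ks (sb k).
have -> : (nbeg (a n) k < t < nend (a n) k) = true.
  by move: ks; rewrite /in_needle le_eqVlt eq_sym (negbTE (sb k)).
rewrite scale1r addr0.
apply: (@le_trans _ _ (2 * eta)); last by rewrite ler_peMr// mulr_ge0.
have tr : `|tube (x n) t - X t| <= r by exact: (tube_near H).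
have h1 := phil (t := t) (vM k) tr (tube_center H t).
have h2 := phil (t := t) (set_uM H t) tr (tube_center H t).
have h3 : `|phi t (X t) (vk k) - phi t (X t) (u t) - psi k t| <= eta.
  apply: dP; have /andP[k1 k2] := ks; rewrite (le_trans _ k1) ?nbeg_ge//=.
  rewrite (lt_le_trans k2)// (le_trans (nend_le _ _ _))// lerD2l ltW//.
  by rewrite (le_lt_trans (sum_needles_le n)).
have h4 : Lp * `|tube (x n) t - X t| <= Lp * (2 * B * s n) by rewrite ler_wpM2l// tube_close.
set p1 := phi t _ (vk k) in h1 *; set p2 := phi t _ (u t) in h2 *.
set p3 := phi t _ (vk k) in h1 h3 *; set p4 := phi t _ (u t) in h2 h3 *.
have -> : p1 - p2 - psi k t = (p1 - p3) - (p2 - p4) + (p3 - p4 - psi k t).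
  by rewrite addrA; congr (_ - _); rewrite addrAC subrKA opprB subrKA.
rewrite (le_trans (ler_normD _ _))// mulrDl mul1r lerD//.
rewrite (le_trans (ler_normB _ _))// (le_trans (lerD h1 h2))// (le_trans (lerD h4 h4))//.
by rewrite (le_trans _ neta)// -mulrDr ler_wpM2l//; lra.
Qed.

(** Shared by state and costs: the linear prediction errs by a multiple of the defect plus a term
    with primitive [o(s n)], made of the remainder along [u] and of the jumps on the needles. *)
Lemma increment_estimate e : 0 < e -> exists n0, forall n, (n0 <= n)%N -> exists g G : R -> R,
  [/\ continuous G, G 0 = 0,
    forall t, 0 < t < T -> t \notin breaks (a n) -> is_derive t 1 G (g t) /\ 0 <= g t,
    forall t, 0 < t < T -> t \notin breaks (a n) ->
     `|phi t (tube (x n) t) (ua (a n) t) - phi t (X t) (u t)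
        - \sum_k (bump (a n) k t *: psi k t
            + ramp (nbeg (a n) k) (nend (a n) k) t *: D t (u t) (y k t))|
      <= Lp * `|defect n t| + g t &
    forall t, 0 <= t <= T -> 0 <= G t <= e * s n].
Proof.
(* [A * s n] bounds the total length of the needles, so the jumps contribute at most
   [2 * eta * A * s n = e / 2 * s n]. *)
move=> e0; pose A := N%:R * B + 1; have A0 : 0 < A by rewrite ltr_wpDl// mulr_ge0.
pose eta := e / 4 / A; have eta0 : 0 < eta by rewrite !divr_gt0.
have [d d0 dP] := jump_near eta0.
have ctube n : continuous (tube (x n)) by apply: (tube_continuous H); case: (xtraj n).
have [Q [cQ Q0 dQ Qmono Qsmall]] := remainder_primitive H phir Lp0 phil s_gt0 s_to0
  (mulr_ge0 (ler0n R 2) B0) ctube (fun n t => tube_near H (x n) t) tube_close.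
have small (c b : R) : 0 <= c -> 0 < b -> exists n0, forall n, (n0 <= n)%N -> c * s n < b.
  move=> c0 b0; have c1 : 0 < c + 1 by rewrite ltr_wpDl.
  have [n0 n0P] := s_to0 (divr_gt0 b0 c1); exists n0 => n /n0P; rewrite gtr0_norm// => h.
  rewrite (le_lt_trans (ler_wpM2l c0 h))// mulrA ltr_pdivrMr// mulrC ltr_pM2l//.
  by rewrite ltrDl.
have [n1 n1P] := small (N%:R * B) d (mulr_ge0 (ler0n R N) B0) d0.
have [n2 n2P] := small (Lp * (4 * B)) eta (mulr_ge0 Lp0 (mulr_ge0 (ler0n R 4) B0)) eta0.
have [n3 n3P] := small B r B0 r0.
have [n4 n4P] := Qsmall (e / 2) (divr_gt0 e0 (ltr0n R 2)).
exists (maxn (maxn n1 n2) (maxn n3 n4)) => n; rewrite !geq_max.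
move=> /andP[/andP[/n1P h1 /n2P h2] /andP[/n3P h3 /n4P h4]].
exists (fun t => `|remainder u X phi D (fun n => tube (x n)) n t| + 2 * eta * chi (a n) t).
exists (fun t => Q n t + 2 * eta * ramps (a n) t); split.
- move=> t; apply: cvgD; first exact: cQ.
  by apply: cvgM; [exact: cvg_cst|exact: ramps_continuous].
- by rewrite Q0 (ramps0 tkT)// mulr0 addr0.
- move=> t tT tb; have [tS _ _] := notin_breaks tb; split; last first.
    by rewrite addr_ge0// mulr_ge0 ?chi_ge0// mulr_ge0// ltW.
  apply: is_deriveD; first exact: dQ.
  apply: (is_derive_eq (is_derive_mulr (is_derive_const (2 * eta) t) (is_derive_ramps (a_ge0 n) tb))).
  by rewrite mul0r add0r.
- move=> t /andP[t1 t2] tb; have tT : 0 <= t <= T by rewrite !ltW.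
  have {}h2 : Lp * (4 * B * s n) <= eta by rewrite mulrA ltW.
  have h5 := jump_sum dP (ltW eta0) tT tb h1 h2.
  rewrite big_split/=; set c := \sum_k _; set w := \sum_k _.
  have dz : D t (u t) (defect n t) = D t (u t) (tube (x n) t - X t) - w.
    rewrite (tube_eq tT (ltW h3)) /defect linearB linear_sum; congr (_ - _).
    by apply: eq_bigr => k _; rewrite linearZ.
  have h6 : `|D t (u t) (defect n t)| <= Lp * `|defect n t|.
    rewrite (le_trans (blin_bound _ _))// ler_wpM2r//.
    by apply: (reg_norm H phir Lp0 phil); exact: (set_uM H).
  set p1 := phi t _ (ua _ _) in h5 *; set p2 := phi t (X t) (u t).
  set p3 := phi t _ (u t) in h5.
  have -> : p1 - p2 - (c + w) = D t (u t) (defect n t)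
      + (remainder u X phi D (fun n => tube (x n)) n t + (p1 - p3 - c)).
    rewrite dz /remainder -/p2 -/p3 addrA [X in _ = X + _]addrC subrKA.
    by rewrite [RHS]addrC addrACA subrKA opprD.
  rewrite (le_trans (ler_normD _ _))// lerD// (le_trans (ler_normD _ _))// lerD//.
- move=> t tT; have /andP[q1 q2] := Qmono n t tT; 
  have q3 : 0 <= 2 * eta * ramps (a n) t by rewrite mulr_ge0 ?ramps_ge0// mulr_ge0// ltW.
  rewrite (addr_ge0 q1 q3)/=.
  have h5 : 2 * eta * ramps (a n) t <= e / 2 * s n.
    have h6 := le_trans (ramps_le tk t (a_ge0 n)) (sum_needles_le n).
    have h7 : N%:R * B * s n <= A * s n by rewrite ler_pM2r// lerDl.
    rewrite (le_trans (ler_wpM2l _ (le_trans h6 h7)))//; first by rewrite mulr_ge0// ltW.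
    by rewrite mulrA ler_pM2r// /eta mulrA divfK ?gt_eqF//; lra.
  rewrite (le_trans (lerD (le_trans q2 h4) h5))// -mulrDl -splitr//.
Qed.

Lemma is_derive_needle_sum n t : t \notin breaks (a n) ->
  (forall k, is_derive t 1 (psi k) (D t (u t) (y k t))) ->
  is_derive t 1 (fun t => \sum_k ramp (nbeg (a n) k) (nend (a n) k) t *: psi k t)
    (\sum_k (bump (a n) k t *: psi k t
      + ramp (nbeg (a n) k) (nend (a n) k) t *: D t (u t) (y k t))).
Proof.
move=> tb dpsi; have [_ sb se] := notin_breaks tb.
apply: (@is_derive_sum _ _ _ _ (fun k t => ramp (nbeg (a n) k) (nend (a n) k) t *: psi k t)).
move=> k; apply: is_derive_scale => //; apply: is_derive_ramp => //.
exact: nbeg_le_end.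
Qed.

Lemma needle_sum_continuous n :
  continuous (fun t => \sum_k ramp (nbeg (a n) k) (nend (a n) k) t *: psi k t).
Proof.
apply: (@continuous_sum _ _ _ _ (fun k t => ramp (nbeg (a n) k) (nend (a n) k) t *: psi k t)).
by move=> k t'; apply: cvgZ; [exact: ramp_continuous|exact: cpsi].
Qed.

(** The defect is already known to be small, so it suffices to integrate the increment estimate:
    Gronwall is called with constant 0. *)
Lemma expansion_cost (w : nat -> R -> F) e :
  (forall k t, t \notin S -> is_derive t 1 (psi k) (D t (u t) (y k t))) ->
  (forall n, continuous (w n)) -> (forall n, w n 0 = 0) ->
  (forall n t, 0 < t < T -> t \notin breaks (a n) ->
    is_derive t 1 (w n) (phi t (tube (x n) t) (ua (a n) t) - phi t (X t) (u t))) ->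
  (forall e, 0 < e -> exists n0, forall n, (n0 <= n)%N ->
    forall t, 0 <= t <= T -> `|defect n t| <= e * s n) ->
  0 < e -> exists n0, forall n, (n0 <= n)%N ->
    `|w n T - \sum_k a n k *: psi k T| <= e * s n.
Proof.
move=> dpsi cw w0 dw small e0.
pose b := Lp * T + 1; have b0 : 0 < b by rewrite ltr_wpDl// mulr_ge0// ltW.
have [n1 n1P] := small _ (divr_gt0 (divr_gt0 e0 (ltr0n R 2)) b0).
have [n2 n2P] := increment_estimate (divr_gt0 e0 (ltr0n R 2)).
exists (maxn n1 n2) => n; rewrite geq_max => /andP[/n1P h1 /n2P[g [G [cG G0 dG est Gs]]]].
set e' := e / 2 / b in h1; have e'0 : 0 <= e' by rewrite !divr_ge0// ltW.
have TT : 0 <= T <= T by rewrite ltW//=.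
have c0 : 0 <= Lp * (e' * s n) := mulr_ge0 Lp0 (mulr_ge0 e'0 (ltW (s_gt0 n))).
have -> : \sum_k a n k *: psi k T =
    \sum_k ramp (nbeg (a n) k) (nend (a n) k) T *: psi k T.
  apply: eq_bigr => k _; have [_ aT _] := afit n.
  by rewrite ramp_after ?nbeg_le_end ?(ltW (aT k))// /nend addrAC subrr add0r.
have := @gronwall_int _ _ (breaks (a n))
  (fun t => w n t - \sum_k ramp (nbeg (a n) k) (nend (a n) k) t *: psi k t)
  (fun t => Lp * (e' * s n) * t + G t) (fun t => Lp * (e' * s n) + g t) 0 T (ltW T0) (lexx 0).
rewrite mul0r expR0 mulr1 => /(_ _ _ _ _ _)/le_trans; apply.
- by move=> t; apply: cvgB; [exact: cw|exact: needle_sum_continuous].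
- by move=> t; apply: cvgD; [apply: cvgM; [exact: cvg_cst|exact: cvg_id]|exact: cG].
- move=> t tT tb; have [tS _ _] := notin_breaks tb; have [dGt g0] := dG t tT tb.
  have tT' : 0 <= t <= T by have /andP[t1 t2] := tT; rewrite !ltW.
  eexists; split.
  + apply: is_derive_sub; first exact: dw.
    by apply: is_derive_needle_sum => // k; exact: dpsi.
  + apply: is_deriveD => //.
    apply: (is_derive_eq (is_derive_mulr (is_derive_const (Lp * (e' * s n)) t) (is_derive_id t 1))).
    by rewrite mul0r add0r mulr1.
  + by rewrite addr_ge0.
  + have /andP[G1 _] := Gs t tT'; have /andP[t0 _] := tT'.
    by rewrite addr_ge0// mulr_ge0.
  + rewrite mul0r add0r (le_trans (est t tT tb))// lerD2r ler_wpM2l// h1//.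
- rewrite w0 big1 ?subrr// => k _; rewrite (ramp0 tkT) ?scale0r//.
- by rewrite mulr0 G0 addr0.
have /andP[_ h2] := Gs T TT.
have -> : e * s n = e / 2 * s n + e / 2 * s n by rewrite -mulrDl -splitr.
rewrite lerD// mulrAC mulrA ler_pM2r// /e' mulrA ler_pdivrMr// mulrC ler_pM2l ?divr_gt0//.
by rewrite lerDl.
Qed.

End Integrand.

(** For the dynamics itself [psi] is [y], and the increment estimate becomes a differential
    inequality for the defect, closed by Gronwall. *)
Lemma expansion_state e :
  (forall k t, t \notin S -> is_derive t 1 (y k) (Df t (u t) (y k t))) ->
  (forall k, y k (tk k) = f (tk k) (X (tk k)) (vk k) - f (tk k) (X (tk k)) (u (tk k))) ->
  0 < e -> exists n0, forall n, (n0 <= n)%N ->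
    forall t, 0 <= t <= T -> `|defect n t| <= e * s n.
Proof.
move=> dy y_tk e0; pose b := expR (L * T); have b0 : 0 < b by rewrite expR_gt0.
have fl t zeta xi xi' (Mz : M zeta) (h1 : `|xi - X t| <= r) (h2 : `|xi' - X t| <= r) :=
  (set_lip H Mz h1 h2).2.
have L0 := set_L0 H.
have [n0 n0P] := increment_estimate (set_reg H) L0 fl cy y_tk (divr_gt0 e0 b0).
exists n0 => n /n0P[g [G [cG G0 dG est Gs]]] t tT; have /andP[t0 t1] := tT.
have [cx x0 dx] := xtraj n.
have := @gronwall_int _ _ (breaks (a n)) (defect n) G g L t t0 L0.
move=> /(_ _ _ _ _ _)/le_trans; apply => //.
- exact: defect_continuous.
- move=> t' /andP[t'0 t't] tb; have [tS _ _] := notin_breaks tb.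
  have tT' : 0 < t' < T by rewrite t'0 (lt_le_trans t't).
  have [dGt g0] := dG t' tT' tb; eexists; split.
  + apply: is_derive_sub.
      by apply: is_derive_sub; [exact: dx|exact: (set_ode H)].
    by apply: (is_derive_needle_sum tb) => k; exact: dy.
  + exact: dGt.
  + exact: g0.
  + by have /andP[] := Gs t' ltac:(by have /andP[h1 h2] := tT'; rewrite !ltW).
  + exact: est.
- exact: defect0.
have /andP[G1 G2] := Gs t tT.
rewrite (le_trans (ler_wpM2r (expR_ge0 _) G2))// mulrAC ler_pM2r//.
rewrite mulrAC ler_pdivrMr// ler_pM2l// ler_expR ler_wpM2l//.
Qed.

End Needles.

(** Supplies the compact set of directions for Hadamard differentiability: needle lengths divided by
    [s n] stay in [[0, B]]. *)
Lemma compact_combinations {R : realType} {V : normedModType R} (I : Type) (r : seq I)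
    (y : I -> V) (C : R) : exists2 K, compact K &
  forall c : I -> R, (forall i, 0 <= c i <= C) -> K (\sum_(i <- r) c i *: y i).
Proof.
elim: r => [|i r [K cK KP]].
  by exists [set 0]; [exact: compact_set1|move=> c _; rewrite big_nil].
exists [set z.1 *: y i + z.2 | z in `[0, C]%classic `*` K].
  apply: continuous_compact; last by apply: compact_setX => //; exact: segment_compact.
  apply: continuous_subspaceT => z; apply: cvgD; last exact: snd_continuous.
  by apply: cvgZr_tmp; exact: fst_continuous.
move=> c cC; exists (c i, \sum_(i <- r) c i *: y i); last by rewrite big_cons.
by split=> /=; [rewrite in_itv/= cC|exact: KP].
Qed.

Lemma continuous_blin_apply {R : realType} {V W : normedModType R} (p : R -> blin V W) (y : R ->
  V) :
  continuous p -> continuous y -> continuous (fun t => p t (y t)).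
Proof.
move=> cp cy t; apply/continuous_epsP => e e0.
have := within_blin (within_continuous (A := setT) cp) (within_continuous (A := setT) cy).
by move=> /within_epsP/(_ t I e e0)[d d0 dP]; exists d => // s; exact: dP.
Qed.

Lemma adjoint_cadlag {R : realType} {E : completeNormedModType R} {Y : normedModType R}
    (S : seq R) (U : set Y) (u : R -> Y) (D : R -> Y -> blin E R) (Df : R -> Y -> blin E E) p :
  cadlag S U u -> {within setT `*` U, continuous (fun z : R * Y => D z.1 z.2)} ->
  {within setT `*` U, continuous (fun z : R * Y => Df z.1 z.2)} -> continuous p ->
  cadlag S setT (fun t => - (D t (u t) + blin_comp (p t) (Df t (u t)))).
Proof.
move=> ucad cD cDf cp; apply: (@cadlag_comp _ _ _ _ U u
  (fun z : R * Y => - (D z.1 z.2 + blin_comp (p z.1) (Df z.1 z.2)))) ucad.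
move=> z; apply: cvgN; move: z; apply: within_add => //.
apply: within_blin_comp => //; apply: within_continuous => z.
by apply: (@continuous_comp _ _ _ fst p); [exact: fst_continuous|exact: cp].
Qed.

(** * Adjoint arcs and the variation of a functional *)

Section Variation.
Context {R : realType} {E : completeNormedModType R} {Y : normedModType R}.
Variables (T : R) (Om : set E) (U : set Y) (S : seq R) (u : R -> Y) (X : R -> E).
Variables (f : R -> E -> Y -> E) (Df : R -> Y -> blin E E) (M : set Y) (r L : R).
Hypothesis H : setting T Om U S u X f Df M r L.
Variables (phi : R -> E -> Y -> R) (D : R -> Y -> blin E R) (Lp : R).
Hypothesis phir : reg Om U X phi D.
Hypothesis Lp0 : 0 <= Lp.
Hypothesis phil : forall t zeta xi xi', M zeta -> `|xi - X t| <= r -> `|xi' - X t| <= r ->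
  `|phi t xi zeta - phi t xi' zeta| <= Lp * `|xi - xi'|.

Let fl t zeta xi xi' (Mz : M zeta) (h1 : `|xi - X t| <= r) (h2 : `|xi' - X t| <= r) :=
  (set_lip H Mz h1 h2).2.
Let L0 := set_L0 H.
Let T0 := set_T0 H.
Let r0 := set_r0 H.

Definition adjoint (p : R -> blin E R) := continuous p /\ forall t, t \notin S ->
  is_derive t 1 p (- (D t (u t) + blin_comp (p t) (Df t (u t)))).

Lemma adjoint_exists (pT : blin E R) : exists2 p, adjoint p & p T = pT.
Proof.
pose rhs t q := - (D t (u t) + blin_comp q (Df t (u t))).
have lip t q q' : `|rhs t q - rhs t q'| <= L * `|q - q'|.
  rewrite /rhs opprK opprD addrACA addNr add0r.
  have -> : - blin_comp q (Df t (u t)) + blin_comp q' (Df t (u t))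
      = blin_comp (q' - q) (Df t (u t)).
    by apply: blin_ext => h; rewrite blin_addE blin_oppE !blin_compE blin_addE blin_oppE addrC.
  rewrite (le_trans (blin_comp_norm _ _))// mulrC distrC ler_wpM2r//.
  by apply: (reg_norm H (set_reg H) L0 fl); exact: (set_uM H).
have prim p : continuous p -> exists G : R -> blin E R,
    continuous G /\ forall t, t \notin S -> is_derive t 1 G (rhs t (p t)).
  by move=> cp; have [G [cG dG]] := pwc_primitive (cadlag_pwc
    (adjoint_cadlag (set_u H) (reg_Dcont phir) (reg_Dcont (set_reg H)) cp)); exists G.
by have [p [cp pTE dp]] := ode_global_solution L0 lip prim T pT; exists p.
Qed.

(* The pairing of the adjoint arc with a linearized arc, completed by the running
   cost of the latter, does not depend on time. *)
Lemma adjoint_pairing p (y : R -> E) (psi : R -> R) t : adjoint p -> 0 <= t <= T ->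
  continuous y -> continuous psi ->
  (forall t, t \notin S -> is_derive t 1 y (Df t (u t) (y t))) ->
  (forall t, t \notin S -> is_derive t 1 psi (D t (u t) (y t))) ->
  p T (y T) + psi T = p t (y t) + psi t.
Proof.
move=> [cp dp] /andP[_ tT] cy cpsi dy dpsi.
have cpy : continuous (fun t => p t (y t) + psi t).
  by move=> s; apply: cvgD; [exact: continuous_blin_apply|exact: cpsi].
have cc : continuous ((fun=> 0) : R -> R) by move=> s; exact: cvg_cst.
have := @same_derivative _ _ S (fun t => p t (y t) + psi t) (fun=> 0) t T tT cpy cc.
rewrite subrr => /(_ _)/eqP; rewrite subr_eq0 => h; apply/eqP; apply: h.
move=> s _ sS; exists 0; last exact: is_derive_const.
apply: (is_derive_eq (is_deriveD (is_derive_blin_apply (dp s sS) (dy s sS)) (dpsi s sS))).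
by rewrite blin_oppE blin_addE blin_compE opprD subrK addNr.
Qed.

Section Sequence.
Context {N : nat}.
Variables (tk : 'I_N -> R) (vk : 'I_N -> Y).
Hypothesis tkT : forall k, 0 <= tk k < T.
Hypothesis vM : forall k, M (vk k).

Notation ua := (needled u tk vk).
Notation breaks := (breaks S tk).
Notation fit := (fit T tk).
Notation traj := (traj S u X f r tk vk).

Variables (s : nat -> R) (B : R) (a : nat -> 'I_N -> R) (x : nat -> R -> E).
Hypotheses (s_gt0 : forall n, 0 < s n) (s_to0 : tends0 s) (B0 : 0 <= B).
Hypotheses (afit : forall n, fit (a n)) (aB : forall n k, a n k <= B * s n).
Hypothesis xtraj : forall n, traj (a n) (x n).
Hypothesis xclose : forall n t, 0 <= t <= T -> `|x n t - X t| <= B * s n.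

(** The quotient of [x n T - X T] by [s n] approaches the combination of the [y k T] with
    coefficients [a n k / s n], which stays in a compact set, as [Hdiff_sequence] requires. *)
Lemma endpoint_expansion (y : 'I_N -> R -> E) (G : E -> R) (LG : blin E R) e :
  is_Hdiff G (X T) LG ->
  (forall e, 0 < e -> exists n0, forall n, (n0 <= n)%N -> `|defect X tk a x y n T| <= e * s n) ->
  0 < e -> exists n0, forall n, (n0 <= n)%N ->
    `|G (x n T) - G (X T) - \sum_k a n k * LG (y k T)| <= e * s n.
Proof.
move=> GL small e0.
have [K cK KP] := compact_combinations (index_enum 'I_N) (fun k => y k T) B.
pose h n := (s n)^-1 *: (x n T - X T).
pose k n := \sum_k (a n k / s n) *: y k T.
have defE n : defect X tk a x y n T = x n T - X T - \sum_k a n k *: y k T.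
  rewrite /defect; congr (_ - _); apply: eq_bigr => j _; have [a0 aT _] := afit n.
  by rewrite ramp_after ?nbeg_le_end ?(ltW (aT j))// /nend addrAC subrr add0r.
have Kk n : K (k n).
  apply: KP => j; have [a0 _ _] := afit n.
  by rewrite divr_ge0 ?(ltW (s_gt0 n))//= ler_pdivrMr.
have hk n : h n - k n = (s n)^-1 *: defect X tk a x y n T.
  rewrite defE scalerBr scaler_sumr; congr (_ - _); apply: eq_bigr => j _.
  by rewrite scalerA mulrC.
have hk0 : tends0 (fun n => `|h n - k n|).
  move=> e' e'0; have [n0 n0P] := small e' e'0; exists n0 => n /n0P le_n.
  by rewrite normr_id hk normrZ gtr0_norm ?invr_gt0// ler_pdivrMl// mulrC.
have e20 : 0 < e / 2 by rewrite divr_gt0.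
have [n1 n1P] := Hdiff_sequence GL cK Kk hk0 s_gt0 s_to0 e20.
have c0 : 0 < `|LG| + 1 by rewrite ltr_wpDl.
have [n2 n2P] := small _ (divr_gt0 e20 c0).
exists (maxn n1 n2) => n; rewrite geq_max => /andP[/n1P h1 /n2P h2].
have sh : s n *: h n = x n T - X T by rewrite /h scalerA mulfV ?gt_eqF// scale1r.
have Lh : s n *: LG (h n) = LG (x n T - X T) by rewrite -linearZ/= sh.
rewrite sh (addrC (X T)) subrK Lh in h1.
have dL : LG (x n T - X T) = LG (defect X tk a x y n T) + \sum_k a n k * LG (y k T).
  have -> : \sum_k a n k * LG (y k T) = LG (\sum_k a n k *: y k T).
    by rewrite linear_sum; apply: eq_bigr => j _; rewrite linearZ.
  by rewrite defE -linearD subrK.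
have h3 : `|LG (defect X tk a x y n T)| <= e / 2 * s n.
  rewrite (le_trans (blin_bound _ _))// (le_trans (ler_wpM2l _ h2))//.
  rewrite mulrA ler_pM2r// mulrCA -[leRHS]mulr1 ler_pM2l// mulrC ler_pdivrMl//.
  by rewrite mulr1 lerDl.
rewrite dL opprD addrA addrAC in h1.
have -> : e * s n = e / 2 * s n + e / 2 * s n by rewrite -mulrDl -splitr.
set q := _ - _ - _; rewrite -[q](subrK (LG (defect X tk a x y n T))).
by rewrite (le_trans (ler_normD _ _))// lerD.
Qed.

(** The endpoint contributes [p T (y k T)] and the running cost [psi k T]; [adjoint_pairing]
    evaluates their sum at [tk k], where it is the effect of the needle. *)
Lemma variation p (G : E -> R) e : is_Hdiff G (X T) (p T) -> adjoint p -> 0 < e ->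
  exists n0, forall n, (n0 <= n)%N ->
  `|(G (x n T) + \int[lebesgue_measure]_(t in `[0, T]) phi t (x n t) (ua (a n) t))
    - (G (X T) + \int[lebesgue_measure]_(t in `[0, T]) phi t (X t) (u t))
    - \sum_k a n k * (p (tk k) (f (tk k) (X (tk k)) (vk k) - f (tk k) (X (tk k)) (u (tk k)))
        + (phi (tk k) (X (tk k)) (vk k) - phi (tk k) (X (tk k)) (u (tk k))))| <= e * s n.
Proof.
move=> Gp pA e0.
have exy k : exists y : R -> E, [/\ continuous y,
    y (tk k) = f (tk k) (X (tk k)) (vk k) - f (tk k) (X (tk k)) (u (tk k)) &
    forall t, t \notin S -> is_derive t 1 y (Df t (u t) (y t))].
  apply: (@ode_global_solution R E S (fun t => Df t (u t)) L L0).
    move=> t z z'; rewrite -linearB (le_trans (blin_bound _ _))// ler_wpM2r//.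
    by apply: (reg_norm H (set_reg H) L0 fl); exact: (set_uM H).
  move=> z cz; have [G' [cG dG]] := pwc_primitive (cadlag_pwc (linearized_cadlag H (set_reg H) cz)).
  by exists G'.
have [y yP] := choice exy.
have cy k : continuous (y k) by case: (yP k).
have y_tk k : y k (tk k) = f (tk k) (X (tk k)) (vk k) - f (tk k) (X (tk k)) (u (tk k)).
  by case: (yP k).
have dy k t : t \notin S -> is_derive t 1 (y k) (Df t (u t) (y k t)).
  by case: (yP k) => _ _; apply.
have expsi (k : 'I_N) := linearized_primitive H phir (tk k)
  (phi (tk k) (X (tk k)) (vk k) - phi (tk k) (X (tk k)) (u (tk k))) (cy k).
have [psi psiP] := choice expsi.
have cpsi k : continuous (psi k) by case: (psiP k).
have psi_tk k : psi k (tk k) =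
    phi (tk k) (X (tk k)) (vk k) - phi (tk k) (X (tk k)) (u (tk k)) by case: (psiP k).
have dpsi k t : t \notin S -> is_derive t 1 (psi k) (D t (u t) (y k t)).
  by case: (psiP k) => _ _; apply.
have small e' := expansion_state H tkT vM s_gt0 s_to0 B0 afit aB xtraj xclose cy dy y_tk (e := e').
have TT : 0 <= T <= T by rewrite ltW//=.
have smallT e' : 0 < e' -> exists n0, forall n, (n0 <= n)%N -> `|defect X tk a x y n T| <= e' * s n.
  by move=> /small[n0 n0P]; exists n0 => n /n0P; apply.
have e20 : 0 < e / 2 by rewrite divr_gt0.
have [n1 n1P] := endpoint_expansion Gp smallT e20.
have cx n : continuous (x n) by case: (xtraj n).
have jc n := reg_joint_cont phir (tube_continuous H (cx n)) (tube_Om H (x n)).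
have cad n := cadlag_comp (jc n) (ua_cadlag H vM (afit n)).
have cad0 := cadlag_comp (reg_joint_cont phir (set_X H) (set_XOm H)) (set_u H).
have exW n : exists W : R -> R, [/\ continuous W, W 0 = 0 & forall t, t \notin breaks (a n) ->
    is_derive t 1 W (phi t (tube X r (x n) t) (ua (a n) t))].
  have [W [cW dW]] := pwc_primitive (cadlag_pwc (cad n)).
  exists (fun t => - W 0 + W t); split; last by move=> t /dW dt; exact: is_derive_addl.
  - by move=> t; apply: cvgD; [exact: cvg_cst|exact: cW].
  - by rewrite addNr.
have [W WP] := choice exW.
have [W0 [cW0 dW0]] := pwc_primitive (cadlag_pwc cad0).
have iW0 : \int[lebesgue_measure]_(t in `[0, T]) phi t (X t) (u t) = W0 T - W0 0.
  by apply: pwc_FTC (cadlag_pwc cad0) cW0 _ => // t _; exact: dW0.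
pose w n t := W n t - (W0 t - W0 0).
have cw n : continuous (w n).
  have [cW _ _] := WP n => t; apply: cvgB; first exact: cW.
  by apply: cvgB; [exact: cW0|exact: cvg_cst].
have w0 n : w n 0 = 0 by have [_ h _] := WP n; rewrite /w h !subrr.
have dw n t : 0 < t < T -> t \notin breaks (a n) ->
    is_derive t 1 (w n) (phi t (tube X r (x n) t) (ua (a n) t) - phi t (X t) (u t)).
  move=> _ tb; have [tS _ _] := notin_breaks tb; have [_ _ dW] := WP n.
  by apply: is_derive_sub; [exact: dW|apply: is_derive_subr; exact: dW0].
have [n2 n2P] := expansion_cost H tkT vM s_gt0 s_to0 B0 afit aB xtraj xclose phir Lp0 phil
  cpsi psi_tk dpsi cw w0 dw small e20.
have B1 : 0 < B + 1 by rewrite ltr_wpDl.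
(* From this rank on trajectories stay in the tube, so the cost along [x n] is the one computed with
   [tube]. *)
have [n3 n3P] := s_to0 (divr_gt0 r0 B1).
exists (maxn (maxn n1 n2) n3) => n; rewrite !geq_max => /andP[/andP[/n1P h1 /n2P h2] /n3P].
rewrite gtr0_norm// => h3.
have Br : B * s n <= r.
  rewrite (@le_trans _ _ ((B + 1) * s n))//; first by rewrite ler_pM2r// lerDl.
  by rewrite mulrC -ler_pdivlMr.
have iW : \int[lebesgue_measure]_(t in `[0, T]) phi t (x n t) (ua (a n) t) = W n T.
  have [cW W00 dW] := WP n.
  transitivity (W n T - W n 0); last by rewrite W00 subr0.
  rewrite -(pwc_FTC T0 (cadlag_pwc (cad n)) cW (fun t _ => dW t)).
  apply: eq_Rintegral => t; rewrite inE/= in_itv/= => tT.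
  by rewrite (tube_eq H xclose tT Br).
rewrite iW iW0.
have -> : \sum_k a n k * (p (tk k) (f (tk k) (X (tk k)) (vk k) - f (tk k) (X (tk k)) (u (tk k)))
        + (phi (tk k) (X (tk k)) (vk k) - phi (tk k) (X (tk k)) (u (tk k))))
    = \sum_k a n k * p T (y k T) + \sum_k a n k *: psi k T.
  rewrite -big_split/=; apply: eq_bigr => k _; rewrite -y_tk -psi_tk.
  have /andP[t1 t2] := tkT k.
  by rewrite -(adjoint_pairing pA _ (cy k) (cpsi k) (dy k) (dpsi k)) ?mulrDr// t1 ltW.
set q1 := \sum_k _; set q2 := \sum_k _ *: _.
rewrite (_ : _ - _ - _ = (G (x n T) - G (X T) - q1) + (w n T - q2)); last by rewrite /w; ring.
have -> : e * s n = e / 2 * s n + e / 2 * s n by rewrite -mulrDl -splitr.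
by rewrite (le_trans (ler_normD _ _))// lerD.
Qed.

End Sequence.
End Variation.

(** * Multipliers *)

Section Multipliers.
Context {R : realType} {l m q : nat} {Nd : Type}.
Notation J := ('I_l + 'I_m + 'I_q)%type.
Variables (valid : set Nd) (w : J -> Nd -> R) (active : pred 'I_m).

(** Slacks are free on inactive inequalities: their multipliers must vanish, and in the dense case
    nothing is asked of them. *)
Definition slack (gamma : J -> R) := [/\ forall i, 0 <= gamma (inl (inl i)),
  forall a, active a -> 0 <= gamma (inl (inr a)) & forall b, gamma (inr b) = 0].

Definition needle_cone : set 'rV[R]_#|{: J}| := [set k | exists (I : finType) (c : I -> R)
  (nd : I -> Nd) (gamma : J -> R), [/\ forall i, 0 <= c i, forall i, valid (nd i), slack gamma &
    forall j, k 0 (enum_rank j) = \sum_i c i * w j (nd i) - gamma j]].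

Lemma needle_coneD k k' : needle_cone k -> needle_cone k' -> needle_cone (k + k').
Proof.
move=> [I [c [nd [ga [c0 ndv [g1 g2 g3] kE]]]]] [I' [c' [nd' [ga' [c0' ndv' [g1' g2' g3'] kE']]]]].
exists (I + I')%type, (fun s => match s with inl i => c i | inr i => c' i end),
  (fun s => match s with inl i => nd i | inr i => nd' i end), (fun j => ga j + ga' j); split.
- by case.
- by case.
- split=> [i|a aa|b]; first by rewrite addr_ge0.
  + by rewrite addr_ge0 ?g2 ?g2'.
  + by rewrite g3 g3' addr0.
by move=> j; rewrite mxE kE kE' big_sumType/= opprD addrACA.
Qed.

Lemma needle_coneZ x k : 0 <= x -> needle_cone k -> needle_cone (x *: k).
Proof.
move=> x0 [I [c [nd [ga [c0 ndv [g1 g2 g3] kE]]]]].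
exists I, (fun i => x * c i), nd, (fun j => x * ga j); split=> // [i||j].
- by rewrite mulr_ge0.
- split=> [i|a aa|b]; first by rewrite mulr_ge0.
  + by rewrite mulr_ge0// g2.
  + by rewrite g3 mulr0.
rewrite mxE kE mulrBr mulr_sumr; congr (_ - _).
by apply: eq_bigr => i _; rewrite mulrA.
Qed.

Lemma dotr_enum (c k : 'rV[R]_#|{: J}|) :
  dotr c k = \sum_j c 0 (enum_rank j) * k 0 (enum_rank j).
Proof.
rewrite /dotr (reindex_onto enum_rank enum_val)/= => [|r _]; last by rewrite enum_valK.
by apply: eq_bigl => j; rewrite enum_rankK eqxx.
Qed.

Lemma slack_cone gamma : slack gamma -> needle_cone (\row_r - gamma (enum_val r)).
Proof.
move=> sg; exists void, (fun=> 0), (of_void Nd), gamma; split=> // j.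
by rewrite mxE enum_rankK big1 ?sub0r// => -[].
Qed.

(** Either some target stays at positive distance from the cone and is separated from it, or every
    target is approximated. Tested on pure slacks, the separating vector yields the signs of the
    multipliers; tested on single needles, the maximum condition. *)
Lemma multiplier_or_dense :
  (exists (theta : 'rV[R]_l) (lambda : 'rV[R]_m) (mu : 'rV[R]_q),
    [/\ (theta, lambda, mu) != 0, forall i, 0 <= theta 0 i, forall a, 0 <= lambda 0 a,
        forall a, ~~ active a -> lambda 0 a = 0 &
        forall nd, valid nd -> \sum_i theta 0 i * w (inl (inl i)) nd
          + \sum_a lambda 0 a * w (inl (inr a)) nd + \sum_b mu 0 b * w (inr b) nd <= 0]) \/
  forall (y : J -> R) (e : R), 0 < e -> exists (N : nat) (c : 'I_N -> R) (nd : 'I_N -> Nd),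
    [/\ forall i, 0 <= c i, forall i, valid (nd i),
        forall i, y (inl (inl i)) - e <= \sum_k c k * w (inl (inl i)) (nd k),
        forall a, active a -> y (inl (inr a)) - e <= \sum_k c k * w (inl (inr a)) (nd k) &
        forall b, `|\sum_k c k * w (inr b) (nd k) - y (inr b)| <= e].
Proof.
pose yv (y : J -> R) : 'rV[R]_#|{: J}| := \row_r y (enum_val r).
have [[y [e [e0 far]]]|dense] := pselect (exists (y : J -> R) (e : R),
    0 < e /\ forall k, needle_cone k -> exists r, e <= `|k 0 r - yv y 0 r|); [left|right].
  have K0 : needle_cone 0.
    have -> : (0 : 'rV[R]_#|{: J}|) = \row_r - (fun=> 0) (enum_val r : J).
      by apply/rowP => r; rewrite !mxE oppr0.
    by apply: (@slack_cone (fun=> 0)); split.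
  have [c c_neq0 cP] := cone_separation e0 K0 needle_coneD needle_coneZ far.
  have cslack gamma : slack gamma -> 0 <= \sum_j c 0 (enum_rank j) * gamma j.
    move=> /slack_cone/cP; rewrite dotr_enum -oppr_ge0 -sumrN => h.
    rewrite (le_trans h)// le_eqVlt; apply/orP; left; apply/eqP; apply: eq_bigr => j _.
    by rewrite mxE enum_rankK mulrN opprK.
  have cdelta (j : J) (x : R) : slack (fun j' => (j' == j)%:R * x) -> 0 <= c 0 (enum_rank j) * x.
    move=> /cslack; rewrite (bigD1 j)//= eqxx mul1r big1 ?addr0// => j' /negbTE ->.
    by rewrite mul0r mulr0.
  exists (\row_i c 0 (enum_rank (inl (inl i) : J))), (\row_a c 0 (enum_rank (inl (inr a) : J))),
    (\row_b c 0 (enum_rank (inr b : J))); split.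
  - apply: contra c_neq0 => /eqP[/rowP c1 /rowP c2 /rowP c3]; apply/eqP/rowP => r.
    rewrite -(enum_valK r) mxE; case: (enum_val r) => [[i|a]|b].
    + by have := c1 i; rewrite !mxE.
    + by have := c2 a; rewrite !mxE.
    + by have := c3 b; rewrite !mxE.
  - move=> i; rewrite mxE -[leRHS]mulr1; apply: cdelta.
    by split=> [i'|a _|b]; rewrite ?mulr_ge0 ?ler0n//= mul0r.
  - move=> a; rewrite mxE -[leRHS]mulr1; apply: cdelta.
    by split=> [i'|a' _|b]; rewrite ?mulr_ge0 ?ler0n//= mul0r.
  - move=> a na; rewrite mxE; apply/eqP; rewrite eq_le -[X in X <= 0]opprK oppr_le0.
    have sl (x : R) : slack (fun j' => (j' == inl (inr a))%:R * x).
      split=> [i'|a'|b] //=; rewrite ?mul0r//; case: eqP => [[->]|_]; rewrite ?mul0r//.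
      by rewrite (negbTE na).
    by rewrite -mulrN1 cdelta//= -[leRHS]mulr1 cdelta.
  move=> nd ndv; have : needle_cone (\row_r w (enum_val r) nd).
    exists 'I_1, (fun=> 1), (fun=> nd), (fun=> 0); split=> //.
    by move=> j; rewrite mxE enum_rankK big_ord1 mul1r subr0.
  move=> /cP; rewrite dotr_enum; apply: le_trans; rewrite le_eqVlt; apply/orP; left; apply/eqP.
  transitivity (\sum_j c 0 (enum_rank j) * w j nd); last first.
    by apply: eq_bigr => j _; rewrite [X in _ = _ * X]mxE enum_rankK.
  by rewrite !big_sumType/=; congr (_ + _ + _); apply: eq_bigr => i _; rewrite mxE.
move=> y e e0; apply: contrapT => none; apply: dense; exists y, e; split=> //.
move=> k [I [c [nd [ga [c0 ndv [g1 g2 g3] kE]]]]]; apply: contrapT => near.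
have {}near j : `|\sum_i c i * w j (nd i) - ga j - y j| <= e.
  rewrite leNgt; apply/negP => far; apply: near; exists (enum_rank j).
  by rewrite kE mxE enum_rankK ltW.
have sumE j : \sum_(k < #|I|) c (enum_val k) * w j (nd (enum_val k)) = \sum_i c i * w j (nd i).
  by rewrite [RHS](reindex_onto enum_val enum_rank)//= => [|i _]; [apply: eq_bigl => i;
    rewrite enum_valK eqxx|rewrite enum_rankK].
apply: none; exists #|I|, (fun k => c (enum_val k)), (fun k => nd (enum_val k)); split=> //.
- move=> i; rewrite sumE; have := near (inl (inl i)); rewrite ler_norml => /andP[h _].
  by have := g1 i; lra.
- move=> a aa; rewrite sumE; have := near (inl (inr a)); rewrite ler_norml => /andP[h _].
  by have := g2 a aa; lra.
- by move=> b; rewrite sumE; have := near (inr b); rewrite g3 subr0.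
Qed.

End Multipliers.

Definition payoff {R : realType} {E Y : normedModType R} (T : R) (phi : R -> E -> Y -> R)
    (G : E -> R) (x : R -> E) (v : R -> Y) : R :=
  G (x T) + \int[lebesgue_measure]_(t in `[0, T]) phi t (x t) (v t).

Definition needle_effect {R : realType} {E Y : normedModType R} (f : R -> E -> Y -> E)
    (X : R -> E) (u : R -> Y) (phi : R -> E -> Y -> R) (p : R -> blin E R) (nd : R * Y) : R :=
  p nd.1 (f nd.1 (X nd.1) nd.2 - f nd.1 (X nd.1) (u nd.1))
  + (phi nd.1 (X nd.1) nd.2 - phi nd.1 (X nd.1) (u nd.1)).

Section UniformVariation.
Context {R : realType} {E : completeNormedModType R} {Y : normedModType R} {J : finType}.
Variables (T : R) (Om : set E) (U : set Y) (S : seq R) (u : R -> Y) (X : R -> E).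
Variables (f : R -> E -> Y -> E) (Df : R -> Y -> blin E E) (M : set Y) (r L : R).
Hypothesis H : setting T Om U S u X f Df M r L.
Variables (phi : J -> R -> E -> Y -> R) (D : J -> R -> Y -> blin E R) (Lp : J -> R).
Hypothesis phir : forall j, reg Om U X (phi j) (D j).
Hypothesis phil : forall j, 0 <= Lp j /\ forall t zeta xi xi', M zeta ->
  `|xi - X t| <= r -> `|xi' - X t| <= r ->
  `|phi j t xi zeta - phi j t xi' zeta| <= Lp j * `|xi - xi'|.
Variables (G : J -> E -> R) (p : J -> R -> blin E R).
Hypothesis Gp : forall j, is_Hdiff (G j) (X T) (p j T).
Hypothesis pA : forall j, adjoint S u Df (D j) (p j).
Context {N : nat}.
Variables (tk : 'I_N -> R) (vk : 'I_N -> Y).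
Hypothesis tkT : forall k, 0 <= tk k < T.
Hypothesis vM : forall k, M (vk k).
Context {Z : Type}.
Variables (s : nat -> R) (B : R) (a : nat -> Z -> 'I_N -> R).
Hypotheses (s_gt0 : forall n, 0 < s n) (s_to0 : tends0 s) (B0 : 0 <= B).
Hypotheses (afit : forall n z, fit T tk (a n z)) (aB : forall n z k, a n z k <= B * s n).
Hypothesis xclose : forall n z x, traj S u X f r tk vk (a n z) x ->
  forall t, 0 <= t <= T -> `|x t - X t| <= B * s n.

(** Uniformity in [z] by contradiction: failures at arbitrarily large ranks would form a sequence of
    lengths and trajectories to which [variation] applies. *)
Lemma uniform_variation e : 0 < e -> exists n0, forall n, (n0 <= n)%N -> forall z x,
  traj S u X f r tk vk (a n z) x -> forall j,
  `|payoff T (phi j) (G j) x (needled u tk vk (a n z)) - payoff T (phi j) (G j) X u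
    - \sum_k a n z k * needle_effect f X u (phi j) (p j) (tk k, vk k)| <= e * s n.
Proof.
move=> e0; apply: contrapT => none.
have bad n0 : exists w : nat * Z * (R -> E), [/\ (n0 <= w.1.1)%N,
    traj S u X f r tk vk (a w.1.1 w.1.2) w.2 & ~ forall j,
    `|payoff T (phi j) (G j) w.2 (needled u tk vk (a w.1.1 w.1.2)) - payoff T (phi j) (G j) X u
    - \sum_k a w.1.1 w.1.2 k * needle_effect f X u (phi j) (p j) (tk k, vk k)| <= e * s w.1.1].
  apply: contrapT => nobad; apply: none; exists n0 => n nn z x xt; apply: contrapT => bad.
  by apply: nobad; exists (n, z, x).
have [v vP] := choice bad.
have vn n : (n <= (v n).1.1)%N by case: (vP n).
have xt n : traj S u X f r tk vk (a (v n).1.1 (v n).1.2) (v n).2 by case: (vP n).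
have sv0 : tends0 (fun n => s (v n).1.1).
  by move=> e' /s_to0[n0 n0P]; exists n0 => n nn; apply: n0P; exact: leq_trans (vn n).
have [n0 n0P] := finite_rank (fun j => variation H (phir j) (phil j).1 (phil j).2 tkT vM
  (s := fun n => s (v n).1.1) (fun n => s_gt0 _) sv0 B0 (fun n => afit _ _) (fun n => aB _ _)
  xt (fun n => xclose (xt n)) (Gp j) (pA j) e0).
by have [_ _] := vP n0; apply; exact: n0P.
Qed.

End UniformVariation.

Lemma setting_exists {R : realType} {E : completeNormedModType R} {Y : normedModType R}
    {J : finType} (T : R) (Om : set E) (U : set Y) (S : seq R) (u : R -> Y) (X : R -> E)
    (f : R -> E -> Y -> E) (Df : R -> Y -> blin E E) (M : set Y)
    (phi : J -> R -> E -> Y -> R) (D : J -> R -> Y -> blin E R) :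
  0 < T -> T \notin S -> cadlag S U u -> continuous X -> (forall t, Om (X t)) ->
  (forall t, X (clamp 0 T t) = X t) -> (forall t, f (clamp 0 T t) = f t) ->
  reg Om U X f Df -> (forall t, 0 < t < T -> t \notin S -> is_derive t 1 X (f t (X t) (u t))) ->
  compact M -> M `<=` U -> (forall t, M (u t)) -> (forall j, reg Om U X (phi j) (D j)) ->
  exists (r L : R) (Lp : J -> R), setting T Om U S u X f Df M r L /\
    forall j, 0 <= Lp j /\ forall t zeta xi xi', M zeta ->
      `|xi - X t| <= r -> `|xi' - X t| <= r ->
      `|phi j t xi zeta - phi j t xi' zeta| <= Lp j * `|xi - xi'|.
Proof.
move=> T0 TS ucad cX XOm Xfr ffr fr dX cM MU uM phir.
have M0 : M !=set0 by exists (u 0).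
have [rf [L [rf0 L0 lipf]]] := reg_lip fr M0 cM MU.
have ex j : exists rL : R * R, [/\ 0 < rL.1, 0 <= rL.2 & forall t zeta xi xi', M zeta ->
      `|xi - X t| <= rL.1 -> `|xi' - X t| <= rL.1 ->
      Om xi /\ `|phi j t xi zeta - phi j t xi' zeta| <= rL.2 * `|xi - xi'|].
  by have [rj [Lj h]] := reg_lip (phir j) M0 cM MU; exists (rj, Lj).
have [rL rLP] := choice ex.
have rL0 j : 0 < (rL j).1 by case: (rLP j).
have [rp rp0 rpP] := finite_lower_bound rL0.
exists (Num.min rf rp), L, (fun j => (rL j).2); split.
  split=> //; first by rewrite lt_min rf0.
  by move=> t zeta xi xi' Mz; rewrite !le_min => /andP[h _] /andP[h' _]; exact: lipf.
move=> j; have [_ Lj lip] := rLP j; split=> // t zeta xi xi' Mz.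
rewrite !le_min => /andP[_ h] /andP[_ h'].
by have [_] := lip t zeta xi xi' Mz (le_trans h (rpP j)) (le_trans h' (rpP j)).
Qed.

(** * Realisation of prescribed directions *)

Section Targets.
Context {R : realType} {q : nat} {K : Type}.
Notation Sg := (option ('I_q * bool)).
Implicit Types (z : 'rV[R]_q) (sg : Sg) (b : 'I_q).

(* [None] pushes every cost and inequality upwards; [Some (b, s)] moves the
   equality constraint [b] in the direction of the sign [s]. *)
Definition target sg (j : K + 'I_q) : R := match sg, j with
  | None, inl _ => 1 | None, inr _ => 0 | Some _, inl _ => 0
  | Some (b, s), inr b' => if b == b' then (-1) ^+ (~~ s) else 0 end.

(** Positive and negative parts of the coordinates of [z]: with these nonnegative weights the
    targets add up to 1 on costs and inequalities and to [z 0 b] on equalities. *)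
Definition coef z sg : R := match sg with
  | None => 1 | Some (b, s) => Num.max ((-1) ^+ (~~ s) * z 0 b) 0 end.

Lemma coef_ge0 z sg : 0 <= coef z sg.
Proof. by case: sg => [[b s]|] //=; rewrite le_max lexx orbT. Qed.

Lemma coef_le1 z sg : cube z -> coef z sg <= 1.
Proof.
move=> zc; case: sg => [[b s]|] //=; have /andP[h1 h2] := zc b.
by rewrite ge_max ler01 andbT; case: s; rewrite /= ?mul1r// mulN1r lerNl.
Qed.

Lemma coef_lipschitz z z' sg (d : R) : 0 <= d -> (forall b, `|z 0 b - z' 0 b| <= d) ->
  `|coef z sg - coef z' sg| <= d.
Proof.
move=> d0 zd; case: sg => [[b s]|]; last by rewrite subrr normr0.
rewrite (le_trans (max_nonexpansive _ _ _))// -mulrBr normrM normrX normrN normr1 expr1n mul1r.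
exact: zd.
Qed.

Lemma sum_coef_le z : cube z -> \sum_sg coef z sg <= #|{: Sg}|%:R.
Proof.
move=> zc; apply: (@le_trans _ _ (\sum_(sg : Sg) 1)); last by rewrite sumr_const.
by apply: ler_sum => sg _; exact: coef_le1.
Qed.

Lemma sum_target_inl z j : \sum_sg coef z sg * target sg (inl j) = 1.
Proof. by rewrite (bigD1 None)//= mulr1 big1 ?addr0// => -[[b s]|] //= _; rewrite mulr0. Qed.

Lemma sum_target_inr z b : \sum_sg coef z sg * target sg (inr b) = z 0 b.
Proof.
have neq : Some (b, false) != Some (b, true) by apply/eqP => -[].
rewrite (bigD1 (Some (b, true)))//= (bigD1 (Some (b, false)) neq)/= !eqxx big1 ?addr0.
  rewrite /= expr0 expr1 mul1r mulr1 mulN1r mulrN1; case: (leP 0 (z 0 b)) => zb.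
    by rewrite (max_idPr _) ?oppr0 ?addr0// oppr_le0.
  by rewrite (max_idPl _) ?opprK ?add0r// oppr_ge0 ltW.
move=> [[b' s]|]; last by rewrite /= mulr0.
have [->|bb] := eqVneq b' b; last by rewrite /= (negbTE bb) mulr0.
by case: s; rewrite !eqxx ?andbF.
Qed.

Lemma combination_inl z (v : Sg -> R) (e : R) j : cube z ->
  (forall sg, target sg (inl j) - e <= v sg) -> 0 <= e ->
  1 - e * #|{: Sg}|%:R <= \sum_sg coef z sg * v sg.
Proof.
move=> zc vt e0; rewrite -[X in X - _](sum_target_inl z j).
apply: (@le_trans _ _ (\sum_sg coef z sg * (target sg (inl j) - e))); last first.
  by apply: ler_sum => sg _; rewrite ler_wpM2l// coef_ge0.
under [leRHS]eq_bigr do rewrite mulrBr.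
by rewrite sumrB lerB// -mulr_suml [leLHS]mulrC ler_wpM2l// sum_coef_le.
Qed.

Lemma combination_inr z (v : Sg -> R) (e : R) b : cube z ->
  (forall sg, `|v sg - target sg (inr b)| <= e) -> 0 <= e ->
  `|\sum_sg coef z sg * v sg - z 0 b| <= e * #|{: Sg}|%:R.
Proof.
move=> zc vt e0; rewrite -[in X in `|_ - X|](sum_target_inr z b) -sumrB.
rewrite (le_trans (ler_norm_sum _ _ _))//.
apply: (@le_trans _ _ (\sum_sg coef z sg * e)); last first.
  by rewrite -mulr_suml [leLHS]mulrC ler_wpM2l// sum_coef_le.
by apply: ler_sum => sg _; rewrite -mulrBr normrM ger0_norm ?coef_ge0// ler_wpM2l// coef_ge0.
Qed.

End Targets.

(** * Improvement of the reference pair in the dense case *)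

Section Improvement.
Context {R : realType} {E : completeNormedModType R} {Y : normedModType R} {l m q : nat}.
Notation J := ('I_l + 'I_m + 'I_q)%type.
Variables (T : R) (Om : set E) (U : set Y) (S : seq R) (u : R -> Y) (X : R -> E).
Variables (f : R -> E -> Y -> E) (Df : R -> Y -> blin E E) (M0 : set Y).
Hypotheses (T0 : 0 < T) (TS : T \notin S) (ucad : cadlag S U u) (cX : continuous X).
Hypotheses (XOm : forall t, Om (X t)) (Xfr : forall t, X (clamp 0 T t) = X t).
Hypotheses (ffr : forall t, f (clamp 0 T t) = f t) (fr : reg Om U X f Df).
Hypothesis dX : forall t, 0 < t < T -> t \notin S -> is_derive t 1 X (f t (X t) (u t)).
Hypotheses (cM0 : compact M0) (M0U : M0 `<=` U) (uM0 : forall t, M0 (u t)).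
Variables (phi : J -> R -> E -> Y -> R) (D : J -> R -> Y -> blin E R).
Hypothesis phir : forall j, reg Om U X (phi j) (D j).
Variables (G : J -> E -> R) (p : J -> R -> blin E R).
Hypothesis Gp : forall j, is_Hdiff (G j) (X T) (p j T).
Hypothesis pA : forall j, adjoint S u Df (D j) (p j).
Hypothesis payoffX : forall j x v, (if j is inl (inl _) then false else true) ->
  payoff T (phi j) (G j) x v = G j (x T).
Hypothesis Gineq : forall a, 0 <= G (inl (inr a)) (X T).
Hypothesis Geq : forall b, G (inr b) (X T) = 0.
Hypothesis Gcont : forall b, exists2 V, nbhs (X T) V & {within V, continuous (G (inr b))}.

Let valid : set (R * Y) := [set nd | 0 <= nd.1 < T /\ U nd.2].
Let w j nd := needle_effect f X u (phi j) (p j) nd.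

Hypothesis dense : forall (y : J -> R) (e : R), 0 < e ->
  exists (N : nat) (c : 'I_N -> R) (nd : 'I_N -> R * Y),
    [/\ forall i, 0 <= c i, forall i, valid (nd i),
        forall i, y (inl (inl i)) - e <= \sum_k c k * w (inl (inl i)) (nd k),
        forall a, G (inl (inr a)) (X T) == 0 ->
          y (inl (inr a)) - e <= \sum_k c k * w (inl (inr a)) (nd k) &
        forall b, `|\sum_k c k * w (inr b) (nd k) - y (inr b)| <= e].

Notation Sg := (option ('I_q * bool)).

(** Density is used for finitely many targets only, one for each [sg]; weights at most 1 then spread
    the approximation over the whole cube. *)
Lemma needle_directions : exists (I : finType) (sg : I -> Sg) (c : I -> R) (nd : I -> R * Y),
  [/\ forall i, 0 <= c i, forall i, valid (nd i) &
   forall z : 'rV[R]_q, cube z -> let V j := \sum_i coef z (sg i) * c i * w j (nd i) in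
     [/\ forall i, 7 / 8 <= V (inl (inl i)),
         forall a, G (inl (inr a)) (X T) == 0 -> 7 / 8 <= V (inl (inr a)) &
         forall b, `|V (inr b) - z 0 b| <= 1 / 8]].
Proof.
(* At most [#|Sg|] errors add up, to 1/8 in all. *)
pose e : R := (8 * #|{: Sg}|%:R)^-1.
have n0 : 0 < #|{: Sg}|%:R :> R by rewrite ltr0n; apply/card_gt0P; exists None.
have e0 : 0 < e by rewrite invr_gt0 mulr_gt0.
have en : e * #|{: Sg}|%:R = 1 / 8 by rewrite /e; field; rewrite gt_eqF.
have ex sg : exists W : {N : nat & (('I_N -> R) * ('I_N -> R * Y))%type},
    [/\ forall i, 0 <= (projT2 W).1 i, forall i, valid ((projT2 W).2 i),
        forall i, target sg (inl (inl i) : J) - e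
          <= \sum_k (projT2 W).1 k * w (inl (inl i)) ((projT2 W).2 k),
        forall a, G (inl (inr a)) (X T) == 0 -> target sg (inl (inr a) : J) - e
          <= \sum_k (projT2 W).1 k * w (inl (inr a)) ((projT2 W).2 k) &
        forall b, `|\sum_k (projT2 W).1 k * w (inr b) ((projT2 W).2 k) - target sg (inr b : J)|
          <= e].
  have [N [c [nd h]]] := dense (fun j => target sg j) e0.
  by exists (existT _ N (c, nd)).
have [W WP] := choice ex.
exists {sg : Sg & 'I_(projT1 (W sg))}, (fun i => tag i),
  (fun i => (projT2 (W (tag i))).1 (tagged i)), (fun i => (projT2 (W (tag i))).2 (tagged i)).
split=> [i|i|z zc V]; [by case: (WP (tag i))|by case: (WP (tag i))|].
have VE j : V j = \sum_sg coef z sg * \sum_k (projT2 (W sg)).1 k * w j ((projT2 (W sg)).2 k).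
  under eq_bigr do rewrite mulr_sumr.
  by rewrite sig_big_dep; apply: eq_bigr => i _; rewrite mulrA.
have e8 : (7 / 8 : R) = 1 - e * #|{: Sg}|%:R by rewrite en; field.
split=> [i|a aa|b]; rewrite VE.
- rewrite e8; apply: (combination_inl (j := inl i) zc) => [sg|]; last exact: ltW.
  by case: (WP sg).
- rewrite e8; apply: (combination_inl (j := inr a) zc) => [sg|]; last exact: ltW.
  by case: (WP sg) => _ _ _ h _; exact: h.
- rewrite -en; apply: (combination_inr (K := 'I_l + 'I_m) zc) => [sg|]; last exact: ltW.
  by case: (WP sg).
Qed.

(** At scale [s] the lengths [a s z] raise costs and active constraints by at least [3 / 4 * s], and
    move the equality constraints by [s * z 0 b] up to a quarter of [s]. The signs on the faces of
    the cube then give a [z] where the equalities hold. *)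
Lemma dense_improves : exists x v,
  [/\ PC1 T Om x, NPC0 T U v, forall t, t \in `[0, T] -> ext_derive T x t = f t (x t) (v t),
      x 0 = X 0 &
   [/\ forall i : 'I_l, payoff T (phi (inl (inl i))) (G (inl (inl i))) X u
         < payoff T (phi (inl (inl i))) (G (inl (inl i))) x v,
       forall a, 0 <= G (inl (inr a)) (x T) & forall b, G (inr b) (x T) = 0]].
Proof.
have [I [sg [c [nd [c0 ndv dir]]]]] := needle_directions.
pose tk (k : 'I_#|I|) := (nd (enum_val k)).1; pose vk (k : 'I_#|I|) := (nd (enum_val k)).2.
have tkT k : 0 <= tk k < T by case: (ndv (enum_val k)).
pose M := M0 `|` range vk.
have cM : compact M.
  by apply: compactU => //; apply: finite_compact; exact: finite_image.
have MU : M `<=` U by move=> _ [/M0U//|[k _ <-]]; case: (ndv (enum_val k)).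
have uM t : M (u t) by left.
have vM k : M (vk k) by right; exists k.
have [r [L [Lp [H phil]]]] := setting_exists T0 TS ucad cX XOm Xfr ffr fr dX cM MU uM phir.
have [C C0 CP] := traj_close H tkT vM; have [C' C'0 CP'] := traj_cont H tkT vM.
have [d d0 dP] := small_fit tkT.
pose a (s : R) (z : 'rV[R]_q) (k : 'I_#|I|) := s * (coef z (sg (enum_val k)) * c (enum_val k)).
pose cs := \sum_(k < #|I|) c (enum_val k); pose A := cs + 1.
have cs0 : 0 <= cs by apply: sumr_ge0.
have A0 : 0 < A by rewrite ltr_wpDl.
have a0 s z k : 0 <= s -> 0 <= a s z k by move=> s0; rewrite !mulr_ge0// coef_ge0.
have ac s z k : 0 <= s -> cube z -> a s z k <= s * c (enum_val k).
  by move=> s0 zc; rewrite ler_wpM2l// -[leRHS]mul1r ler_wpM2r// coef_le1.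
have aA s z : 0 <= s -> cube z -> \sum_k a s z k <= A * s.
  move=> s0 zc; apply: (@le_trans _ _ (cs * s)); last by rewrite ler_wpM2r// lerDl.
  by rewrite mulrC mulr_sumr; apply: ler_sum => k _; exact: ac.
(* The total length is at most [A * s n <= d], so the needles fit at every rank. *)
pose s n := d / A * n.+1%:R^-1 : R.
have s_gt0 n : 0 < s n by rewrite mulr_gt0 ?divr_gt0// invr_gt0 ltr0n.
have s_to0 : tends0 s.
  move=> e e0; have [n0 n0P] := tends0_inv (divr_gt0 e0 (divr_gt0 d0 A0)).
  exists n0 => n /n0P; rewrite ger0_norm ?invr_ge0 ?ler0n// ler_pdivlMr ?divr_gt0// => h.
  by rewrite gtr0_norm// /s mulrC.
have sA n : A * s n <= d.
  rewrite /s mulrA [A * _]mulrC divfK ?gt_eqF//.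
  by rewrite ler_pdivrMr ?ltr0n// ler_peMr ?ler1n// ltW.
clearbody s.
pose Z := {z : 'rV[R]_q | cube z}.
have afit n (z : Z) : fit T tk (a (s n) (sval z)).
  apply: dP => [k|]; first by apply: a0; exact: ltW.
  by rewrite (le_trans (aA _ _ (ltW (s_gt0 n)) (svalP z))).
(* One constant for two bounds: lengths are at most [A * s n], deviations at most [C * A * s n]. *)
pose B := (C + 1) * A.
have B0 : 0 <= B by rewrite mulr_ge0 ?addr_ge0// ltW.
have aB n (z : Z) k : a (s n) (sval z) k <= B * s n.
  have s0 := ltW (s_gt0 n).
  apply: (@le_trans _ _ (A * s n)); last first.
    by rewrite ler_wpM2r// ler_peMl ?lerDr// ltW.
  apply: le_trans (aA _ _ s0 (svalP z)).
  by rewrite (bigD1 k)//= lerDl sumr_ge0// => j _; exact: a0.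
have xclose n (z : Z) x : traj S u X f r tk vk (a (s n) (sval z)) x ->
    forall t, 0 <= t <= T -> `|x t - X t| <= B * s n.
  move=> xt t tT; rewrite (le_trans (CP _ _ (afit n z) xt t tT))//.
  have h := aA _ _ (ltW (s_gt0 n)) (svalP z).
  rewrite (le_trans (ler_wpM2l C0 h))// mulrA ler_pM2r// ler_pM2r// lerDl//.
have [n1 n1P] := uniform_variation H phir phil Gp pA tkT vM s_gt0 s_to0 B0 afit aB xclose
  (divr_gt0 (ltr01 : 0 < 1 :> R) (ltr0n R 8)).
have exV b : exists rho : R, 0 < rho /\ forall x, `|x - X T| < rho -> forall e, 0 < e ->
    exists2 d : R, 0 < d & forall x', `|x' - X T| < rho -> `|x' - x| < d ->
      `|G (inr b) x' - G (inr b) x| < e.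
  have [V /nbhs_epsP[rho rho0 rhoP] /within_epsP cG] := Gcont b.
  by exists rho; split=> // x xr e e0; have [d' d'0 d'P] := cG x (rhoP x xr) e e0;
     exists d' => // x' x'r; apply: d'P; exact: rhoP.
have [rhob rhobP] := choice exV.
have [rho rho0 rhoP] := finite_lower_bound (fun b => (rhobP b).1).
(* Margins of the inactive constraints; active ones receive the dummy value 1. *)
have gm0 a' : 0 < (if G (inl (inr a')) (X T) == 0 then 1 else G (inl (inr a')) (X T)).
  by case: ifPn => // h; rewrite lt_neqAle eq_sym h Gineq.
have [gm gm_gt0 gmP] := finite_lower_bound gm0.
(* Bounds the first-order effect on every inequality, uniformly in [z]; for small [s] the margins
   absorb it. *)
pose W := \sum_a' \sum_i `|c i * w (inl (inr a')) (nd i)|.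
have W0 : 0 <= W by do 2! apply: sumr_ge0 => ? _.
have small b : 0 < b -> exists n0, forall n, (n0 <= n)%N -> (B + W + 1) * s n < b.
  move=> b0; have BW : 0 < B + W + 1 + 1 by have := addr_ge0 B0 W0; lra.
  have [n0 n0P] := s_to0 _ (divr_gt0 b0 BW); exists n0 => n /n0P; rewrite gtr0_norm//.
  rewrite ler_pdivlMr// => h; rewrite (lt_le_trans _ h)// mulrC ltr_pM2l// ltrDl//.
have r0 := set_r0 H.
have [n2 n2P] := small (Num.min r (Num.min rho gm)) ltac:(by rewrite !lt_min r0 rho0).
pose n := maxn n1 n2.
have {n2P} := n2P n (leq_maxr _ _); rewrite !lt_min => /and3P[sr srho sgm].
have {}n1P := n1P n (leq_maxl _ _).
have s0 := s_gt0 n; set sn := s n in sr srho sgm n1P s0.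
have Bs b : (B + W + 1) * sn < b -> B * sn < b.
  by apply: le_lt_trans; rewrite ler_pM2r// -addrA lerDl addr_ge0.
have ext (z : Z) := traj_exists H vM (afit n z).
have [x xP] := choice ext.
have xr z t : 0 <= t <= T -> `|x z t - X t| <= r.
  by move=> tT; rewrite (le_trans (xclose n z _ (xP z) t tT))// ltW// Bs.
have TT : 0 <= T <= T by rewrite ltW/=.
have xrho z : `|x z T - X T| < rho.
  by rewrite (le_lt_trans (xclose n z _ (xP z) T TT))// Bs.
pose V (z : 'rV[R]_q) j := \sum_i coef z (sg i) * c i * w j (nd i).
have sumE (z : 'rV[R]_q) j :
    \sum_k a sn z k * needle_effect f X u (phi j) (p j) (tk k, vk k) = sn * V z j.
  rewrite /V mulr_sumr [RHS](reindex_onto enum_val enum_rank)/= => [|i _];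
    last by rewrite enum_rankK.
  apply: eq_big => [k|k _]; first by rewrite enum_valK eqxx.
  by rewrite /a /tk /vk -surjective_pairing !mulrA.
have est z j : `|payoff T (phi j) (G j) (x z) (needled u tk vk (a sn (sval z)))
    - payoff T (phi j) (G j) X u - sn * V (sval z) j| <= 1 / 8 * sn.
  by rewrite -sumE; exact: n1P (xP z) j.
have estc z j : (if j is inl (inl _) then false else true) ->
    `|G j (x z T) - G j (X T) - sn * V (sval z) j| <= 1 / 8 * sn.
  by move=> jc; have := est z j; rewrite !payoffX.
(* The error 1/8 of the expansion and the error 1/8 of the directions preserve the sign of [z 0 b]
   where it is 1 or -1. *)
have eqz z b : `|G (inr b) (x z T) / sn - sval z 0 b| <= 1 / 2.
  have h := estc z (inr b) isT; rewrite Geq subr0 in h.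
  have [_ _ /(_ b) h'] := dir _ (svalP z); rewrite -/(V (sval z) (inr b)) in h'.
  rewrite -(ler_pM2r s0) -[X in _ * X](gtr0_norm s0) -normrM mulrBl divfK ?gt_eqF//.
  have h'' : `|sn * V (sval z) (inr b) - sval z 0 b * sn| <= 1 / 8 * sn.
    by rewrite [sn * _]mulrC -mulrBl normrM (gtr0_norm s0) ler_pM2r.
  have := ler_distD (sn * V (sval z) (inr b)) (G (inr b) (x z T)) (sval z 0 b * sn).
  by move=> h3; rewrite (le_trans h3)// (le_trans (lerD h h''))//; lra.
have [z0 z0P] : exists z : Z, forall b, G (inr b) (x z T) = 0.
  (* Trajectories were chosen for points of the cube only; the value 0 elsewhere is a default. *)
  pose F (z : 'rV[R]_q) : 'rV[R]_q := match pselect (cube z) with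
    | left zc => \row_b (G (inr b) (x (exist _ z zc) T) / sn) | right _ => 0 end.
  have FE (z : Z) b : F (sval z) 0 b = G (inr b) (x z T) / sn.
    rewrite /F; case: pselect => [zc|/(_ (svalP z))//]; rewrite mxE.
    by case: z zc => z z1 zc; rewrite (Prop_irrelevance z1 zc).
  have [z zc Fz] : exists2 z, cube z & F z = 0.
    apply: Poincare_Miranda.
    - move=> z zc e e0; pose zz : Z := exist _ z zc.
      have exd b : exists d' : R, 0 < d' /\ forall x', `|x' - X T| < rho -> `|x' - x zz T| < d' ->
          `|G (inr b) x' - G (inr b) (x zz T)| < e * sn.
        have [_ /(_ (x zz T) (lt_le_trans (xrho zz) (rhoP b)) (e * sn) (mulr_gt0 e0 s0))] :=
          rhobP b.
        by move=> [d' d'0 d'P]; exists d'; split=> // x' x'r; apply: d'P;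
          exact: lt_le_trans (rhoP b).
      have [db dbP] := choice exd; have [d' d'0 d'P] := finite_lower_bound (fun b => (dbP b).1).
      (* Lipschitz constant of the endpoint in [z]: for each of the [#|I|] needles, the beginning
         moves by at most the total change of the lengths and the end by at most twice that. *)
      pose K := C' * (3 * (#|I|%:R * (A * sn))) + 1.
      have K0 : 0 < K by rewrite ltr_wpDl// mulr_ge0// mulr_ge0// mulr_ge0 ?ler0n// mulr_ge0 ?ltW.
      exists (d' / K); first by rewrite divr_gt0.
      move=> z' z'c zz' b; pose zz'' : Z := exist _ z' z'c.
      have dist : `|x zz'' T - x zz T| < d'.
        have ak k : `|a sn z' k - a sn z k| <= d' / K * (sn * c (enum_val k)).
          rewrite /a -mulrBr -mulrBl !normrM (gtr0_norm s0) (ger0_norm (c0 _)) mulrCA.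
          rewrite ler_wpM2r ?mulr_ge0 ?(ltW s0)//.
          apply: coef_lipschitz => [|b']; first by rewrite divr_ge0 ?ltW.
          by rewrite distrC ltW.
        have sumak : \sum_k `|a sn z' k - a sn z k| <= d' / K * (A * sn).
          apply: (@le_trans _ _ (\sum_k d' / K * (sn * c (enum_val k)))); first exact: ler_sum.
          rewrite -mulr_sumr ler_wpM2l ?divr_ge0 ?(ltW d'0) ?(ltW K0)//.
          by rewrite -mulr_sumr mulrC ler_pM2r// lerDl.
        have beg k : `|nbeg tk (a sn z') k - nbeg tk (a sn z) k| <= \sum_j `|a sn z' j - a sn z j|.
          rewrite /nbeg opprD addrACA subrr add0r -sumrB (le_trans (ler_norm_sum _ _ _))//.
          by rewrite [leRHS](bigID (fun j : 'I_#|I| => (j < k)%N))/= lerDl sumr_ge0.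
        have en k : `|nend tk (a sn z') k - nend tk (a sn z) k| <= 2 * \sum_j `|
          a sn z' j - a sn z j|.
          rewrite /nend opprD addrACA (le_trans (ler_normD _ _))// [leRHS]mulrDl !mul1r lerD//.
          by rewrite [leRHS](bigD1 k)//= lerDl sumr_ge0.
        rewrite (le_lt_trans (CP' _ _ _ _ (afit n zz'') (afit n zz) (xP zz'') (xP zz)))//.
        apply: (@le_lt_trans _ _ (C' * (3 * (#|I|%:R * (d' / K * (A * sn)))))).
          rewrite ler_wpM2l//; apply: (@le_trans _ _ (\sum_(k < #|I|) 3 * (d' / K * (A * sn)))).
            apply: ler_sum => k _; rewrite (le_trans (lerD (beg k) (en k)))//.
            by rewrite -[X in X + _]mul1r -mulrDl ler_pM2l// (_ : 1 + 2 = 3)//; ring.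
          by rewrite sumr_const card_ord -[leLHS]mulr_natl mulrCA.
        rewrite (_ : C' * _ = (K - 1) * (d' / K)); last by rewrite /K addrK; ring.
        by rewrite mulrA ltr_pdivrMr// mulrC ltr_pM2l// gtrBl.
      rewrite (FE zz) (FE zz'') -mulrBl normrM normfV (gtr0_norm s0) ltr_pdivrMr// distrC.
      by apply: (dbP b).2 => //; exact: lt_le_trans (d'P b).
    - move=> z b zc zb; have := eqz (exist _ z zc) b; rewrite -FE/= zb ler_norml => /andP[_].
      lra.
    - move=> z b zc zb; have := eqz (exist _ z zc) b; rewrite -FE/= zb ler_norml => /andP[h _].
      lra.
  exists (exist _ z zc) => b; have := FE (exist _ z zc) b; rewrite /= Fz mxE => /esym/eqP.
  by rewrite mulf_eq0 invr_eq0 (gt_eqF s0) orbF => /eqP.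
have [xPC vN xE] := traj_admissible H vM (afit n z0) (xP z0) (xr z0).
exists (x z0), (needled u tk vk (a sn (sval z0))); split=> //; first by case: (xP z0).
have [Vc Va _] := dir _ (svalP z0); split=> // [i|a'].
  have := est z0 (inl (inl i)); rewrite ler_norml => /andP[h _].
  have := Vc i; rewrite -/(V (sval z0) (inl (inl i))) -(ler_pM2l s0) => h'.
  rewrite -subr_gt0; lra.
have := estc z0 (inl (inr a')) isT; rewrite ler_norml => /andP[h _].
have [/eqP aa|aa] := boolP (G (inl (inr a')) (X T) == 0).
  have := Va a' ltac:(by rewrite aa); rewrite -/(V (sval z0) (inl (inr a'))) -(ler_pM2l s0).
  by rewrite aa in h => h'; lra.
have gma := gmP a'; rewrite (negbTE aa) in gma.
have VW : `|V (sval z0) (inl (inr a'))| <= W.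
  rewrite /W (bigD1 a')//= ler_wpDr//; first by do 2! apply: sumr_ge0 => ? _.
  rewrite (le_trans (ler_norm_sum _ _ _))//; apply: ler_sum => i _.
  rewrite -mulrA normrM ger0_norm ?coef_ge0// -[leRHS]mul1r ler_wpM2r// coef_le1//.
  exact: svalP.
have : - (W * sn) <= sn * V (sval z0) (inl (inr a')).
  rewrite [leRHS]mulrC lerNl -mulNr ler_pM2r// (le_trans _ VW)//.
  by rewrite -normrN ler_norm.
have : 0 <= B * sn by rewrite mulr_ge0// ltW.
by move: sgm; rewrite !mulrDl mul1r; lra.
Qed.

End Improvement.

(** * The Pontryagin conditions *)

Lemma is_Fdiff_add {R : realType} {V W : normedModType R} (f g : V -> W) x (L L' : blin V W) :
  is_Fdiff f x L -> is_Fdiff g x L' -> is_Fdiff (fun x => f x + g x) x (L + L').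
Proof. by move=> fL gL; have := is_diffD fL gL. Qed.

Lemma is_Fdiff_scale {R : realType} {V W : normedModType R} (f : V -> W) x (L : blin V W) (a : R) :
  is_Fdiff f x L -> is_Fdiff (fun x => a *: f x) x (a *: L).
Proof. by move=> fL; have := is_diffZ a fL. Qed.

Lemma is_Fdiff0 {R : realType} {V W : normedModType R} x : is_Fdiff (fun=> 0) x (0 : blin V W).
Proof.
apply/is_Fdiff_epsP => e e0; exists 1 => // h _.
by rewrite subrr sub0r blin_zeroE oppr0 normr0 mulr_ge0// ltW.
Qed.

Lemma is_Fdiff_sum {R : realType} {V W : normedModType R} (I : Type) (r : seq I)
    (f : I -> V -> W) x (L : I -> blin V W) : (forall i, is_Fdiff (f i) x (L i)) ->
  is_Fdiff (fun x => \sum_(i <- r) f i x) x (\sum_(i <- r) L i).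
Proof.
move=> fL; elim: r => [|i r IH].
  rewrite big_nil (_ : (fun x => _) = fun=> 0); first exact: is_Fdiff0.
  by apply/funext => y; rewrite big_nil.
rewrite big_cons (_ : (fun x => _) = fun x => f i x + \sum_(j <- r) f j x); last first.
  by apply/funext => y; rewrite big_cons.
exact: is_Fdiff_add.
Qed.

Lemma is_Fdiff_blin {R : realType} {V V' W : normedModType R} (f : V -> V') x
    (L : blin V V') (p : blin V' W) : is_Fdiff f x L -> is_Fdiff (fun x =>
      p (f x)) x (blin_comp p L).
Proof.
move=> /is_Fdiff_epsP fL; apply/is_Fdiff_epsP => e e0.
have p1 : 0 < `|p| + 1 by rewrite ltr_wpDl.
have [d d0 dP] := fL _ (divr_gt0 e0 p1); exists d => // h hd.
rewrite blin_compE -!linearB (le_trans (blin_bound _ _))//.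
apply: (@le_trans _ _ ((`|p| + 1) * (e / (`|p| + 1) * `|h|))).
  by rewrite ler_pM// ?dP// lerDl.
by rewrite mulrA [_ * (e / _)]mulrC divfK// gt_eqF.
Qed.

Lemma within_scale {R : realType} {V W : normedModType R} (A : set V) (f : V -> W) (a : R) :
  {within A, continuous f} -> {within A, continuous (fun x => a *: f x)}.
Proof. by move=> cf x; apply: cvgZl_tmp; exact: cf. Qed.

Lemma within_sum {R : realType} {V W : normedModType R} (A : set V) (I : Type) (r : seq I)
    (f : I -> V -> W) : (forall i, {within A, continuous (f i)}) ->
  {within A, continuous (fun x => \sum_(i <- r) f i x)}.
Proof.
move=> cf; elim: r => [|i r IH].
  rewrite (_ : (fun x => _) = fun=> 0); first by apply: within_continuous; exact: cst_continuous.
  by apply/funext => y; rewrite big_nil.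
rewrite (_ : (fun x => _) = fun x => f i x + \sum_(j <- r) f j x); last first.
  by apply/funext => y; rewrite big_cons.
by apply: within_add => //; exact: cf.
Qed.

(** * The maximum condition on the closed interval *)

Section MaximumPrinciple.
Context {R : realType} {Y : normedModType R}.
Variables (T : R) (S : seq R) (U : set Y) (u : R -> Y) (K : R * Y -> R).
Hypotheses (T0 : 0 < T) (TS : T \notin S) (ucad : cadlag S U u).
Hypothesis cK : {within setT `*` U, continuous K}.

Let K_near t y e : U y -> 0 < e -> exists2 d : R, 0 < d & forall s y', U y' ->
  `|s - t| < d -> `|y' - y| < d -> `|K (s, y') - K (t, y)| < e.
Proof.
move=> Uy e0; have [//|d d0 dP] := proj1 (within_epsP _ _) cK (t, y) _ e e0.
exists d => // s y' Uy' st yy'; apply: dP => //.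
by rewrite prod_normE/= gt_max st.
Qed.

(** Needles start before [T]; the inequality at [T] follows by continuity, [u] having no jump
    there. *)
Lemma maximum_closed : (forall t v, 0 <= t < T -> U v -> K (t, v) <= K (t, u t)) ->
  forall t v, 0 <= t <= T -> U v -> K (t, v) <= K (t, u t).
Proof.
move=> mp t v /andP[t0]; rewrite le_eqVlt => /predU1P[->|tT] Uv; last by rewrite mp// t0.
rewrite leNgt; apply/negP => lt_K; pose e := (K (T, v) - K (T, u T)) / 2.
have e0 : 0 < e by rewrite divr_gt0// subr_gt0.
have [uU uc _ _] := ucad.
have [d d0 dP] := K_near T Uv e0; have [d' d'0 dP'] := K_near T (uU T) e0.
have /continuous_epsP/(_ d' d'0)[d1 d10 d1P] := uc T TS.
pose s := T - Num.min (Num.min d d') (Num.min d1 T) / 2.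
set mm := Num.min (Num.min d d') _ in s; have mm0 : 0 < mm by rewrite !lt_min d0 d'0 d10.
have sT : `|s - T| < mm.
  by rewrite /s addrAC subrr add0r normrN gtr0_norm ?divr_gt0// ltr_pdivrMr// ltr_pMr// ltr1n.
have := sT; rewrite /mm !lt_min => /andP[/andP[h1 h2] /andP[h3 _]].
have mT : mm <= T by rewrite /mm !ge_min lexx !orbT.
have h4 := dP s v Uv h1 ltac:(by rewrite subrr normr0).
have h5 := dP' s (u s) (uU s) h2 (d1P s h3).
have h6 : K (s, v) <= K (s, u s) by apply: mp => //; rewrite /s; lra.
move: h4 h5; rewrite !ltr_norml => /andP[h4 _] /andP[_ h5]; rewrite /e in h4 h5; lra.
Qed.

(** At a jump of [u] the left limit [y] belongs to [U]. The maximum condition compares [y] with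
    [u t] at time [t], and [u t] with [u s] at earlier times [s]; both inequalities together
    identify the left limit of the Hamiltonian with its value. *)
Lemma maximum_continuous : (forall t v, 0 <= t <= T -> U v -> K (t, v) <= K (t, u t)) ->
  {within `[0, T], continuous (fun t => K (t, u t))}.
Proof.
move=> mp; have [uU uc ur ul] := ucad.
apply/within_epsP => t /=; rewrite in_itv/= => tT e e0.
have e20 : 0 < e / 2 by rewrite divr_gt0.
have [_ _ Kr _] := cadlag_comp cK ucad.
have /cvg_right_epsP/(_ _ e20)[d1 d10 d1P] := Kr t.
have [y Uy /cvg_left_epsP uy] := ul t.
have [d2 d20 d2P] := K_near t Uy e20; have [d3 d30 d3P] := K_near t (uU t) e20.
have [d4 d40 d4P] := uy (d2 / 2) (divr_gt0 d20 (ltr0n R 2)).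
pose d := Num.min (Num.min d1 d2) (Num.min d3 d4).
exists d; first by rewrite !lt_min d10 d20 d30.
move=> s; rewrite in_itv/= => sT; rewrite /d !lt_min => /andP[/andP[s1 s2] /andP[s3 s4]].
case: (ltgtP s t) => [st|ts|->]; last by rewrite subrr normr0.
  have h1 : K (s, u t) <= K (s, u s) by apply: mp.
  have h2 : K (t, y) <= K (t, u t) by apply: mp.
  have us : `|u s - y| < d2.
    apply: (@le_lt_trans _ _ (d2 / 2)); last by rewrite ltr_pdivrMr// ltr_pMr// ltr1n.
    by apply: d4P; rewrite st andbT; move: s4; rewrite ltr_norml => /andP[]; lra.
  have := d2P s (u s) (uU s) s2 us; have := d3P s (u t) (uU t) s3 ltac:(by rewrite subrr normr0).
  rewrite !ltr_norml => /andP[h3 _] /andP[_ h4]; lra.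
apply: (@le_lt_trans _ _ (e / 2)); last by rewrite ltr_pdivrMr// ltr_pMr// ltr1n.
by apply: d1P; rewrite ts/=; move: s1; rewrite ltr_norml => /andP[_]; lra.
Qed.

End MaximumPrinciple.

(** * Existence of multipliers *)

Section Bolza.
Context {R : realType} {E : completeNormedModType R} {Y : normedModType R} {l m q : nat}.
Variables (T : R) (Om : set E) (U : set Y) (xi0 : E).
Hypotheses (T0 : 0 < T) (Om_open : open Om).
Variables (f : R -> E -> Y -> E) (f0 : 'I_l -> R -> E -> Y -> R).
Variables (g0 : 'I_l -> E -> R) (g : 'I_m -> E -> R) (h : 'I_q -> E -> R).
Variables (x0 : R -> E) (u0 : R -> Y).
Hypothesis fr : regular_along T Om U x0 f.
Hypothesis f0r : forall i, regular_along T Om U x0 (f0 i).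
Hypothesis adm : admissible T Om U xi0 f g h x0 u0.
Notation J := ('I_l + 'I_m + 'I_q)%type.

Let X t := x0 (clamp 0 T t).
Let u t := u0 (clamp 0 T t).
Let ff t := f (clamp 0 T t).
Let Df t zeta := DF (ff t ^~ zeta) (X t).
(** Constraints are treated as functionals without running cost. *)
Let phi (j : J) : R -> E -> Y -> R :=
  if j is inl (inl i) then fun t => f0 i (clamp 0 T t) else fun _ _ _ => 0.
Let D (j : J) : R -> Y -> blin E R :=
  if j is inl (inl i) then fun t zeta => DF (f0 i (clamp 0 T t) ^~ zeta) (X t) else fun _ _ => 0.
Let G (j : J) := match j with inl (inl i) => g0 i | inl (inr a) => g a | inr b => h b end.

Let T0' := ltW T0.
Let clampT t : 0 <= t <= T -> clamp 0 T t = t. Proof. exact: clampE. Qed.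
Let TT : 0 <= T <= T. Proof. by rewrite T0' lexx. Qed.
Let XT : X T = x0 T. Proof. by rewrite /X clampT. Qed.
Let clampK t : clamp 0 T (clamp 0 T t) = clamp 0 T t.
Proof. by rewrite clampT// clamp_itv. Qed.

Lemma frozen_data : exists S, [/\ T \notin S, cadlag S U u, continuous X, forall t, Om (X t) &
  forall t, 0 < t < T -> t \notin S -> is_derive t 1 X (ff t (X t) (u t))].
Proof.
have [[[s xs] xOm] uN xE _ _] := adm.
have [S1 TS1 ucad] := NPC0_cadlag T0 uN.
have [_ cx _] := xs.
exists (S1 ++ [seq t <- s | t < T]); split.
- by rewrite mem_cat negb_or TS1 mem_filter ltxx.
- by apply: cadlag_sub ucad => t tS; rewrite mem_cat tS.
- exact: continuous_clamp T0' cx.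
- by move=> t; apply: xOm; rewrite in_itv/=; exact: clamp_itv.
move=> t tT; rewrite mem_cat mem_filter negb_or => /andP[_]; have /andP[t0 t1] := tT.
rewrite t1 /= => ts; apply: is_derive_clamp => //.
have tT' : 0 <= t <= T by rewrite !ltW.
rewrite /ff /X /u clampT//.
exact: (ext_derive_is_derive xs xE).
Qed.

Let freg : reg Om U X ff Df.
Proof.
have [[[s [_ cx _]] xOm] _ _ _ _] := adm.
exact: (regular_along_reg T0 Om_open cx xOm fr).
Qed.

Let phireg j : reg Om U X (phi j) (D j).
Proof.
have zero : reg Om U X (fun _ _ _ => 0 : R) (fun _ _ => 0 : blin E R).
  split.
  - by apply: within_continuous => z; exact: cvg_cst.
  - by move=> t zeta _; exact: is_Fdiff0.
  - by apply: within_continuous => z; exact: cvg_cst.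
  move=> M M0 cM MU; have [r [L [r0 _ lip]]] := reg_lip freg M0 cM MU.
  exists r, 0; split=> // t zeta xi xi' Mz x1 x2; split.
    by have [] := lip t zeta xi xi' Mz x1 x2.
  by rewrite subrr normr0 mul0r.
case: j => [[i|a]|b] //=.
have [[[s [_ cx _]] xOm] _ _ _ _] := adm.
exact: (regular_along_reg T0 Om_open cx xOm (f0r i)).
Qed.

Lemma frozen_payoff (i : 'I_l) x v (w : R -> Y) (y : R -> E) :
  (forall t, 0 <= t <= T -> x t = y t /\ v t = w t) ->
  Jobj T f0 g0 i x v = payoff T (phi (inl (inl i))) (G (inl (inl i))) y w.
Proof.
move=> eq; rewrite /Jobj /payoff /= (eq T TT).1; congr (_ + _).
apply: eq_Rintegral => t; rewrite inE/= in_itv/= => tT.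
by have [-> ->] := eq t tT; rewrite clampT.
Qed.

Hypothesis opt : ~ exists x u, [/\ admissible T Om U xi0 f g h x u,
  forall i, Jobj T f0 g0 i x0 u0 <= Jobj T f0 g0 i x u
  & exists i0, Jobj T f0 g0 i0 x0 u0 < Jobj T f0 g0 i0 x u].
Hypothesis l_gt0 : (0 < l)%N.
Hypothesis g0d : forall i, Hdifferentiable (g0 i) (x0 T).
Hypothesis gd : forall a, Hdifferentiable (g a) (x0 T).
Hypothesis hd : forall b, Hdifferentiable (h b) (x0 T).
Hypothesis hc : forall b, exists2 V, nbhs (x0 T) V & {within V, continuous (h b)}.

Lemma multipliers_exist : exists (theta : 'rV[R]_l) (lambda : 'rV[R]_m) (mu : 'rV[R]_q)
  (p : R -> blin E R), PC1 T setT p /\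
  Pontryagin T U f f0 g0 g h x0 u0 theta lambda mu p.
Proof.
have [xPC uN xE x00 [gx hx]] := adm.
have [S [TS ucad cX XOm dX]] := frozen_data.
have [M0 [cM0 M0U uM0']] := cadlag_range_compact 0 T ucad.
have uM0 t : M0 (u t).
  have -> : u t = u (clamp 0 T t) by rewrite /u clampK.
  by apply: uM0'; exact: clamp_itv.
have Xfr t : X (clamp 0 T t) = X t by rewrite /X clampK.
have ffr t : ff (clamp 0 T t) = ff t by rewrite /ff clampK.
have [r [L [Lp [H phil]]]] := setting_exists T0 TS ucad cX XOm Xfr ffr freg dX cM0 M0U uM0 phireg.
have exp j := adjoint_exists H (phireg j) (DH (G j) (x0 T)).
have [p pP] := choice (fun j => let: ex_intro2 p pA pT := exp j in
  ex_intro (fun p => adjoint S u Df (D j) p /\ p T = DH (G j) (x0 T)) p (conj pA pT)).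
have pA j : adjoint S u Df (D j) (p j) by case: (pP j).
have pT j : p j T = DH (G j) (x0 T) by case: (pP j).
have Gp j : is_Hdiff (G j) (X T) (p j T).
  by rewrite XT pT; apply: DHP; case: j => [[i|a]|b] /=.
have cp j : continuous (p j) by case: (pA j).
have [mult|dense] := multiplier_or_dense (fun nd : R * Y => 0 <= nd.1 < T /\ U nd.2)
  (fun j nd => needle_effect ff X u (phi j) (p j) nd) (fun a => g a (X T) == 0); last first.
  exfalso; apply: opt.
  have payX (j : J) x v : (if j is inl (inl _) then false else true) ->
      payoff T (phi j) (G j) x v = G j (x T).
    move=> jc; suff int0 : \int[lebesgue_measure]_(t in `[0, T]) phi j t (x t) (v t) = 0.
      by rewrite /payoff int0 addr0.
    by case: j jc => [[i|a]|b] //= _; rewrite /Rintegral integral0.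
  have [x [v [xPC' vN xE' x0' [inc ineq eq]]]] := dense_improves T0 TS ucad cX XOm Xfr ffr freg
    dX cM0 M0U uM0 phireg Gp pA payX ltac:(by move=> a; rewrite XT; exact: gx)
    ltac:(by move=> b; rewrite XT; exact: hx) ltac:(by move=> b; rewrite XT; exact: hc) dense.
  have inc' i : Jobj T f0 g0 i x0 u0 < Jobj T f0 g0 i x v.
    rewrite (@frozen_payoff i x0 u0 u X); last by move=> t tT; rewrite /X /u clampT.
    by rewrite (@frozen_payoff i x v v x).
  exists x, v; split=> [|i|]; last 1 first.
  - by exists (Ordinal l_gt0).
  - split=> //; last by rewrite x0' /X clampT// lexx T0'.
    by move=> t tT; rewrite xE'// /ff clampT//; move: tT; rewrite in_itv.
  - exact: ltW.
have [theta [lambda [mu [nn th0 la0 sl mp]]]] := mult.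
(* The adjoint equation is linear in arc and cost jointly, so this is the adjoint arc of the
   combined cost with differential [Dt]. *)
pose P t := \sum_i theta 0 i *: p (inl (inl i)) t + \sum_a lambda 0 a *: p (inl (inr a)) t
  + \sum_b mu 0 b *: p (inr b) t.
pose Dt t zeta := \sum_i theta 0 i *: D (inl (inl i)) t zeta.
have cD : {within setT `*` U, continuous (fun z : R * Y => Dt z.1 z.2)}.
  apply: (within_sum (f := fun i (z : R * Y) => theta 0 i *: D (inl (inl i)) z.1 z.2)) => i.
  by apply: within_scale; exact: reg_Dcont (phireg (inl (inl i))).
have cP : continuous P.
  have cs n (c : 'rV[R]_n) (pj : 'I_n -> R -> blin E R) : (forall i, continuous (pj i)) ->
      continuous (fun t => \sum_i c 0 i *: pj i t).
    move=> cpj; apply: (@continuous_sum _ _ _ _ (fun i t => c 0 i *: pj i t)) => i t.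
    by apply: cvgZl_tmp; exact: cpj.
  move=> t; apply: cvgD; first by apply: cvgD; apply: cs.
  by apply: cs.
have dP t : t \notin S -> is_derive t 1 P (- (Dt t (u t) + blin_comp (P t) (Df t (u t)))).
  move=> tS; have ds n (c : 'rV[R]_n) (inj : 'I_n -> J) :
      is_derive t 1 (fun t => \sum_i c 0 i *: p (inj i) t) (\sum_i c 0 i *:
        (- (D (inj i) t (u t) + blin_comp (p (inj i) t) (Df t (u t))))).
    apply: (@is_derive_sum _ _ _ _ (fun i t => c 0 i *: p (inj i) t)) => i.
    by apply: is_deriveZ; exact: (pA (inj i)).2.
  apply: (is_derive_eq (is_deriveD (is_deriveD (ds l theta (fun i => inl (inl i)))
    (ds m lambda (fun a => inl (inr a)))) (ds q mu (fun b => inr b)))).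
  apply: blin_ext => e; set v := Df t (u t) e.
  have grp n (c : 'rV[R]_n) (inj : 'I_n -> J) : (\sum_i c 0 i *:
      (- (D (inj i) t (u t) + blin_comp (p (inj i) t) (Df t (u t))))) e =
      - (\sum_i c 0 i * D (inj i) t (u t) e + \sum_i c 0 i * p (inj i) t v).
    rewrite blin_sumE -big_split -sumrN; apply: eq_bigr => i _ /=.
    by rewrite -mulrDr -mulrN.
  rewrite !blin_addE !grp blin_oppE blin_addE blin_compE -/v /P /Dt !blin_addE !blin_sumE.
  have z1 n (c : 'rV[R]_n) (z : 'I_n -> blin E R) : (forall i, z i = 0) -> \sum_i c 0 i * z i e = 0.
    by move=> z0; apply: big1 => i _; rewrite z0 mulr0.
  by rewrite (z1 m)// (z1 q)// !add0r -!opprD !addrA.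
have adj := adjoint_cadlag ucad cD (reg_Dcont freg) cP.
have [PPC PE] := cadlag_PC1 (G := setT) T0 TS (continuous_subspaceT cP) (fun _ _ => I) adj
  (fun t _ => dP t).
pose K (z : R * Y) := \sum_i theta 0 i * phi (inl (inl i)) z.1 (X z.1) z.2
  + P z.1 (ff z.1 (X z.1) z.2).
have cK : {within setT `*` U, continuous K}.
  apply: within_add.
    apply: (within_sum (f := fun i (z : R * Y) =>
      theta 0 i *: phi (inl (inl i)) z.1 (X z.1) z.2)) => i.
    by apply: within_scale; exact: reg_joint_cont (phireg (inl (inl i))) cX XOm.
  apply: within_blin; last exact: reg_joint_cont freg cX XOm.
  by apply: within_continuous => z; apply: (@continuous_comp _ _ _ fst P); [exact: fst_continuous|
    exact: cP].
have KE t v : 0 <= t <= T -> K (t, v) = Hamiltonian f f0 t (x0 t) v (P t) theta.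
  by move=> tT; rewrite /K /Hamiltonian /= /X /ff clampT.
have Ku t : 0 <= t <= T -> K (t, u t) = Hamiltonian f f0 t (x0 t) (u0 t) (P t) theta.
  by move=> tT; rewrite KE// /u clampT.
have mpK t v : 0 <= t < T -> U v -> K (t, v) <= K (t, u t).
  move=> tT Uv; have := mp (t, v) (conj tT Uv).
  (* The increment of the Hamiltonian is the combination of the needle effects that the multipliers
     make nonpositive. *)
  suff KKE : K (t, v) - K (t, u t) =
      \sum_i theta 0 i * needle_effect ff X u (phi (inl (inl i))) (p (inl (inl i))) (t, v)
    + \sum_a lambda 0 a * needle_effect ff X u (phi (inl (inr a))) (p (inl (inr a))) (t, v)
    + \sum_b mu 0 b * needle_effect ff X u (phi (inr b)) (p (inr b)) (t,
      v) by rewrite -KKE subr_le0.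
  set d := ff t (X t) v - ff t (X t) (u t).
  have grp n (c : 'rV[R]_n) (inj : 'I_n -> J) :
      \sum_i c 0 i * needle_effect ff X u (phi (inj i)) (p (inj i)) (t, v) =
      \sum_i c 0 i * p (inj i) t d
      + (\sum_i c 0 i * phi (inj i) t (X t) v - \sum_i c 0 i * phi (inj i) t (X t) (u t)).
    by rewrite -sumrB -big_split; apply: eq_bigr => i _; rewrite /needle_effect/= mulrDr mulrBr.
  rewrite !grp /= -!sumrB.
  have z1 n (c : 'rV[R]_n) : \sum_i (c 0 i * 0 - c 0 i * 0) = 0 :> R.
    by apply: big1 => i _; rewrite subrr.
  have PB : P t d = P t (ff t (X t) v) - P t (ff t (X t) (u t)) by rewrite /d linearB.
  have Pd : P t d = \sum_i theta 0 i * p (inl (inl i)) t d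
      + \sum_a lambda 0 a * p (inl (inr a)) t d + \sum_b mu 0 b * p (inr b) t d.
    by rewrite /P !blin_addE !blin_sumE.
  rewrite !z1 !addr0 sumrB /K /= opprD addrACA -PB Pd.
  ring.
have mpT := maximum_closed T0 TS ucad cK mpK.
have chK := maximum_continuous ucad cK mpT.
exists theta, lambda, mu, P; split=> //; split=> //.
- move=> a; have [/eqP ga|ga] := boolP (g a (X T) == 0); first by rewrite -XT ga mulr0.
  by rewrite sl// mul0r.
- by rewrite /P; congr (_ + _ + _); apply: eq_bigr => i _; rewrite pT.
split.
- move=> t tT; rewrite PE//; congr (- _); apply/esym/DFE.
  have Uu : U (u0 t) by have [uU _ _ _] := uN; exact: uU.
  apply: is_Fdiff_add.
    apply: (@is_Fdiff_sum _ _ _ _ _ (fun i xi => theta 0 i *: f0 i t xi (u0 t))) => i.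
    apply: is_Fdiff_scale; have := reg_diff (phireg (inl (inl i))) t Uu.
    by rewrite /= /u /X clampT.
  by apply: is_Fdiff_blin; have := reg_diff freg t Uu; rewrite /u /ff /X clampT.
- move=> t v; rewrite in_itv/= => tT Uv; rewrite -KE// -Ku//; exact: mpT.
- apply/within_epsP => t tT e e0; have [d d0 dP'] := proj1 (within_epsP _ _) chK t tT e e0.
  by exists d => // s sT st; rewrite -!Ku//; exact: dP'.
Qed.

End Bolza.

(** If [p (L y) > 0], a short step in direction [y] stays in [U] and increases [p] along [psi]; the
    direction [- y] gives the other inequality. *)
Lemma interior_maximum {R : realType} {Y E : normedModType R} (U : set Y) (psi : Y -> E)
    (zeta0 : Y) (L : blin Y E) (p : blin E R) : nbhs zeta0 U -> is_Gdiff psi zeta0 L ->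
  (forall zeta, U zeta -> p (psi zeta) <= p (psi zeta0)) -> forall y, p (L y) = 0.
Proof.
move=> /nbhs_epsP[rho rho0 rhoP] /is_Gdiff_epsP dpsi maxp.
have le0 y : p (L y) <= 0.
  rewrite leNgt; apply/negP => c0; pose c := p (L y).
  (* With this tolerance the error costs at most half of the gain [t * c] after applying [p]. *)
  have [d d0 dP] := dpsi y (c / 2 / (`|p| + 1)) ltac:(by rewrite !divr_gt0).
  pose t := Num.min d (rho / (`|y| + 1)) / 2.
  have m0 : 0 < Num.min d (rho / (`|y| + 1)) by rewrite lt_min d0 divr_gt0.
  have t0 : 0 < t by rewrite divr_gt0.
  have tm : t < Num.min d (rho / (`|y| + 1)) by rewrite ltr_pdivrMr// ltr_pMr// ltr1n.
  have := tm; rewrite lt_min => /andP[td trho]; rewrite ltr_pdivlMr// in trho.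
  have Uz : U (zeta0 + t *: y).
    apply: rhoP; rewrite addrAC subrr add0r normrZ gtr0_norm//.
    by rewrite (le_lt_trans _ trho)// ler_pM2l// lerDl.
  have h1 := dP t ltac:(by rewrite t0).
  have h2 : `|p (psi (zeta0 + t *: y) - psi zeta0 - t *: L y)| <= c / 2 * t.
    rewrite (le_trans (blin_bound _ _))// (le_trans (ler_wpM2l _ h1))//.
    rewrite mulrA ler_pM2r// mulrCA ger_pMr ?divr_gt0// ler_pdivrMr// mul1r lerDl//.
  have h3 := maxp _ Uz; move: h2; rewrite !linearB linearZ/= ler_norml => /andP[h2 _].
  have : 0 < t * c by rewrite mulr_gt0.
  have : t *: (p (L y) : R^o) = t * c by [].
  move=> tc; rewrite tc in h2; lra.
move=> y; apply/eqP; rewrite eq_le le0/= -oppr_le0.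
by have := le0 (- y); rewrite !linearN.
Qed.

(** * Nonvanishing of the cost multipliers *)

Section Normality.
Context {R : realType} {E : completeNormedModType R} {Y : normedModType R} {l m q : nat}.
Variables (T : R) (Om : set E) (U : set Y) (xi0 : E).
Hypotheses (T0 : 0 < T) (Om_open : open Om).
Variables (f : R -> E -> Y -> E) (f0 : 'I_l -> R -> E -> Y -> R).
Variables (g0 : 'I_l -> E -> R) (g : 'I_m -> E -> R) (h : 'I_q -> E -> R).
Variables (x0 : R -> E) (u0 : R -> Y).
Hypothesis fr : regular_along T Om U x0 f.
Hypothesis adm : admissible T Om U xi0 f g h x0 u0.
Hypothesis qualification : forall (c : 'rV[R]_m) (d : 'rV[R]_q),
  (forall a, 0 <= c 0 a) -> (forall a, c 0 a * g a (x0 T) = 0) ->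
  \sum_a c 0 a *: DH (g a) (x0 T) + \sum_b d 0 b *: DH (h b) (x0 T) = 0 ->
  (forall a, c 0 a = 0) /\ (forall b, d 0 b = 0).
Hypothesis surjective_control : exists t, [/\ t \in `[0, T], nbhs (u0 t) U,
  Gdifferentiable (f t (x0 t)) (u0 t) &
  forall v : E, exists y : Y, DG (f t (x0 t)) (u0 t) y = v].

Lemma theta_neq0 (theta : 'rV[R]_l) (lambda : 'rV[R]_m) (mu : 'rV[R]_q) (p : R -> blin E R) :
  PC1 T setT p -> Pontryagin T U f f0 g0 g h x0 u0 theta lambda mu p -> theta != 0.
Proof.
move=> [[s ps] _] [nn [_ la0] sl tc [ae mp _]]; apply/eqP => th0.
have [t1 [t1T Uu fd fsurj]] := surjective_control.
have T0' := ltW T0.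
have HE t xi v : Hamiltonian f f0 t xi v (p t) theta = p t (f t xi v).
  by rewrite /Hamiltonian th0 big1 ?add0r// => i _; rewrite mxE mul0r.
have pt1 : p t1 = 0.
  apply: blin_ext => v; have [y <-] := fsurj v.
  apply: (interior_maximum Uu (DGP fd)) => zeta Uz.
  by rewrite -!HE; exact: mp.
have [S [TS ucad cX XOm _]] := frozen_data T0 adm.
have [[[s' [_ cx _]] xOm] uN _ _ _] := adm; have [uU _ _ _] := uN.
have freg := regular_along_reg T0 Om_open cx xOm fr.
have cad : cadlag S setT (fun t => DF (f (clamp 0 T t) ^~ (u0 (clamp 0 T t))) (x0 (clamp 0 T t))).
  exact: (cadlag_comp (reg_Dcont freg) ucad).
(* The state differential of [f] along the reference pair is regulated, hence bounded on [[0, T]];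
   this is the constant for Gronwall in the homogeneous adjoint equation. *)
have [L0 LP] := regulated_bounded T0' (cadlag_pwc cad).1.
pose L := `|L0|; have L_ge0 : 0 <= L := normr_ge0 L0.
have pE t : t \in `[0, T] -> ext_derive T p t = - blin_comp (p t) (DF (f t ^~ (u0 t)) (x0 t)).
  move=> tT; rewrite ae//; congr (- _); apply: DFE.
  rewrite (_ : (fun xi => _) = fun xi => p t (f t xi (u0 t))); last by apply/funext => xi;
    exact: HE.
  apply: is_Fdiff_blin; apply: DFP; have [_ _ fF _ _] := fr; apply: fF => //; exact: uU.
have [_ cp _] := ps.
have cp' := continuous_clamp T0' cp.
have pT0 : p T = 0.
  move: t1T; rewrite in_itv/= => /andP[t10 t1T].
  have cz : continuous ((fun=> 0) : R -> R) by move=> t; exact: cvg_cst.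
  have := @gronwall _ _ s (fun t => p (clamp 0 T t)) (fun=> 0) L t1 T t1T L_ge0 cp' cz.
  rewrite !clampE ?lexx ?T0' ?t10// => gr; apply/eqP; rewrite -normr_le0; apply: gr; last first.
    by rewrite pt1 normr0.
  move=> t /andP[tt1 tT] ts; have t0 : 0 < t by rewrite (le_lt_trans t10).
  have t0T : 0 <= t <= T by rewrite !ltW.
  exists (- blin_comp (p t) (DF (f t ^~ (u0 t)) (x0 t))), 0; split.
  - apply: is_derive_clamp; first by rewrite t0.
    by apply: (ext_derive_is_derive ps pE) => //; rewrite t0.
  - exact: is_derive_const.
  rewrite mulr0 subrr subr_le0 clampE// normrN (le_trans (blin_comp_norm _ _))// mulrC ler_wpM2r//.
  by have := LP t t0T; rewrite clampE// => /le_trans; apply; rewrite ler_norm.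
have th_sum : \sum_i theta 0 i *: DH (g0 i) (x0 T) = 0.
  by apply: big1 => i _; rewrite th0 mxE scale0r.
rewrite th_sum add0r pT0 in tc; have [c0 d0] := qualification la0 sl tc.
have la00 : lambda = 0 by apply/rowP => a; rewrite c0 mxE.
have mu00 : mu = 0 by apply/rowP => b; rewrite d0 mxE.
by move: nn; rewrite th0 la00 mu00 eqxx.
Qed.

End Normality.

Theorem corollary4p11 (R : realType) (E : completeNormedModType R)
    (Y : normedModType R) (l m q : nat)
    (l_gt0 : (0 < l)%N) (m_gt0 : (0 < m)%N) (q_gt0 : (0 < q)%N)
    (T : R) (T_gt0 : 0 < T)
    (Omega : set E) (Omega_open : open Omega)
    (U : set Y) (xi0 : E) (xi0_Omega : Omega xi0)
    (f : R -> E -> Y -> E) (f0 : 'I_l -> R -> E -> Y -> R)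
    (g0 : 'I_l -> E -> R) (g : 'I_m -> E -> R) (h : 'I_q -> E -> R)
    (x0 : R -> E) (u0 : R -> Y)
    (x0u0_opt : Pareto_optimal T Omega U xi0 f f0 g0 g h x0 u0)
    (hyp_a : forall i, regular_along T Omega U x0 (f0 i))
    (hyp_b : regular_along T Omega U x0 f)
    (hyp_c : (forall i, Hdifferentiable (g0 i) (x0 T)) /\
             (forall a, Hdifferentiable (g a) (x0 T)))
    (hyp_d : forall b,
       (exists V, [/\ nbhs (x0 T) V, V `<=` Omega & {within V, continuous (h b)}])
       /\ Hdifferentiable (h b) (x0 T))
    (hyp_e : forall (c : 'rV[R]_m) (d : 'rV[R]_q),
       (forall a, 0 <= c 0 a) ->
       (forall a, c 0 a * g a (x0 T) = 0) ->
       \sum_a c 0 a *: DH (g a) (x0 T) + \sum_b d 0 b *: DH (h b) (x0 T) = 0 ->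
       (forall a, c 0 a = 0) /\ (forall b, d 0 b = 0))
    (hyp_f : exists t, [/\ t \in `[0, T], nbhs (u0 t) U,
       Gdifferentiable (f t (x0 t)) (u0 t) &
       forall v : E, exists y : Y, DG (f t (x0 t)) (u0 t) y = v]) :
  (exists (theta : 'rV[R]_l) (lambda : 'rV[R]_m) (mu : 'rV[R]_q)
     (p : R -> blin E R),
     PC1 T setT p /\
     Pontryagin T U f f0 g0 g h x0 u0 theta lambda mu p) /\
  (forall (theta : 'rV[R]_l) (lambda : 'rV[R]_m) (mu : 'rV[R]_q)
     (p : R -> blin E R),
     PC1 T setT p ->
     Pontryagin T U f f0 g0 g h x0 u0 theta lambda mu p -> theta != 0).
Proof.
have [adm opt] := x0u0_opt; have [g0d gd] := hyp_c; split.
  apply: (multipliers_exist T_gt0 Omega_open hyp_b hyp_a adm opt l_gt0 g0d gd) => b.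
    by have [] := hyp_d b.
  by have [[V [xV _ cV]] _] := hyp_d b; exists V.
move=> theta lambda mu p.
exact: (theta_neq0 T_gt0 Omega_open hyp_b adm hyp_e hyp_f).
Qed.
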